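(* Let $T>0$. Let $g\colon\mathbb{R}^{+}\to\mathbb{R}^{+}$ be a continuous function with $g(0)=0$ and $g(s)>0$ for $s>0$. Let $a\in L^{1}([0,T])$ satisfy: (i) there exist $m\ge1$ closed and pairwise disjoint intervals $I_1,\dots,I_m\subseteq[0,T]$ such that, for $i=1,\dots,m$, $a(x)\ge0$ for a.e. $x\in I_i$ with $a\not\equiv0$ on $I_i$, and $a(x)\le0$ for a.e. $x\in[0,T]\setminus\bigcup_{i=1}^{m}I_i$; (ii) $\int_{0}^{T}a(x)\,dx<0$. For $i=1,\dots,m$ let $\lambda_1^i$ be the first eigenvalue of $\varphi''+\lambda a(x)\varphi=0$, $\varphi|_{\partial I_i}=0$. Suppose also that $g$ is regularly oscillating at zero and satisfies \[ \lim_{s\to0^{+}}\frac{g(s)}{s}=0\quad\text{and}\quad\liminf_{s\to+\infty}\frac{g(s)}{s}>\max_{i=1,\dots,m}\lambda_1^i. \] Then the problem \[ u''+a(x)g(u)=0\ \text{ on }(0,T),\qquad\mathscr{B}(u,u')=\underline{0}, \] has at least one positive solution, where $\mathscr{B}(u,u')=\underline{0}$ denotes either of the two boundary conditions (Neumann or periodic) described in the context.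
   Context: $\mathbb{R}^{+}=[0,+\infty)$. The boundary operator is either $\mathscr{B}(u,u')=(u'(0),u'(T))$ (Neumann) or $\mathscr{B}(u,u')=(u(T)-u(0),u'(T)-u'(0))$ (periodic); the statement holds for each of the two choices. A solution is a continuously differentiable function $u\colon[0,T]\to\mathbb{R}$ with $u'$ absolutely continuous, satisfying the equation for a.e. $x\in[0,T]$ and the boundary condition. A positive solution is a solution with $u(x)>0$ for every $x\in[0,T]$. The function $g$ is regularly oscillating at zero if $\lim_{s\to0^{+},\,\omega\to1}\frac{g(\omega s)}{g(s)}=1$ (joint limit). ''$a\not\equiv0$ on $I_i$'' means that $a$ is not a.e. zero on $I_i$. The $\liminf$ may be $+\infty$. *)

(* Defs.v *)
From HB Require Import structures.
From mathcomp Require Import all_boot all_order all_algebra.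
From mathcomp Require Import all_classical all_reals all_analysis.

Set Implicit Arguments.
Unset Strict Implicit.
Unset Printing Implicit Defensive.

Import Order.TTheory GRing.Theory Num.Theory.
Import numFieldNormedType.Exports.

Local Open Scope classical_set_scope.
Local Open Scope ring_scope.

(* The derivative of f at x relative to A: for A = `[al, be] this is the
   two-sided derivative at interior points and the one-sided derivative at the
   endpoints, and it only depends on the values of f on A. *)
Definition is_derive_on (R : realType) (A : set R) (f : R -> R) (x d : R) :=
  (f y - f x) / (y - x) @[y --> within A x^'] --> d.

Definition abs_continuous_on (R : realType) (al be : R) (f : R -> R) :=
  forall e : R, 0 < e -> exists2 d : R, 0 < d &
    forall (n : nat) (p q : 'I_n -> R),
      (forall i, al <= p i <= q i /\ q i <= be) ->
      trivIset [set: 'I_n] (fun i => [set` `]p i, q i[]) ->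
      \sum_(i < n) (q i - p i) < d ->
      \sum_(i < n) `|f (q i) - f (p i)| < e.

(* The equation is u'' + F(x, u) = 0; the clause on u' carries the existence of
   w = u''(x), for almost every x. *)
Definition ode_sol (R : realType) (al be : R) (F : R -> R -> R)
    (u u' : R -> R) :=
  [/\ {in `[al, be], forall x, is_derive_on `[al, be] u x (u' x)},
      {within `[al, be], continuous u'},
      abs_continuous_on al be u' &
      {ae @lebesgue_measure R, forall x, x \in `[al, be] ->
        exists2 w, is_derive_on `[al, be] u' x w & w + F x (u x) = 0}].

Definition is_eigenvalue (R : realType) (a : R -> R) (al be lam : R) :=
  exists phi phi' : R -> R,
    [/\ ode_sol al be (fun x s => lam * a x * s) phi phi',
        phi al = 0, phi be = 0 & exists2 x, x \in `[al, be] & phi x != 0].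

(* Meant for a >= 0 a.e. on `[al, be]: all eigenvalues are then positive and the
   first one is the least. *)
Definition is_first_eigenvalue (R : realType) (a : R -> R) (al be lam : R) :=
  is_eigenvalue a al be lam /\
  forall lam', is_eigenvalue a al be lam' -> lam <= lam'.

(* p = (s, omega); omega = 1 is not excluded, the quotient being 1 there. *)
Definition regularly_oscillating_at0 (R : realType) (g : R -> R) :=
  g (p.2 * p.1) / g p.1 @[p --> filter_prod (0:R)^'+ (nbhs (1:R))] --> (1:R).

Inductive boundary_type := Neumann | Periodic.

Definition boundary_op (R : realType) (T : R) (b : boundary_type)
    (u u' : R -> R) : R * R :=
  match b with
  | Neumann => (u' 0, u' T)
  | Periodic => (u T - u 0, u' T - u' 0)
  end.

Definition positive_solution (R : realType) (T : R) (b : boundary_type)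
    (a g u : R -> R) :=
  (exists2 u', ode_sol 0 T (fun x s => a x * g s) u u' &
     boundary_op T b u u' = (0, 0)) /\
  {in `[0, T], forall x, 0 < u x}.

(* Main.v *)
(* Split [0, T] into N cells of length h and replace the weight by its integrals
   a_k over the cells. The discrete problem d2 e = h a_k g(e_k), where
   d2 e = 2 e_k - e_(k-1) - e_(k+1) with ghost nodes encoding the boundary
   condition, is the fixed point equation of an explicit Euler step F, a
   self-map of the cone of nonnegative vectors.
   - On a small sphere F x = mu x forces mu < 1: otherwise, since g(s) = o(s), x
     is almost constant, so by regular oscillation sum a_k g(x_k) is close to
     g(|x|) times the integral of a, hence negative; but that sum must be >= 0.
   - Solutions of the equation with an extra forcing t max(a_k, 0), t >= 0, are
     bounded: the maximum is attained at a cell meeting some I_i, by concavity e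
     is large inside I_i, and a discrete Sturm comparison with an eigenfunction
     on one of its nodal intervals gives a contradiction.
   Thus F expands the cone and has a fixed point between the two spheres. This
   follows from Brouwer's theorem, which is obtained from the combinatorial
   argument of Scarf, in the form given by Petri and Voorneveld. All bounds are
   uniform in N, and Tychonoff's theorem provides a limit solution. It has no
   zero because g(s) <= K s. *)
Require Import Defs.
From HB Require Import structures.
From mathcomp Require Import all_boot all_order all_algebra.
From mathcomp Require Import zify ring lra.

Set Implicit Arguments.
Unset Strict Implicit.
Unset Printing Implicit Defensive.

(** * Brouwer's theorem *)

(** Under both boundary conditions the constants are in the kernel of the second difference, so the
    equation cannot be turned into a fixed point problem by inverting its linear part; an explicit
    Euler step needs no inverse. For it [F x = mu *: x] reads [d2 e + kappa * e = h * a * g(e)] with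
    [kappa = (mu - 1) / eps], and summation over the nodes removes [d2]: the sign of [mu - 1]
    becomes that of a weighted sum of values of [g]. Regular oscillation is what turns [x_k / |x|]
    close to 1 into [g(x_k) / g(|x|)] close to 1, however fast [g] vanishes at 0. The weight is only
    integrable, hence cell integrals instead of point values. The comparison on large solutions uses
    a truncated polygon of the continuous eigenfunction rather than discrete eigenvectors, so no
    convergence of discrete eigenvalues enters; the gap between the eigenvalue and the slope of [g]
    at infinity absorbs every error of discretisation. The limit is taken in the integrated form
    [u' = c - A], with [A] a primitive of [a * g(u)]; the second derivative is recovered almost
    everywhere only at the end. *)

Section Scarf.
Variables (P : finType) (n : nat).
Local Notation I := 'I_n.+2.
Variable rk : I -> P -> nat.
Hypothesis rk_inj : forall i, injective (rk i).
Variable e : I -> P.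
Hypothesis e_inj : injective e.
Hypothesis e_min : forall i p, rk i (e i) <= rk i p.
Hypothesis e_top :
  forall i j p, j != i -> p \notin codom e -> rk i p < rk i (e j).
Variable col : P -> I.
Hypothesis col_e : forall i, col (e i) = i.
Variable p0 : P.
Hypothesis p0Ne : p0 \notin codom e.

(** Reading the ranks as coordinates, no point of [P] lies strictly above the minimum of [S] in all
    of them. Dominant sets of [n.+2] points, the rooms, act as the top cells of a triangulation,
    those of [n.+1] points as their walls. *)
Definition dominant (S : {set P}) :=
  [forall p, [exists i, [forall q in S, rk i p <= rk i q]]].

Lemma dominantP (S : {set P}) :
  reflect (forall p, exists i, forall q, q \in S -> rk i p <= rk i q)
          (dominant S).
Proof.
apply: (iffP forallP) => H p.
  by have /existsP[i /forall_inP Hi] := H p; exists i.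
by have [i Hi] := H p; apply/existsP; exists i; apply/forall_inP.
Qed.

Definition rooms (D : {set P}) :=
  [set S : {set P} | [&& dominant S, #|S| == n.+2 & D \subset S]].

Definition argmin_rk (D : {set P}) i :=
  if [pick p in D] is Some q0 then [arg min_(p < q0 in D) rk i p] else p0.

Lemma argmin_rkP (D : {set P}) i : D != set0 ->
  argmin_rk D i \in D /\ (forall q, q \in D -> rk i (argmin_rk D i) <= rk i q).
Proof.
case/set0Pn => q qD; rewrite /argmin_rk; case: pickP => [q0 q0D|/(_ q)].
  by case: arg_minnP.
by rewrite qD.
Qed.

(** The candidates for entering [D] when order [k] alone is given up: every other order keeps its
    minimiser over [D]. *)
Definition improving (D : {set P}) k :=
  [set x | [forall l, (l != k) ==> (rk l (argmin_rk D l) < rk l x)]].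

Lemma improvingP (D : {set P}) k x :
  reflect (forall l, l != k -> rk l (argmin_rk D l) < rk l x)
    (x \in improving D k).
Proof.
rewrite inE; apply: (iffP forallP) => H l; first exact/implyP.
by apply/implyP/H.
Qed.

(** By dominance each point of [D] is minimal in [D] for some order, so two of the [n.+2] orders,
    [i] and [j], share a minimiser. A room around [D] adds a point that becomes minimal for one of
    these two, [k], and dominance forces it to be the [rk k]-greatest element of [improving D k]: at
    most one choice for each. *)
Lemma rooms_improving (D : {set P}) : dominant D -> #|D| = n.+1 ->
  exists i j, [/\ i != j, argmin_rk D i = argmin_rk D j &
   #|rooms D| = (improving D i != set0) + (improving D j != set0)].
Proof.
move=> domD cardD.
have D0 : D != set0 by rewrite -card_gt0 cardD.
pose m i := argmin_rk D i.
have mD i : m i \in D by have [] := argmin_rkP i D0.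
have mmin i q : q \in D -> rk i (m i) <= rk i q.
  by have [_ h] := argmin_rkP i D0; exact: h.
have msurj y : y \in D -> exists i, y = m i.
  move=> yD; have [i Hi] := dominantP _ domD y.
  exists i; apply: (@rk_inj i); apply/eqP; rewrite eqn_leq Hi ?mD //=.
  exact: mmin.
have /injectivePn[i [j ij mij]] : ~~ injectiveb m.
  apply/negP => /injectiveP minj; have E := card_imset predT minj.
  have : #|m @: predT| <= #|D|.
    by apply/subset_leq_card/subsetP => _ /imsetP[k _ ->].
  by rewrite E cardD card_ord ltnn.
have jsurj k y : k \in [set i; j] -> y \in D -> exists2 l, l != k & y = m l.
  move=> kij /msurj[l ->]; have [->|lk] := eqVneq l k; last by exists l.
  by case/set2P: kij => ->; [exists j; rewrite // eq_sym|exists i].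
have notimp k x : k \in [set i; j] -> x \in improving D k -> x \notin D.
  move=> kij /improvingP xi; apply/negP => /(jsurj k _ kij)[l lk xl].
  by have := xi l lk; rewrite xl ltnn.
have disj x : x \in improving D i -> x \in improving D j -> False.
  move=> /improvingP xi /improvingP xj.
  have [l Hl] := dominantP _ domD x.
  have := Hl _ (mD l); rewrite leqNgt => /negP; apply.
  have [li|li] := eqVneq l i; last exact: xi.
  by apply: xj; rewrite li.
have roomE S : S \in rooms D <-> exists x k, [/\ k \in [set i; j],
     x \in improving D k, forall z, z \in improving D k -> rk k z <= rk k x
     & S = x |: D].
  split.
    rewrite inE => /and3P[/dominantP domS /eqP cardS DS].
    have /cards1P[x Sx] : #|S :\: D| == 1.
      by rewrite cardsD (setIidPr DS) cardS cardD subSnn.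
    have xS : x \in S by have := set11 x; rewrite -Sx inE => /andP[].
    have xD : x \notin D by have := set11 x; rewrite -Sx inE => /andP[].
    have SE : S = x |: D by rewrite -Sx setUC setDE setUIr setUCr setIT;
       apply/esym/setUidPr.
    have [k Hk] := domS x.
    (* The orders in [L], whose minimiser over [D] stays below [x], have minimisers covering [D], so
       there are at least [n.+1] of them; as [k] is not one, they are all the others. *)
    have Lk l : l != k -> rk l (m l) < rk l x.
      pose L := [set l | rk l (m l) < rk l x].
      have LD : m @: L = D.
        apply/eqP; rewrite eqEsubset; apply/andP; split.
          by apply/subsetP => _ /imsetP[? _ ->].
        apply/subsetP => y yD; have [a Ha] := domS y.
        have ya : y = m a.
          apply: (@rk_inj a); apply/eqP; rewrite eqn_leq Ha ?(subsetP DS)//=.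
          exact: mmin.
        apply/imsetP; exists a => //; rewrite inE -ya.
        rewrite ltn_neqAle Ha // andbT.
        apply/negP => /eqP/rk_inj yx; by rewrite -yx yD in xD.
      have kL : k \notin L by rewrite inE -leqNgt Hk // (subsetP DS).
      have : #|[set~ k] :\: L| == 0.
        have sub : L \subset [set~ k].
          by apply/subsetP => a aL; rewrite !inE; apply/negP => /eqP ak;
             rewrite -ak aL in kL.
        rewrite cardsD (setIidPr sub) cardsC1 card_ord subn_eq0 /=.
        by apply: leq_trans (leq_imset_card m L); rewrite LD cardD.
      rewrite cards_eq0 setD_eq0 => /subsetP sub lk.
      by have := sub l; rewrite !inE; apply.
    (* Were [k] neither [i] nor [j], the minimisers for the orders other than [k] and [i] would
       still cover [D], and these orders are only [n]. *)
    have kij : k \in [set i; j].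
      apply/negPn/negP; rewrite !inE => kij.
      have : D \subset m @: ([set~ k] :\ i).
        apply/subsetP => y yD; have [a Ha] := domS y.
        have ya : y = m a.
          apply: (@rk_inj a); apply/eqP; rewrite eqn_leq Ha ?(subsetP DS)//=.
          exact: mmin.
        have ak : a != k.
          apply/negP => /eqP ak; have := Ha _ xS; rewrite ak => yx.
          have := Hk _ (subsetP DS _ yD) => xy.
          have /rk_inj yx' : rk k x = rk k y by apply/eqP; rewrite eqn_leq xy.
          by rewrite yx' yD in xD.
        apply/imsetP; have [ai|ai] := eqVneq a i; last first.
          by exists a; rewrite // !inE ai.
        exists j; last by rewrite ya ai.
        by move: kij; rewrite !inE negb_or (eq_sym j k) (eq_sym j i) ij => /andP[].
      move/subset_leq_card => /leq_trans /(_ (leq_imset_card _ _)).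
      have := cardsD1 i [set~ k]; rewrite cardsC1 card_ord cardD !inE.
      have -> : i != k by move: kij; rewrite negb_or eq_sym => /andP[].
      by rewrite add1n /= => -[<-]; rewrite ltnn.
    exists x, k; split=> //; first exact/improvingP.
    move=> z /improvingP zk; rewrite leqNgt; apply/negP => xz.
    have [l Hl] := domS z; have [lk|lk] := eqVneq l k.
      by have := Hl _ xS; rewrite lk leqNgt xz.
    by have := Hl _ (subsetP DS _ (mD l)); rewrite leqNgt zk.
  case=> x [k [kij xk xmax ->]].
  have xD := notimp _ _ kij xk.
  rewrite inE subsetUr cardsU1 xD cardD eqxx !andbT.
  apply/dominantP => p; have [pk|] := boolP (p \in improving D k).
    have [l Hl] := dominantP _ domD p.
    exists l => q; rewrite !inE => /orP[/eqP ->|]; last exact: Hl.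
    have [->|lk] := eqVneq l k; first exact: xmax.
    have := Hl _ (mD l); rewrite leqNgt => /negP; case.
    exact: (improvingP _ _ _ pk).
  rewrite inE negb_forall => /existsP[l]; rewrite negb_imply -leqNgt => /andP[lk pl].
  exists l => q; rewrite !inE => /orP[/eqP ->|]; last first.
    by move=> qD; apply: leq_trans pl (mmin _ _ qD).
  by apply: leq_trans pl (ltnW _); exact: (improvingP _ _ _ xk).
exists i, j; split=> //.
pose mx k (x : P) := [arg max_(z > x in improving D k) rk k z].
have mxP k x : x \in improving D k -> mx k x \in improving D k /\
   forall z, z \in improving D k -> rk k z <= rk k (mx k x).
  by move=> xk; rewrite /mx; case: arg_maxnP.
have uniqmx k x y : x \in improving D k -> y \in improving D k ->
   (forall z, z \in improving D k -> rk k z <= rk k x) ->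
   (forall z, z \in improving D k -> rk k z <= rk k y) -> x = y.
  move=> xk yk xm ym; apply: (@rk_inj k); apply/eqP.
  by rewrite eqn_leq xm // ym.
have iij : i \in [set i; j] by rewrite set21.
have jij : j \in [set i; j] by rewrite set22.
have [Zi|/set0Pn[xi xiZ]] := eqVneq (improving D i) set0;
have [Zj|/set0Pn[xj xjZ]] := eqVneq (improving D j) set0.
- apply/eqP; rewrite cards_eq0; apply/eqP/setP => S; rewrite in_set0.
  apply/negP => /roomE[x [k [/set2P[]-> + _ _]]]; by rewrite (Zi, Zj) inE.
- have [y1 y2] := mxP _ _ xjZ; apply/eqP/cards1P; exists (mx j xj |: D).
  apply/setP => S; rewrite [RHS]inE; apply/idP/eqP.
    move=> /roomE[x [k [/set2P[]->]]]; first by rewrite Zi inE.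
    by move=> h1 h2 ->; rewrite (uniqmx _ _ _ h1 y1 h2 y2).
  by move=> ->; apply/roomE; exists (mx j xj), j.
- have [y1 y2] := mxP _ _ xiZ; apply/eqP/cards1P; exists (mx i xi |: D).
  apply/setP => S; rewrite [RHS]inE; apply/idP/eqP.
    move=> /roomE[x [k [/set2P[]->]]]; last by rewrite Zj inE.
    by move=> h1 h2 ->; rewrite (uniqmx _ _ _ h1 y1 h2 y2).
  by move=> ->; apply/roomE; exists (mx i xi), i.
- have [y1 y2] := mxP _ _ xiZ; have [z1 z2] := mxP _ _ xjZ.
  apply/eqP/cards2P; exists (mx i xi |: D), (mx j xj |: D); split.
    apply/negP => /eqP E.
    have : mx i xi \in mx j xj |: D by rewrite -E setU11.
    rewrite !inE (negbTE (notimp _ _ iij y1)) orbF => /eqP E'.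
    by apply: (disj _ y1); rewrite E'.
  apply/setP => S; rewrite [RHS]inE !in_set1; apply/idP/orP.
    move=> /roomE[x [k [/set2P[]->]]] h1 h2 ->; [left|right].
      by rewrite (uniqmx _ _ _ h1 y1 h2 y2).
    by rewrite (uniqmx _ _ _ h1 z1 h2 z2).
  case=> /eqP ->; apply/roomE; first by exists (mx i xi), i.
  by exists (mx j xj), j.
Qed.

(** Walls with all colours but [ord_max], each shown once since the cardinals agree. Pairs of a door
    and a room around it are counted modulo 2. *)
Definition door (D : {set P}) :=
  [&& dominant D, #|D| == n.+1 & col @: D == [set~ ord_max]].

Let E0 := e @: [set~ ord_max].

Lemma door_E0 : door E0.
Proof.
apply/and3P; split.
- apply/dominantP => p; have [/codomP[i ->]|pe] := boolP (p \in codom e).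
    by exists i => q _; exact: e_min.
  exists ord_max => q /imsetP[j]; rewrite !inE => jm ->.
  by apply/ltnW/e_top.
- by rewrite card_imset // cardsC1 card_ord.
- apply/eqP/setP => i; apply/imsetP/idP => [[_ /imsetP[j jm ->]]|im].
    by rewrite col_e => ->.
  by exists (e i); rewrite ?col_e //; apply/imsetP; exists i.
Qed.

(** In [E0] the order [ord_max] shares its minimiser with some [j0]. Giving up [ord_max] lets [p0]
    enter; giving up [j0] lets nothing enter, because in order [ord_max] only points [e l] can be
    above [e j0], and each of them is minimal in its own order. *)
Lemma card_rooms_E0 : #|rooms E0| = 1.
Proof.
have /and3P[domE /eqP cardE _] := door_E0.
have E00 : E0 != set0 by rewrite -card_gt0 cardE.
have mE l : l != ord_max -> argmin_rk E0 l = e l.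
  move=> lm; have [h1 h2] := argmin_rkP l E00.
  apply: (@rk_inj l); apply/eqP; rewrite eqn_leq e_min andbT h2 //.
  by apply/imsetP; exists l; rewrite ?inE.
have [/imsetP[j0]] := argmin_rkP ord_max E00.
rewrite !inE => j0m j0E mmin.
have imax : improving E0 ord_max != set0.
  apply/set0Pn; exists p0; apply/improvingP => l lm.
  rewrite mE // ltn_neqAle e_min andbT; apply/negP => /eqP/rk_inj ep.
  by move: p0Ne; rewrite -ep codom_f.
have imj : improving E0 j0 = set0.
  apply/setP => x; rewrite [RHS]inE; apply/negP => /improvingP xj.
  have := xj ord_max; rewrite eq_sym => /(_ j0m); rewrite j0E => jx.
  have [/codomP[l xl]|xe] := boolP (x \in codom e).
    have [lj|lj] := eqVneq l j0; first by move: jx; rewrite xl lj ltnn.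
    have := xj _ lj; have [lm|lm] := eqVneq l ord_max.
      by move: jx; rewrite xl lm ltnNge e_min.
    by rewrite mE // xl ltnn.
  by have := e_top j0m xe; rewrite ltnNge (ltnW jx).
have [i [j [ij mij ->]]] := rooms_improving domE cardE.
have [im|im] := eqVneq i ord_max; have [jm|jm] := eqVneq j ord_max.
- by rewrite im jm eqxx in ij.
- move: mij; rewrite im (mE _ jm) j0E => /e_inj <-.
  by rewrite imj imax eqxx.
- move: mij; rewrite jm (mE _ im) j0E => /e_inj ->.
  by rewrite imj imax eqxx.
- by move: mij; rewrite !mE // => /e_inj ijE; rewrite ijE eqxx in ij.
Qed.

(** Such a door contains a point [y] outside the range of [e], as its colours would otherwise make
    it [E0]. Every [e k] is above [y] in all orders but [k], so either of the two shared orders can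
    be given up. *)
Lemma card_rooms_door D : door D -> D != E0 -> #|rooms D| = 2.
Proof.
move=> /and3P[domD /eqP cardD /eqP colD] DE.
have D0 : D != set0 by rewrite -card_gt0 cardD.
have [y yD ye] : exists2 y, y \in D & y \notin codom e.
  apply/exists_inP; apply: contraNT DE; rewrite negb_exists_in => /forall_inP H.
  rewrite eqEcard card_imset // cardsC1 card_ord cardD leqnn andbT.
  apply/subsetP => x xD; have := H _ xD; rewrite negbK => /codomP[l xl].
  have : col x \in col @: D by apply: imset_f.
  by rewrite xl col_e colD => lm; apply/imsetP; exists l.
have nz k : improving D k != set0.
  apply/set0Pn; exists (e k); apply/improvingP => l lk.
  have [_ mmin] := argmin_rkP l D0.
  by apply: leq_ltn_trans (mmin _ yD) _; apply: e_top; rewrite // eq_sym.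
by have [i [j [ij mij ->]]] := rooms_improving domD cardD; rewrite !nz.
Qed.

(** If [S] contains a door, its [n.+2] points show all colours but [ord_max], so exactly one colour
    occurs twice, at [y1] and [y2]; the doors of [S] are obtained by removing one of the two. *)
Lemma card_doors (S : {set P}) : dominant S -> #|S| = n.+2 ->
  col @: S != [set: I] ->
  ~~ odd #|[set D | door D & D \subset S]|.
Proof.
move=> domS cardS colS.
have [->|/set0Pn[D]] := eqVneq [set D | door D & D \subset S] set0.
  by rewrite cards0.
rewrite inE => /andP[/and3P[domD /eqP cardD /eqP colD] DS].
have doms (y : P) : dominant (S :\ y).
  apply/dominantP => p; have [i Hi] := dominantP _ domS p; exists i => q.
  by rewrite inE => /andP[_]; exact: Hi.
have colSE : col @: S = [set~ ord_max].
  apply/eqP; rewrite eqEsubset -{2}colD imsetS // andbT.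
  apply/subsetP => _ /imsetP[x xS ->]; rewrite !inE.
  apply: contraNN colS => /eqP cx; apply/eqP/setP => i; rewrite [RHS]inE.
  have [->|im] := eqVneq i ord_max; first by rewrite -cx imset_f.
  by apply: (subsetP (imsetS col DS)); rewrite colD !inE.
have /cards1P[y1 Sy1] : #|S :\: D| == 1.
  by rewrite cardsD (setIidPr DS) cardS cardD subSnn.
have y1S : y1 \in S by have := set11 y1; rewrite -Sy1 inE => /andP[].
have y1D : y1 \notin D by have := set11 y1; rewrite -Sy1 inE => /andP[].
have [y2 y2D cy] : exists2 y2, y2 \in D & col y1 = col y2.
  by apply/imsetP; rewrite colD -colSE imset_f.
have y2S := subsetP DS _ y2D.
have ny : y1 != y2 by apply/eqP => yy; rewrite yy y2D in y1D.
have crd y : y \in S -> #|S :\ y| = n.+1.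
  by move=> yS; have := cardsD1 y S; rewrite yS cardS add1n => -[].
have -> : [set D | door D & D \subset S] = [set S :\ y1; S :\ y2].
  apply/setP => D'; rewrite !inE; apply/andP/orP.
    move=> [/and3P[_ /eqP cardD' /eqP colD'] D'S].
    have /cards1P[y Sy] : #|S :\: D'| == 1.
      by rewrite cardsD (setIidPr D'S) cardS cardD' subSnn.
    have D'E : D' = S :\ y.
      by rewrite -Sy setDDr setDv set0U; apply/esym/setIidPr.
    have [yy1|yy1] := eqVneq y y1; first by left; rewrite D'E yy1.
    have [yy2|yy2] := eqVneq y y2; first by right; rewrite D'E yy2.
    have : #|col @: D'| <= #|D' :\ y1|.
      rewrite (_ : col @: D' = col @: (D' :\ y1)) ?leq_imset_card //.
      apply/eqP; rewrite eqEsubset (imsetS _ (subsetDl _ _)) andbT.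
      apply/subsetP => _ /imsetP[x xD' ->].
      have [->|xy] := eqVneq x y1; last by rewrite imset_f // !inE xy.
      by rewrite cy imset_f // D'E !inE eq_sym ny eq_sym yy2.
    have y1D' : y1 \in D' by rewrite D'E !inE eq_sym yy1.
    have := cardsD1 y1 D'; rewrite y1D' cardD' add1n => -[<-].
    by rewrite colD' cardsC1 card_ord ltnn.
  have side y y' : y \in S -> y' \in S -> y != y' -> col y = col y' ->
      door (S :\ y) /\ S :\ y \subset S.
    move=> yS y'S yy' c; split; last exact: subsetDl.
    apply/and3P; split=> //; first by rewrite crd.
    rewrite -colSE eqEsubset (imsetS _ (subsetDl _ _)) /=.
    apply/subsetP => _ /imsetP[x xS ->].
    have [->|xy] := eqVneq x y; last by rewrite imset_f // !inE xy.
    by rewrite c imset_f // !inE eq_sym yy'.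
  case=> /eqP ->; first exact: (side _ y2).
  by apply: (side _ y1); rewrite // eq_sym.
rewrite cards2; case: eqP => // /setP/(_ y1).
by rewrite !inE eqxx ny y1S.
Qed.

(* Doors and rooms form a graph in which only the door E0 and the rooms
   showing all colours have odd degree. *)
Lemma scarf : exists S : {set P},
  [/\ dominant S, #|S| = n.+2 & col @: S = [set: I]].
Proof.
pose room S := dominant S && (#|S| == n.+2).
have [/existsP[S /and3P[h1 /eqP h2 /eqP h3]]|none] :=
  boolP [exists S, [&& dominant S, #|S| == n.+2 & col @: S == [set: I]]].
  by exists S.
have ev : ~~ odd (\sum_(S | room S) #|[set D | door D & D \subset S]|).
  elim/big_ind : _ => // [x y|S /andP[domS /eqP cS]].
    by rewrite oddD => /negbTE -> /negbTE ->.
  apply: card_doors => //; apply: contraNN none => cc.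
  by apply/existsP; exists S; rewrite domS cS eqxx.
have od : odd (\sum_(D | door D) #|rooms D|).
  rewrite (bigD1 E0) ?door_E0 //= card_rooms_E0 oddD /=.
  elim/big_ind : _ => // [x y|D /andP[domD cD]]; last by rewrite card_rooms_door.
  by rewrite oddD => /negbTE -> /negbTE ->.
move: ev; rewrite (_ : (\sum_(S | _) _)%N = \sum_(D | door D) #|rooms D|) ?od //.
under eq_bigr do rewrite -sum1_card.
rewrite (exchange_big_dep door) /=; last by move=> S D _; rewrite inE => /andP[].
apply: eq_bigr => D dD; rewrite sum1_card; apply: eq_card => S.
by rewrite !inE unfold_in /= inE dD /= /room -andbA.
Qed.

End Scarf.

(* The artificial points [inr i] are minimal for their own order and above all
   of [X] for the other ones: they encode the absence of [i] from [C]. *)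
Lemma dominated_coalition (X : finType) (n : nat) (f : 'I_n.+2 -> X -> nat)
    (c : X -> 'I_n.+2) (x0 : X) : (forall i, injective (f i)) ->
  exists (C : {set 'I_n.+2}) (Y : {set X}),
    [/\ Y != set0, #|Y| = #|C|, forall i, i \in C -> exists2 y, y \in Y & c y = i &
     forall x, exists2 i, i \in C & forall y, y \in Y -> f i x <= f i y].
Proof.
move=> f_inj.
pose B := \max_i \max_x f i x.
have fB i x : f i x <= B.
  by apply: leq_trans (leq_bigmax (F := fun i => \max_x f i x) i);
     exact: leq_bigmax.
(* The shift by one reserves rank 0 for [inr i] in order [i]; the other artificial points start at
   [B.+2], above every [(f i x).+1], and the summand [j] keeps them distinct. *)
pose rk (i : 'I_n.+2) (p : X + 'I_n.+2) :=
  match p with inl x => (f i x).+1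
             | inr j => if j == i then 0 else B.+2 + j end.
pose col (p : X + 'I_n.+2) := match p with inl x => c x | inr j => j end.
have rk_inj i : injective (rk i).
  move=> [x|j] [y|k] /=.
  - by move=> [/f_inj ->].
  - by case: eqP => // _ h; have := fB i x; lia.
  - by case: eqP => // _ h; have := fB i y; lia.
  - case: eqP => [->|_]; case: eqP => [-> //|_] // h.
    by congr inr; apply/val_inj => /=; lia.
have NE x : inl x \notin codom (@inr X 'I_n.+2).
  by apply/negP => /codomP[].
have [] := @scarf (X + 'I_n.+2)%type n rk rk_inj inr _ _ _ col _ (inl x0) (NE x0).
- by move=> i j [].
- by move=> i p /=; rewrite eqxx.
- move=> i j [x|k] ji h /=; last by rewrite codom_f in h.
  by rewrite (negbTE ji); have := fB i x; lia.
- by [].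
move=> S [/dominantP domS cardS colS].
pose C := [set i | inr i \notin S].
pose Y := [set x | inl x \in S].
have cardYC : #|Y| = #|C|.
  have SE : S = (inl @: Y) :|: (inr @: ~: C).
    have hl x : (inl x \in [set @inr X 'I_n.+2 j | j in ~: C]) = false.
      by apply/negP => /imsetP[].
    have hr j : (inr j \in [set @inl X 'I_n.+2 x | x in Y]) = false.
      by apply/negP => /imsetP[].
    apply/setP => -[x|j]; rewrite !inE ?hl ?hr ?orbF mem_imset ?inE ?negbK //;
      by move=> ? ? [].
  have := cardS; rewrite {1}SE cardsU !card_imset; try by move=> ? ? [].
  rewrite (_ : _ :&: _ = set0) ?cards0 ?subn0; last first.
    by apply/setP => p; rewrite !inE; apply/negP => /andP[/imsetP[x _ ->] /imsetP[]].
  by have := cardsC C; rewrite card_ord; lia.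
(* An order [i] with [inr i] in [S] has minimum 0 over [S], so it cannot witness dominance for a
   point of [X]. *)
have dom x : exists2 i, i \in C & forall y, y \in Y -> f i x <= f i y.
  have [i Hi] := domS (inl x); exists i.
    by rewrite inE; apply/negP => /Hi /=; rewrite eqxx.
  by move=> y; rewrite inE => /Hi.
exists C, Y; split=> //.
- have [i iC _] := dom x0; rewrite -card_gt0 cardYC card_gt0.
  by apply/set0Pn; exists i.
- move=> i; rewrite inE => iS.
  have : i \in col @: S by rewrite colS inE.
  case/imsetP => -[x xS ->|j jS ij]; last by rewrite ij /= jS in iS.
  by exists x; rewrite // inE.
Qed.

(* By domination the minima over [Y] of the coordinates in [C] almost add up to
   [k.+1], hence the points of [Y] are close to each other. *)
Lemma grid_coalition (n k : nat) (c : {ffun 'I_n.+2 -> 'I_k.+2} -> 'I_n.+2) :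
  exists (C : {set 'I_n.+2}) (Y : {set {ffun 'I_n.+2 -> 'I_k.+2}}),
    [/\ Y != set0,
     forall y, y \in Y -> \sum_i (y i : nat) = k.+1,
     forall i, i \in C -> exists2 y, y \in Y & c y = i,
     forall y i, y \in Y -> i \notin C -> y i < n.+2 &
     forall y z i, y \in Y -> z \in Y -> y i < z i + n.+2].
Proof.
pose X := {x : {ffun 'I_n.+2 -> 'I_k.+2} | \sum_i (x i : nat) == k.+1}.
(* The enumeration breaks ties: each coordinate becomes a strict order refining the comparison of
   its values. *)
pose f (i : 'I_n.+2) (x : X) := (sval x i * #|{: X}| + enum_rank x)%N.
have f_inj i : injective (f i).
  move=> x y; rewrite /f => h; apply/enum_rank_inj/val_inj => /=.
  have X0 : (0 < #|{: X}|)%N by apply/card_gt0P; exists x.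
  have := congr1 (modn^~ #|{: X}|) h.
  by rewrite !modnMDl !modn_small // ltn_ord.
have f_lt i (x y : X) : (sval x i < sval y i)%N -> (f i x < f i y)%N.
  rewrite /f; have : enum_rank x < #|{: X}| by apply: ltn_ord.
  by move=> ? ?; nia.
have mkX (v : 'I_n.+2 -> nat) : \sum_i v i = k.+1 ->
    exists x : X, forall i, sval x i = v i :> nat.
  move=> sv; have vk i : v i < k.+2.
    by rewrite ltnS -sv (bigD1 i) //= leq_addr.
  pose u := [ffun i => inord (v i) : 'I_k.+2].
  have su : \sum_i (u i : nat) == k.+1.
    by apply/eqP; rewrite -[RHS]sv; apply: eq_bigr => i _; rewrite ffunE inordK.
  by exists (exist _ u su) => i /=; rewrite ffunE inordK.
have [x0 _] : exists x : X, forall i, sval x i = (i == ord0) * k.+1 :> nat.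
  by apply: mkX; rewrite (bigD1 ord0) //= big1 ?addn0 ?mul1n // => i /negbTE ->.
have [C [Y [/set0Pn[y0 y0Y] cardYC colY dom]]] :=
  dominated_coalition (fun x => c (sval x)) x0 f_inj.
pose m i := sval ([arg min_(y < y0 in Y) (sval y i : nat)]) i : nat.
have mmin i y : y \in Y -> m i <= sval y i.
  by rewrite /m; case: arg_minnP => // z zY h /h.
have m_att i : exists2 y, y \in Y & m i = sval y i.
  rewrite /m; case: arg_minnP => // z zY h; by exists z.
have sumX (y : X) : \sum_i (sval y i : nat) = k.+1 by apply/eqP/(valP y).
(* Otherwise some grid point strictly exceeds [m i] for every [i] in [C], against domination; the
   surplus [d] is put on the coordinate [i0] to bring the sum to [k.+1]. *)
have sm : k.+1 < \sum_(i in C) (m i).+1.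
  rewrite ltnNge; apply/negP => smle.
  have [i0 i0C _] := dom x0.
  pose d := k.+1 - \sum_(i in C) (m i).+1.
  have H0 := mkX (fun i => (i \in C) * (m i).+1 + (i == i0) * d).
  have /H0[x Hx] : \sum_i ((i \in C) * (m i).+1 + (i == i0) * d) = k.+1.
    rewrite big_split /= [X in _ + X](bigD1 i0) //= [X in _ + (_ + X)]big1.
      rewrite eqxx mul1n addn0 [X in X + _](_ : _ = \sum_(i in C) (m i).+1).
        by rewrite /d subnKC.
      rewrite [RHS]big_mkcond; apply: eq_bigr => i _.
      by case: (i \in C); rewrite ?mul1n ?mul0n.
    by move=> i /negbTE ->.
  have [i iC Hi] := dom x; have [y yY my] := m_att i.
  have := Hi _ yY; rewrite leqNgt f_lt // -my Hx iC mul1n; lia.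
have smn : k.+1 < \sum_(i in C) m i + n.+2.
  apply: leq_trans sm _; under eq_bigr do rewrite -addn1.
  rewrite big_split /= leq_add2l sum1_card.
  by apply: leq_trans (max_card _) _; rewrite card_ord.
have key y i : y \in Y -> sval y i < (i \in C) * m i + n.+2.
  move=> yY; have := sumX y; rewrite (bigD1 i) //= => E.
  have H : \sum_(j in C | j != i) m j <= \sum_(j | j != i) (sval y j : nat).
    rewrite [leqLHS](_ : _ = \sum_(j | j != i) (j \in C) * m j).
      by apply: leq_sum => j _; case: (j \in C); rewrite ?mul1n ?mmin.
    rewrite big_mkcondl; apply: eq_bigr => j _.
    by case: (j \in C); rewrite ?mul1n ?mul0n.
  have : \sum_(i in C) m i = (i \in C) * m i + \sum_(j in C | j != i) m j.
    have [iC|iC] := boolP (i \in C); first by rewrite (bigD1 i) //= mul1n.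
    rewrite mul0n add0n; apply: eq_bigl => j.
    by case: eqP => [->|]; rewrite ?andbT // (negbTE iC).
  have arith (u v c' M M' q k' : nat) : u + v = k' -> M <= v ->
    k' < M' + q -> M' = c' + M -> u < c' + q by lia.
  exact: arith E H smn.
exists C, (sval @: Y); split.
- by apply/set0Pn; exists (sval y0); apply: imset_f.
- by move=> _ /imsetP[y _ ->].
- by move=> i /colY[y yY <-]; exists (sval y) => //; apply: imset_f.
- by move=> _ i /imsetP[y yY ->] /negbTE iC; have := key _ i yY; rewrite iC.
- move=> _ _ i /imsetP[y yY ->] /imsetP[z zY ->].
  have := key _ i yY; have := mmin i _ zY.
  case: (i \in C); rewrite ?mul1n ?mul0n; lia.
Qed.

From mathcomp Require Import all_classical all_reals all_analysis.

Import Order.TTheory GRing.Theory Num.Theory.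
Import numFieldNormedType.Exports.

Local Open Scope classical_set_scope.
Local Open Scope ring_scope.

(** * Brouwer's theorem on the simplex and fixed points in a cone *)

Lemma le_coord_norm (R : realType) n (v : 'rV[R]_n) j : `|v ord0 j| <= `|v|.
Proof.
rewrite [leRHS]/Num.norm /= mx_normrE.
by apply/bigmax_geP; right => /=; exists (ord0, j).
Qed.

Lemma norm_le_coord (R : realType) n (v : 'rV[R]_n) (d : R) : 0 <= d ->
  (forall j, `|v ord0 j| <= d) -> `|v| <= d.
Proof.
move=> d0 vd; rewrite [leLHS]/Num.norm /= mx_normrE.
by apply/bigmax_leP; split=> // -[i j] _ /=; rewrite ord1.
Qed.

Lemma norm_coord (R : realType) n (v : 'rV[R]_n.+1) :
  exists j, `|v| = `|v ord0 j|.
Proof.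
have [->|] := eqVneq v 0; first by exists ord0; rewrite mxE !normr0.
rewrite -normr_eq0 => /mx_norm_neq0[[i j] /=]; rewrite ord1 => H.
by exists j.
Qed.

Lemma cvg_sumr (R : realType) (T : Type) (F : set_system T) (I : Type)
    (r : seq I) (f : I -> T -> R) (l : I -> R) : Filter F ->
  (forall i, f i x @[x --> F] --> l i) ->
  \sum_(i <- r) f i x @[x --> F] --> \sum_(i <- r) l i.
Proof. by move=> FF fl; apply: cvg_big => //; exact: add_continuous. Qed.

Definition simplex (R : realType) n : set 'rV[R]_n :=
  [set x | (forall i, 0 <= x ord0 i) /\ \sum_i x ord0 i = 1].

Lemma simplex_compact (R : realType) n : compact (@simplex R n).
Proof.
rewrite (_ : simplex (n:=n) = [set v : 'rV[R]_n | forall i, v ord0 i \in `[0, 1]]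
  `&` (fun v : 'rV[R]_n => \sum_i v ord0 i) @^-1` [set 1]); last first.
  apply/seteqP; split => x /= [x1 x2]; split=> // i.
    rewrite in_itv /= x1 -x2 (bigD1 i) //= lerDl.
    by apply: sumr_ge0 => j _; exact: x1.
  by have := x1 i; rewrite in_itv => /andP[].
apply: compact_closedI.
  have := (@rV_compact R n (fun=> `[0, 1]%classic)). apply=> _.
  exact: segment_compact.
apply: preimage_closed; last exact: closed_eq.
move=> x _; apply: cvg_sumr => [|i]; [exact: nbhs_filter|exact: coord_continuous].
Qed.

(** A grid point is coloured by a coordinate that [f] does not decrease; one exists because both
    sums are 1. In a coalition of a fine grid each coordinate of [C] is not decreased at some point
    of [Y], the others are almost zero, and [Y] is small. At a cluster point [l] no coordinate is
    decreased by [f], so none is increased either. *)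
Lemma brouwer_simplex (R : realType) n (f : 'rV[R]_n.+2 -> 'rV[R]_n.+2) :
  (forall x, simplex x -> {for x, continuous f}) ->
  (forall x, simplex x -> simplex (f x)) ->
  exists x, simplex x /\ f x = x.
Proof.
move=> fc fS.
pose sc k (y : {ffun 'I_n.+2 -> 'I_k.+2}) : 'rV[R]_n.+2 :=
  \row_i ((y i)%:R / k.+1%:R).
have k0 k : 0 < k.+1%:R :> R by rewrite ltr0n.
have scS k (y : {ffun 'I_n.+2 -> 'I_k.+2}) : (\sum_i (y i : nat))%N = k.+1 ->
    simplex (sc k y).
  move=> sy; split=> [i|]; first by rewrite mxE divr_ge0.
  under eq_bigr do rewrite mxE.
  by rewrite -mulr_suml -natr_sum sy divff // gt_eqF.
pose c k (y : {ffun 'I_n.+2 -> 'I_k.+2}) : 'I_n.+2 :=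
  odflt ord0 [pick i | (sc k y) ord0 i <= f (sc k y) ord0 i].
have sum_lt x : simplex x -> (forall i, f x ord0 i < x ord0 i) -> False.
  move=> xS lt; have [_ fs] := fS _ xS; have [_ xs] := xS.
  suff : \sum_i f x ord0 i < \sum_i x ord0 i by rewrite xs fs ltxx.
  rewrite (bigD1 ord0) // [ltRHS](bigD1 ord0) //= ltr_leD //.
  by apply: ler_sum => i _; exact/ltW.
have cP k (y : {ffun 'I_n.+2 -> 'I_k.+2}) : (\sum_i (y i : nat))%N = k.+1 ->
    (sc k y) ord0 (c k y) <= f (sc k y) ord0 (c k y).
  move=> sy; rewrite /c; case: pickP => //= H; exfalso.
  by apply: (sum_lt (sc k y) (scS _ _ sy)) => i; rewrite ltNge H.
pose P k (x : 'rV[R]_n.+2) := simplex x /\ forall i,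
   x ord0 i < n.+2%:R / k.+1%:R \/ exists y, [/\ simplex y,
     y ord0 i <= f y ord0 i & `|x - y| <= n.+2%:R / k.+1%:R].
have /choice[x Px] : forall k, exists x, P k x.
  move=> k; have [C [Y [/set0Pn[y0 y0Y] Ysum YC YnC Ycl]]] :=
    grid_coalition (c k).
  exists (sc k y0); split; first exact/scS/Ysum.
  move=> i; have [iC|iC] := boolP (i \in C); last first.
    by left; rewrite mxE ltr_pM2r ?invr_gt0 // ltr_nat YnC.
  right; have [y yY yi] := YC _ iC; exists (sc k y); split.
  - exact/scS/Ysum.
  - by rewrite -yi; exact/cP/Ysum.
  - apply: norm_le_coord; first by rewrite divr_ge0.
    move=> j; rewrite !mxE -mulrBl normrM [X in _ * X]ger0_norm;
      last by rewrite invr_ge0.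
    rewrite ler_pM2r ?invr_gt0 //.
    have := Ycl _ _ j yY y0Y; have := Ycl _ _ j y0Y yY.
    move/ltnW; rewrite -(ler_nat R) natrD => h1.
    move/ltnW; rewrite -(ler_nat R) natrD => h2.
    by rewrite ler_norml; apply/andP; split; lra.
have [l [lS lcl]] : simplex (n:=n.+2) `&` cluster (x @ \oo) !=set0.
  apply: simplex_compact.
  by exists 0%N => // k _; have [] := Px k.
have [lp ls] := lS; have [fp fs] := fS _ lS.
exists l; split=> //.
suff H i : l ord0 i <= f l ord0 i.
  apply/rowP => i; apply/eqP; rewrite eq_le H andbT leNgt; apply/negP => lt.
  suff : \sum_i l ord0 i < \sum_i f l ord0 i by rewrite ls fs ltxx.
  rewrite (bigD1 i) // [ltRHS](bigD1 i) //= ltr_leD //.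
  by apply: ler_sum => j _.
rewrite leNgt; apply/negP => fl.
pose eta := (l ord0 i - f l ord0 i) / 4.
have eta0 : 0 < eta by rewrite divr_gt0 // subr_gt0.
have /cvgrPdist_lt/(_ _ eta0)/nbhs_ballP[d /= d0 fd] := fc _ lS.
pose d' := Num.min d eta.
have d'0 : 0 < d' by rewrite lt_min d0.
have [k [lxk kd]] : exists k, `|l - x k| < d' / 2 /\ n.+2%:R / k.+1%:R < d' / 2.
  have [k0' k0P] : exists k0, forall k, (k0 <= k)%N -> n.+2%:R / k.+1%:R < d' / 2.
    exists (Num.truncn (n.+2%:R * 2 / d')) => k kk.
    have : n.+2%:R * 2 / d' < k.+1%:R.
      by apply: lt_le_trans (truncnS_gt _) _; rewrite ler_nat.
    by rewrite ltr_pdivrMr // ltr_pdivrMr // => ?; nra.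
  have xx : (x @ \oo) [set v | exists2 k, (k0' <= k)%N & v = x k].
    by exists k0' => // k kk; exists k.
  have bb : nbhs l (ball l (d' / 2)) by apply: nbhsx_ballx; rewrite divr_gt0.
  have [_ [[k kk ->]]] := lcl _ _ xx bb.
  rewrite -ball_normE /= => lx; exists k; split=> //; exact: k0P.
have [xS xP] := Px k.
have d'e : d' <= eta by rewrite ge_min lexx orbT.
have d'd : d' <= d by rewrite ge_min lexx.
have lE : l ord0 i = f l ord0 i + 4 * eta.
  by rewrite /eta mulrC divfK // addrC subrK.
have lxi := le_lt_trans (le_coord_norm (l - x k) i) lxk.
have {lxi} /andP[lx1 lx2] : - (d' / 2) < l ord0 i - x k ord0 i < d' / 2.
  by move: lxi; rewrite ltr_norml !mxE.
have fpi := fp i.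
case: (xP i) => [xi|[y [yS yf xy]]].
  by have xi' := lt_trans xi kd; move: (f l ord0 i) fpi lE => q fpi lE; lra.
have ly : `|l - y| < d'.
  rewrite -(subrKA (x k)); apply: le_lt_trans (ler_normD _ _) _.
  by rewrite (splitr d') ltr_leD // (le_trans xy) // ltW.
have := fd y; rewrite -ball_normE /= => /(_ (lt_le_trans ly d'd)) fy.
have := le_lt_trans (le_coord_norm _ i) fy.
have := le_lt_trans (le_coord_norm _ i) ly.
rewrite !mxE !ltr_norml => /andP[h1 h2] /andP[h3 h4].
lra.
Qed.

Lemma cvg_rowP (R : realType) (T : Type) (F : set_system T) n
    (f : T -> 'rV[R]_n) (l : 'rV[R]_n) : Filter F ->
  (forall j, f x ord0 j @[x --> F] --> l ord0 j) -> f @ F --> l.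
Proof.
move=> FF fl; apply/cvgrPdist_le => e e0.
have : \forall x \near F, forall j, `|l ord0 j - f x ord0 j| <= e.
  by apply: filter_forall => j; move/cvgrPdist_le : (fl j); exact.
by apply: filterS => x H; apply: norm_le_coord => [|j];
  [exact: ltW|rewrite !mxE].
Qed.

Lemma cvg_max (R : realType) (T : Type) (F : set_system T) (f g : T -> R)
    (a b : R) : Filter F -> f @ F --> a -> g @ F --> b ->
  Num.max (f x) (g x) @[x --> F] --> Num.max a b.
Proof.
move=> FF fa gb; under eq_fun do rewrite maxr_absE; rewrite maxr_absE.
apply: cvgM; last exact: cvg_cst.
by apply: cvgD; [exact: cvgD|apply: cvg_norm; exact: cvgB].
Qed.

Lemma cvg_min (R : realType) (T : Type) (F : set_system T) (f g : T -> R)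
    (a b : R) : Filter F -> f @ F --> a -> g @ F --> b ->
  Num.min (f x) (g x) @[x --> F] --> Num.min a b.
Proof.
move=> FF fa gb; under eq_fun do rewrite minr_absE; rewrite minr_absE.
apply: cvgM; last exact: cvg_cst.
by apply: cvgB; [exact: cvgD|apply: cvg_norm; exact: cvgB].
Qed.

(* Points of the cone are written [x = rho * w / |w|]
   with the direction [w] and the radius [rho] read off a point of a simplex;
   reversing the radial component turns the expansion into a self-map. *)
Lemma cone_fixed_point (R : realType) n (F : 'rV[R]_n.+1 -> 'rV[R]_n.+1)
    (r s : R) : 0 < r -> r < s -> continuous F ->
  (forall x : 'rV[R]_n.+1, (forall i, 0 <= x ord0 i) -> forall i, 0 <= F x ord0 i) ->
  (forall x : 'rV[R]_n.+1, (forall i, 0 <= x ord0 i) -> r <= `|x| <= s -> F x != 0) ->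
  (forall (x : 'rV[R]_n.+1) mu, (forall i, 0 <= x ord0 i) -> `|x| = r ->
    F x = mu *: x ->
     mu < 1) ->
  (forall (x : 'rV[R]_n.+1) mu, (forall i, 0 <= x ord0 i) -> `|x| = s ->
    F x = mu *: x ->
     1 < mu) ->
  exists x : 'rV[R]_n.+1, [/\ forall i, 0 <= x ord0 i, r <= `|x| <= s & F x = x].
Proof.
move=> r0 rs Fc F0 Fn0 Fr Fs.
(* The extra term keeps [w] away from zero at the vertex [ord0], where all other coordinates vanish;
   it is inactive at the fixed point, whose coordinate [ord0] is at most 1/2. *)
pose w (y : 'rV[R]_n.+2) : 'rV[R]_n.+1 :=
  \row_j (y ord0 (lift ord0 j) + Num.max 0 (y ord0 ord0 - 1/2)).
pose rho (y : 'rV[R]_n.+2) := r + (s - r) * Num.min (2 * y ord0 ord0) 1.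
pose x (y : 'rV[R]_n.+2) : 'rV[R]_n.+1 := (rho y / `|w y|) *: w y.
pose S y := \sum_j F (x y) ord0 j.
(* The coordinate [ord0] encodes the radius, from [r] at 0 to [s] at 1/2. It is lowered when [F]
   increases the sum of the entries of [x]: this is the reversal. *)
pose z' (y : 'rV[R]_n.+2) := Num.max 0 (Num.min (1/2)
  (y ord0 ord0 + \sum_j x y ord0 j - S y)).
pose Phi (y : 'rV[R]_n.+2) : 'rV[R]_n.+2 := \row_i
  (if unlift ord0 i is Some j then (1 - z' y) * F (x y) ord0 j / S y
   else z' y).
have simplex01 (y : 'rV[R]_n.+2) : simplex y -> 0 <= y ord0 ord0 <= 1.
  move=> [y0 ys]; rewrite y0 /= -ys (bigD1 ord0) //= lerDl.
  by apply: sumr_ge0 => i _; exact: y0.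
have w0 y : simplex y -> forall j, 0 <= w y ord0 j.
  by move=> [y0 _] j; rewrite mxE addr_ge0 // le_max lexx.
have wn0 y : simplex y -> 0 < `|w y|.
  move=> yS; rewrite normr_gt0; apply/eqP => /rowP w00; have [y0 ys] := yS.
  have H j : y ord0 (lift ord0 j) = 0 /\ y ord0 ord0 - 1/2 <= 0.
    have := w00 j; rewrite !mxE => /eqP; rewrite paddr_eq0 ?le_max ?lexx ?y0 //.
    move=> /andP[/eqP -> /eqP m0]; split=> //; rewrite -m0 le_max lexx.
    exact: orbT.
  move: ys; rewrite big_ord_recl big1 => [|j _]; last by have [] := H j.
  by have [_] := H ord0; lra.
have rhoB y : simplex y -> r <= rho y <= s.
  move=> /simplex01/andP[z0 z1].
  have m0 : 0 <= Num.min (2 * y ord0 ord0) 1 <= 1.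
    by rewrite le_min ge_min lexx orbT !andbT ler01 mulr_ge0.
  by move: m0; rewrite /rho => /andP[]; nra.
have nx y : simplex y -> `|x y| = rho y.
  move=> yS; have /andP[h1 h2] := rhoB _ yS; have wy := wn0 _ yS.
  rewrite normrZ normrM normfV normr_id mulfVK ?gt_eqF //.
  by rewrite ger0_norm // (le_trans _ h1) // ltW.
have x0 y : simplex y -> forall j, 0 <= x y ord0 j.
  move=> yS j; have /andP[h1 h2] := rhoB _ yS; have wy := wn0 _ yS.
  rewrite mxE mulr_ge0 ?w0 // divr_ge0 ?(ltW wy) //.
  exact: le_trans (ltW r0) h1.
have S0 y : simplex y -> 0 < S y.
  move=> yS; rewrite lt_neqAle sumr_ge0 ?andbT; last first.
    by move=> j _; apply: F0; exact: x0.
  have /negP Fx : F (x y) != 0.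
    by apply: Fn0; [exact: x0|rewrite nx // rhoB].
  apply/eqP => /esym/eqP; rewrite psumr_eq0 => [/allP FS|j _]; last exact/F0/x0.
  apply: Fx; apply/eqP/rowP => j; rewrite mxE.
  by apply/eqP/FS; rewrite mem_index_enum.
have z'B y : 0 <= z' y <= 1/2.
  by rewrite /z' le_max lexx /= ge_max ge_min lexx /= andbT; lra.
have PhiS y : simplex y -> simplex (Phi y).
  move=> yS; have Sy := S0 _ yS; have /andP[z1 z2] := z'B y; split.
    move=> i; rewrite mxE; case: unliftP => // j _.
    by rewrite divr_ge0 ?(ltW Sy) // mulr_ge0 ?F0 //; [lra|exact: x0].
  rewrite big_ord_recl mxE unlift_none.
  under eq_bigr do rewrite mxE liftK.
  by rewrite -mulr_suml -mulr_sumr mulfK ?gt_eqF //; ring.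
have Phic y : simplex y -> {for y, continuous Phi}.
  move=> yS; suff H (G : set_system 'rV[R]_n.+2) : Filter G ->
      (forall i, v ord0 i @[v --> G] --> y ord0 i) -> Phi v @[v --> G] --> Phi y.
    by apply: (H (nbhs y)) => i; exact: coord_continuous.
  move=> FG cy.
  have wc : w v @[v --> G] --> w y.
    apply: cvg_rowP => j; rewrite mxE.
    rewrite [X in X @ _ --> _](_ : _ = fun y : 'rV[R]_n.+2 =>
      y ord0 (lift ord0 j) + Num.max 0 (y ord0 ord0 - 1/2)).
      apply: cvgD; first exact: cy.
      by apply: cvg_max; [exact: cvg_cst|apply: cvgB; [exact: cy|exact: cvg_cst]].
    by apply/funext => v; rewrite mxE.
  have xc : x v @[v --> G] --> x y.
    apply: cvgZ; last exact: wc.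
    apply: cvgM.
      apply: cvgD; first exact: cvg_cst.
      apply: cvgM; first exact: cvg_cst.
      apply: cvg_min; last exact: cvg_cst.
      by apply: cvgM; [exact: cvg_cst|exact: cy].
    apply: cvgV; first by rewrite gt_eqF // wn0.
    by apply: cvg_norm; exact: wc.
  have Fjc j : F (x v) ord0 j @[v --> G] --> F (x y) ord0 j.
    have h : F (x v) @[v --> G] --> F (x y) by exact: cvg_comp xc (Fc _).
    exact: cvg_comp h (@coord_continuous R _ _ ord0 j (F (x y))).
  have xjc j : x v ord0 j @[v --> G] --> x y ord0 j.
    exact: cvg_comp xc (@coord_continuous R _ _ ord0 j (x y)).
  have Sc : S v @[v --> G] --> S y by apply: cvg_sumr => j; exact: Fjc.
  have z'c : z' v @[v --> G] --> z' y.
    apply: cvg_max; first exact: cvg_cst.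
    apply: cvg_min; first exact: cvg_cst.
    apply: cvgB; last exact: Sc.
    by apply: cvgD; [exact: cy|apply: cvg_sumr => j; exact: xjc].
  apply: cvg_rowP => i; rewrite mxE.
  rewrite [X in X @ _ --> _](_ : _ = fun y : 'rV[R]_n.+2 =>
    if unlift ord0 i is Some j then (1 - z' y) * F (x y) ord0 j / S y
      else z' y); last by apply/funext => v; rewrite mxE.
  case: (unliftP ord0 i) => [j _|_]; last exact: z'c.
  apply: cvgM; last by apply: cvgV; [rewrite gt_eqF // S0|exact: Sc].
  apply: cvgM; last exact: Fjc.
  by apply: cvgB; [exact: cvg_cst|exact: z'c].
have [y [yS Phiy]] := brouwer_simplex Phic PhiS.
have zE : y ord0 ord0 = z' y by rewrite -[in LHS]Phiy mxE unlift_none.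
have yE j : y ord0 (lift ord0 j) = (1 - z' y) * F (x y) ord0 j / S y.
  by rewrite -[in LHS]Phiy mxE liftK.
have /andP[z0 z1] := z'B y.
have Sy := S0 _ yS; have wy := wn0 _ yS; have /andP[rho1 rho2] := rhoB _ yS.
have wE j : w y ord0 j = y ord0 (lift ord0 j).
  by rewrite mxE zE max_l ?addr0 //; lra.
have c0 : 0 < rho y / `|w y| by rewrite divr_gt0 // (lt_le_trans r0).
pose mu := S y / ((1 - z' y) * (rho y / `|w y|)).
have mu0 : 0 < mu by rewrite divr_gt0 // mulr_gt0 //; lra.
have FE : F (x y) = mu *: x y.
  apply/rowP => j; rewrite !mxE -/(w y ord0 j).
  have := wE j; rewrite mxE => ->; rewrite yE /mu; field.
  by rewrite !gt_eqF //; [lra|lra].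
have SE : S y = mu * \sum_j x y ord0 j.
  by rewrite /S FE mulr_sumr; apply: eq_bigr => j _; rewrite mxE.
exists (x y); rewrite nx // rho1 rho2; split=> //; first exact: x0.
have sx0 : 0 < \sum_j x y ord0 j by rewrite -(pmulr_rgt0 _ mu0) -SE.
have zP : y ord0 ord0 = Num.max 0 (Num.min (1/2)
    (y ord0 ord0 + (1 - mu) * \sum_j x y ord0 j)).
  rewrite [LHS]zE /z' SE; congr (Num.max 0 (Num.min _ _)); ring.
have z0y : 0 <= y ord0 ord0 by rewrite zE.
have z1y : y ord0 ord0 <= 1/2 by rewrite zE.
suff mu1 : mu = 1 by rewrite FE mu1 scale1r.
(* A factor above 1 drives the radial coordinate to 0, that is to radius [r], and a factor below 1
   drives it to 1/2, that is to radius [s]; the hypotheses exclude both. *)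
apply/eqP; rewrite eq_le; apply/andP; split; rewrite leNgt; apply/negP => mu1.
- have lt0 : (1 - mu) * \sum_j x y ord0 j < 0 by rewrite nmulr_rlt0 // subr_lt0.
  have zz : y ord0 ord0 = 0.
    move: zP; rewrite min_r; last lra.
    have [h|h] := leP 0 (y ord0 ord0 + (1 - mu) * _) => zP; first by lra.
    exact: zP.
  have rr : `|x y| = r by rewrite nx // /rho zz mulr0 min_l // mulr0 addr0.
  by have := Fr _ _ (x0 _ yS) rr FE; rewrite ltNge ltW.
- have lt0 : 0 < (1 - mu) * \sum_j x y ord0 j by rewrite mulr_gt0 // subr_gt0.
  have zz : y ord0 ord0 = 1/2.
    move: zP.
    have [h|h] := leP (1/2) (y ord0 ord0 + (1 - mu) * _); rewrite max_r => [zP|];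
      lra.
  have rr : `|x y| = s.
    by rewrite nx // /rho zz mulrA mulr1 divff // minxx mulr1 subrKC.
  by have := Fs _ _ (x0 _ yS) rr FE; rewrite ltNge ltW.
Qed.

(** * Discrete equations *)

(* The nodes are 1, ..., N; 0 and N.+1 are ghost nodes. *)
Definition discrete_bc (R : realType) (b : boundary_type) (N : nat)
    (e : nat -> R) :=
  match b with
  | Neumann => e 0%N = e 1%N /\ e N.+1 = e N
  | Periodic => e 0%N = e N /\ e N.+1 = e 1%N
  end.

(** The opposite of the usual second difference: concavity at [k] reads [0 <= d2 e k]. *)
Definition d2 (R : realType) (e : nat -> R) (k : nat) :=
  2 * e k - e k.-1 - e k.+1.

Section discrete.
Variable R : realType.
Implicit Types (b : boundary_type) (e psi : nat -> R) (N k : nat).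

Lemma slopeE e k :
  e k.+1 - e k = (e 1%N - e 0%N) - \sum_(1 <= i < k.+1) d2 e i.
Proof.
elim: k => [|k IH]; first by rewrite big_geq // subr0.
by rewrite big_nat_recr //= opprD addrA -IH /d2 /=; ring.
Qed.

(** The sum telescopes to the difference of the two end slopes, which either boundary condition
    makes equal. *)
Lemma sum_d2 b N e : discrete_bc b N e -> \sum_(1 <= k < N.+1) d2 e k = 0.
Proof.
move=> bc; have := slopeE e N.
by case: b bc => -[e0 eN]; rewrite e0 eN => H; lra.
Qed.

(** In the Neumann case this slope is zero. In the periodic case the slopes add up to zero, so by
    [slopeE] [N] times the first one is a sum of [N] partial sums of [d2], each at most the
    right-hand side in absolute value. *)
Lemma slope0_le b N e : (0 < N)%N -> discrete_bc b N e ->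
  `|e 1%N - e 0%N| <= \sum_(1 <= k < N.+1) `|d2 e k|.
Proof.
move=> N0; set D := \sum_(_ <= _ < _) _; case: b => -[e0 eN].
  by rewrite e0 subrr normr0 sumr_ge0.
have N0' : 0 < N%:R :> R by rewrite ltr0n.
rewrite -(ler_pM2l N0') -{1}(@ger0_norm _ N%:R) // -normrM.
have -> : N%:R * (e 1%N - e 0%N) =
    \sum_(1 <= k < N.+1) \sum_(1 <= i < k.+1) d2 e i.
  have : \sum_(1 <= k < N.+1) (e k.+1 - e k) = 0.
    by rewrite telescope_sumr // eN subrr.
  under eq_bigr do rewrite slopeE; rewrite sumrB => /eqP.
  by rewrite subr_eq0 => /eqP <-; rewrite sumr_const_nat subn1 mulr_natl.
apply: le_trans (ler_norm_sum _ _ _) _.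
apply: (@le_trans _ _ (\sum_(1 <= k < N.+1) D)); last first.
  by rewrite sumr_const_nat subn1 mulr_natl.
rewrite big_nat [leRHS]big_nat; apply: ler_sum => k /andP[k1 kN].
apply: le_trans (ler_norm_sum _ _ _) _.
rewrite /D [leRHS](@big_cat_nat _ _ _ k.+1) //= lerDl.
exact: sumr_ge0.
Qed.

Lemma slope_le b N e k : (0 < N)%N -> discrete_bc b N e -> (k <= N)%N ->
  `|e k.+1 - e k| <= 2 * \sum_(1 <= k < N.+1) `|d2 e k|.
Proof.
move=> N0 bc kN; rewrite slopeE mulr2n mulrDl mul1r.
apply: le_trans (ler_normB _ _) _; apply: lerD; first exact: slope0_le bc.
apply: le_trans (ler_norm_sum _ _ _) _.
rewrite [leRHS](@big_cat_nat _ _ _ k.+1) //= lerDl.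
exact: sumr_ge0.
Qed.

Lemma lipschitz_nat e (c : R) N : (forall k, (k <= N)%N -> `|e k.+1 - e k| <= c) ->
  forall i j, (i <= j <= N.+1)%N -> `|e j - e i| <= c * (j - i)%:R.
Proof.
move=> ec i j /andP[ij jN]; rewrite -(telescope_sumr e ij).
apply: le_trans (ler_norm_sum _ _ _) _.
rewrite -mulrC mulr_natl -sumr_const_nat big_nat [leRHS]big_nat.
by apply: ler_sum => k /andP[_ kj]; apply: ec; rewrite -ltnS (leq_trans kj).
Qed.

Lemma osc_le b N e i j : (0 < N)%N -> discrete_bc b N e ->
  (0 < i <= N)%N -> (0 < j <= N)%N ->
  e j - e i <= 2 * N%:R * \sum_(1 <= k < N.+1) `|d2 e k|.
Proof.
move=> N0 bc; set D := \sum_(_ <= _ < _) _.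
have D0 : 0 <= D by apply: sumr_ge0.
have lip := @lipschitz_nat e (2 * D) N (fun k kN => slope_le N0 bc kN).
move=> /andP[i0 iN] /andP[j0 jN].
have H p q : (p <= q <= N)%N -> 2 * D * (q - p)%:R <= 2 * N%:R * D.
  move=> /andP[pq qN]; rewrite mulrAC ler_wpM2r // ler_wpM2l // ler_nat.
  by rewrite (leq_trans (leq_subr _ _)).
have [ij|/ltnW ji] := leqP i j.
- apply: le_trans (ler_norm _) (le_trans (lip i j _) (H i j _)).
    by rewrite ij (leq_trans jN).
  by rewrite ij.
- rewrite -opprB; apply: le_trans (ler_norm _) _; rewrite normrN.
  apply: (le_trans (lip j i _) (H j i _)); first by rewrite ji (leq_trans iN).
  by rewrite ji.
Qed.

(** Discrete Green identity: the difference of the two summands is an increment of the Wronskian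
    [W]. As [psi] vanishes at two consecutive nodes at each end, the boundary values of [W] are zero
    whatever [e] does there. *)
Lemma summation_by_parts e psi N : (0 < N)%N ->
  psi 0%N = 0 -> psi 1%N = 0 -> psi N = 0 -> psi N.+1 = 0 ->
  \sum_(1 <= k < N.+1) psi k * d2 e k = \sum_(1 <= k < N.+1) e k * d2 psi k.
Proof.
move=> N0 p0 p1 pN pN1.
pose W k := e k * psi k.+1 - psi k * e k.+1.
apply/eqP; rewrite -subr_eq0 -sumrB.
rewrite (eq_big_nat _ _ (F2 := fun k => W k.-1.+1 - W k.-1)).
  by rewrite big_add1 /= telescope_sumr // /W pN pN1 p0 p1 !(mul0r, mulr0) !subr0.
by move=> [//|k] _; rewrite /d2 /W /=; ring.
Qed.

(** Slopes decrease, so [e] is above its chord, here multiplied out by [q - p]. Concavity is asked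
    at interior nodes only, so an end may be a node where the equation says nothing, even a
    ghost. *)
Lemma concave_chord e p q k : (p <= k <= q)%N ->
  (forall i, (p < i < q)%N -> 0 <= d2 e i) ->
  (q - k)%:R * e p + (k - p)%:R * e q <= (q - p)%:R * e k.
Proof.
move=> /andP[pk kq] conc.
have slope_anti i j : (p <= i <= j)%N -> (j < q)%N ->
    e j.+1 - e j <= e i.+1 - e i.
  move=> /andP[pi]; elim: j => [|j IH]; first by rewrite leqn0 => /eqP ->.
  rewrite leq_eqVlt => /orP[/eqP -> //|]; rewrite ltnS => ij jq.
  apply: le_trans (IH ij (ltnW jq)).
  have := conc j.+1; rewrite jq ltnS (leq_trans pi ij) => /(_ isT).
  by rewrite /d2 /=; lra.
have [->|kq'] := eqVneq k q; first by rewrite subnn mul0r add0r.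
have {}kq' : (k < q)%N by rewrite ltn_neqAle kq' kq.
set d := e k.+1 - e k.
have h1 : (k - p)%:R * d <= e k - e p.
  rewrite -(telescope_sumr e pk) mulr_natl -sumr_const_nat.
  rewrite big_nat [leRHS]big_nat; apply: ler_sum => i /andP[pi ik].
  by apply: slope_anti => //; rewrite pi ltnW.
have h2 : e q - e k <= (q - k)%:R * d.
  rewrite -(telescope_sumr e kq) mulr_natl -sumr_const_nat.
  rewrite big_nat [leRHS]big_nat; apply: ler_sum => i /andP[ki iq].
  by apply: slope_anti => //; rewrite pk.
have -> : (q - p)%:R = (q - k)%:R + (k - p)%:R :> R.
  by rewrite -natrD addnBA // subnK.
have := @ler_wpM2l _ (k - p)%:R (ler0n _ _) _ _ h2.
have := @ler_wpM2l _ (q - k)%:R (ler0n _ _) _ _ h1.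
by nra.
Qed.

End discrete.

(** * Nonexistence of small discrete solutions *)

Lemma regularly_oscillating_near0 (R : realType) (g : R -> R) (eps : R) :
  regularly_oscillating_at0 g -> 0 < eps ->
  exists2 d : R, 0 < d & forall s w, 0 < s < d -> `|w - 1| < d ->
    `|g (w * s) / g s - 1| < eps.
Proof.
move=> /cvgrPdist_lt H e0; have [[A B] /= [A0 B1] AB] := H _ e0.
have [d1 /= d10 Ad] := A0; have /nbhs_ballP[d2 /= d20 Bd] := B1.
exists (Num.min d1 d2); first by rewrite lt_min d10.
move=> s w; rewrite !lt_min => /andP[s0 /andP[s1 s2]] /andP[w1 w2].
rewrite distrC; apply: (AB (s, w)); split => /=.
  by apply: Ad => //=; rewrite sub0r normrN gtr0_norm.
by apply: Bd; rewrite -ball_normE /= distrC.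
Qed.

Lemma sublinear_near0 (R : realType) (g : R -> R) (eta : R) :
  g s / s @[s --> 0^'+] --> 0 -> 0 < eta ->
  exists2 d : R, 0 < d & forall s, 0 < s < d -> g s <= eta * s.
Proof.
move=> /cvgrPdist_lt H e0; have [d /= d0 Hd] := H _ e0.
exists d => // s /andP[s0 sd].
have := Hd s; rewrite /= sub0r normrN gtr0_norm // => /(_ sd s0).
rewrite sub0r normrN => /(le_lt_trans (ler_norm _)) /ltW.
by rewrite ler_pdivrMr.
Qed.

(** Adding up the equation leaves [kappa] times the sum of [e] equal to [h] times the sum of
    [a k * g (e k)], which is therefore nonnegative; for small [e] that sum has the sign of [A]. The
    radius is chosen from [g], [T], [M] and [A], before the mesh and the boundary condition. *)
Lemma no_small_solution (R : realType) (g : R -> R) (T M A : R) :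
  regularly_oscillating_at0 g -> g s / s @[s --> 0^'+] --> 0 ->
  g 0 = 0 -> (forall s, 0 < s -> 0 < g s) -> 0 < T -> 0 <= M -> A < 0 ->
  exists2 r : R, 0 < r & forall b N (h kappa rho : R) (a e : nat -> R),
    (0 < N)%N -> N%:R * h = T -> discrete_bc b N e ->
    (forall k, (0 < k <= N)%N -> 0 <= e k <= rho) ->
    (exists2 k, (0 < k <= N)%N & e k = rho) -> 0 < rho <= r -> 0 <= kappa ->
    \sum_(1 <= k < N.+1) `|a k| <= M -> \sum_(1 <= k < N.+1) a k = A ->
    ~ (forall k, (0 < k <= N)%N -> d2 e k + kappa * e k = h * (a k * g (e k))).
Proof.
move=> gosc gsub g00 gpos T0 M0 A0.
pose eps := - A / (2 * (M + 1)).
have eps0 : 0 < eps by rewrite divr_gt0 ?oppr_gt0 //; lra.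
have epsM : eps * M < - A.
  have : eps * (2 * (M + 1)) = - A by rewrite divfK // gt_eqF //; lra.
  by nra.
have [d d0 dP] := regularly_oscillating_near0 gosc eps0.
(* The oscillation of [e] will be at most [4 * T * M * eta * rho]; this choice keeps it below
   [d * rho]. *)
pose eta := d / (2 * (4 * T * M + 1)).
have TM : 0 <= T * M by rewrite mulr_ge0 // ltW.
have eta0 : 0 < eta by rewrite divr_gt0 //; nra.
have etad : 4 * T * M * eta < d.
  have : eta * (2 * (4 * T * M + 1)) = d by rewrite divfK // gt_eqF //; nra.
  by nra.
have [d' d'0 d'P] := sublinear_near0 gsub eta0.
have mdd : 0 < Num.min d d' by rewrite lt_min d0.
exists (Num.min d d' / 2); first by rewrite divr_gt0.
move=> b N h kappa rho a e N0 hT bc eB [k0 k0N ek0] /andP[rho0 rhor] kap0 aM aA H.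
have rhod : rho < d by have := ge_min d d d'; rewrite lexx; lra.
have rhod' : rho < d' by have := ge_min d' d d'; rewrite lexx orbT; lra.
have N0' : 0 < N%:R :> R by rewrite ltr0n.
have h0 : 0 < h by rewrite -(pmulr_rgt0 _ N0') hT.
have gB k : (0 < k <= N)%N -> 0 <= g (e k) <= eta * rho.
  move=> /eB/andP[]; rewrite le_eqVlt => /predU1P[<- _|ek ekr].
    by rewrite g00 lexx /= mulr_ge0 // ltW.
  rewrite (ltW (gpos _ ek)) /=; apply: le_trans (d'P _ _) _.
    by rewrite ek (le_lt_trans ekr).
  by rewrite ler_pM2l.
have sumE : kappa * \sum_(1 <= k < N.+1) e k =
    h * \sum_(1 <= k < N.+1) a k * g (e k).
  have : \sum_(1 <= k < N.+1) (d2 e k + kappa * e k) =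
         \sum_(1 <= k < N.+1) h * (a k * g (e k)).
    by apply: eq_big_nat => k /H.
  by rewrite big_split /= (sum_d2 bc) add0r !mulr_sumr.
have sumag : \sum_(1 <= k < N.+1) `|a k| * g (e k) <= M * (eta * rho).
  apply: (@le_trans _ _ (\sum_(1 <= k < N.+1) `|a k| * (eta * rho))).
    rewrite big_nat [leRHS]big_nat; apply: ler_sum => k /gB/andP[_ gk].
    by rewrite ler_wpM2l.
  by rewrite -mulr_suml ler_wpM2r // mulr_ge0 // ltW.
have sume0 : 0 <= \sum_(1 <= k < N.+1) e k.
  by rewrite big_nat sumr_ge0 // => k /eB/andP[].
(* By [sumE] the terms [kappa * e k] have at most the same total as the nonlinear ones, so the bound
   is uniform in [kappa]; hence the factor 2. *)
have sum_abs : \sum_(1 <= k < N.+1) `|d2 e k| <= 2 * (h * (M * (eta * rho))).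
  apply: (@le_trans _ _ (\sum_(1 <= k < N.+1)
      (kappa * e k + h * (`|a k| * g (e k))))).
    rewrite big_nat [leRHS]big_nat; apply: ler_sum => k kN.
    have -> : d2 e k = h * (a k * g (e k)) - kappa * e k by rewrite -H // addrK.
    have /andP[ek _] := eB _ kN; have /andP[gk _] := gB _ kN.
    rewrite [leRHS]addrC; apply: le_trans (ler_normB _ _) _.
    rewrite !normrM (gtr0_norm h0) (ger0_norm gk) (ger0_norm kap0).
    by rewrite (ger0_norm ek).
  rewrite big_split /= -!mulr_sumr sumE (mulrDl 1 1) !mul1r.
  apply: lerD; rewrite ler_wpM2l ?(ltW h0) //.
  apply: (le_trans _ sumag); rewrite big_nat [leRHS]big_nat; apply: ler_sum.
  by move=> k /gB/andP[gk _]; rewrite ler_wpM2r // ler_norm.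
have near_rho k : (0 < k <= N)%N -> `|e k / rho - 1| < d.
  move=> kN; have /andP[_ ekr] := eB _ kN.
  have osc := osc_le N0 bc kN k0N; rewrite ek0 in osc.
  have : rho - e k < d * rho.
    apply: (le_lt_trans osc); apply: (@le_lt_trans _ _ (4 * T * M * eta * rho)).
      rewrite -hT; apply: le_trans (ler_wpM2l _ sum_abs) _.
        by rewrite mulr_ge0.
      by rewrite le_eqVlt; apply/orP; left; apply/eqP; ring.
    by rewrite ltr_pM2r.
  move=> lt; rewrite distrC ger0_norm; last first.
    by rewrite subr_ge0 ler_pdivrMr // mul1r.
  rewrite -(ltr_pM2r rho0) mulrBl divfK ?mul1r //.
  by rewrite gt_eqF.
have grho := gpos _ rho0.
have close k : (0 < k <= N)%N -> `|g (e k) - g rho| <= eps * g rho.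
  move=> kN; have := dP rho (e k / rho) _ (near_rho k kN).
  rewrite rho0 rhod divfK ?gt_eqF // => /(_ isT)/ltW.
  rewrite -(ler_pM2r grho) -{2}(gtr0_norm grho) -normrM mulrBl divfK ?mul1r //.
  by rewrite gt_eqF.
have : \sum_(1 <= k < N.+1) a k * g (e k) <= A * g rho + eps * g rho * M.
  apply: (@le_trans _ _ (\sum_(1 <= k < N.+1)
      (a k * g rho + eps * g rho * `|a k|))).
    rewrite big_nat [leRHS]big_nat; apply: ler_sum => k /close ck.
    rewrite -lerBlDl -mulrBr; apply: le_trans (ler_norm _) _.
    by rewrite normrM mulrC ler_wpM2r.
  rewrite big_split /= -mulr_suml -mulr_sumr aA lerD2l ler_wpM2l //.
  by rewrite mulr_ge0 // ltW.
have : 0 <= \sum_(1 <= k < N.+1) a k * g (e k).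
  by rewrite -(pmulr_rge0 _ h0) -sumE mulr_ge0.
by nra.
Qed.

(** * Integrals and absolutely continuous functions *)

Notation leb R := (@lebesgue_measure R).

(** Half-open, so that adjacent cells are disjoint. For [y <= x] the value is 0, not the opposite of
    the reversed integral. *)
Definition itg (R : realType) (f : R -> R) (x y : R) : R :=
  \int[leb R]_(t in `]x, y]) f t.

Section itg_theory.
Variable R : realType.
Local Notation mu := (leb R).
Implicit Types (f g : R -> R) (x y z : R).

Lemma aeS (P Q : R -> Prop) : (forall x, P x -> Q x) ->
  {ae mu, forall x, P x} -> {ae mu, forall x, Q x}.
Proof.
have F : Filter (almost_everywhere mu) := ae_filter_ringOfSetsType mu.
by move=> PQ; exact: (@filterS _ _ F).
Qed.

Lemma aeI (P Q : R -> Prop) : {ae mu, forall x, P x} ->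
  {ae mu, forall x, Q x} -> {ae mu, forall x, P x /\ Q x}.
Proof.
have F : Filter (almost_everywhere mu) := ae_filter_ringOfSetsType mu.
by move=> aP aQ; exact: (@filterI _ _ F).
Qed.

Lemma ae_neq x : {ae mu, forall t, t != x}.
Proof.
exists [set x]; split => //; first exact: lebesgue_measure_set1.
by move=> t /= /negP; rewrite negbK => /eqP.
Qed.

Let intitv f x y : mu.-integrable setT (EFin \o f) ->
  mu.-integrable `]x, y] (EFin \o f).
Proof. by apply: integrableS. Qed.

Lemma itg_add f x y z : mu.-integrable setT (EFin \o f) -> x <= y <= z ->
  itg f x y + itg f y z = itg f x z.
Proof.
move=> intf /andP[xy yz]; rewrite /itg.
have := @Rintegral_itvB R f (BRight x) (BRight z) y (intitv _ _ intf).
by rewrite !bnd_simp xy yz => /(_ isT isT) <-; rewrite subrKC.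
Qed.

Lemma itg_same f x : itg f x x = 0.
Proof. by rewrite /itg set_itv_ge ?bnd_simp ?ltxx // Rintegral_set0. Qed.

Lemma itg_norm f x y : mu.-integrable setT (EFin \o f) ->
  `|itg f x y| <= itg (fun t => `|f t|) x y.
Proof. by move=> intf; apply: le_normr_Rintegral => //; exact: intitv. Qed.

Lemma itgB f g x y : mu.-integrable setT (EFin \o f) ->
  mu.-integrable setT (EFin \o g) ->
  itg (fun t => f t - g t) x y = itg f x y - itg g x y.
Proof. by move=> intf intg; apply: RintegralB => //; exact: intitv. Qed.

Lemma itgZ f (c : R) x y : mu.-integrable setT (EFin \o f) ->
  itg (fun t => c * f t) x y = c * itg f x y.
Proof. by move=> intf; apply: RintegralZl => //; exact: intitv. Qed.

Lemma itg_eq0 f x y : mu.-integrable setT (EFin \o f) ->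
  {ae mu, forall t, t \in `]x, y] -> f t = 0} -> itg f x y = 0.
Proof.
move=> intf f0; rewrite /itg /Rintegral (ae_eq_integral (cst 0%E)) //.
- by rewrite integral0.
- by have /integrableP[] := intitv x y intf.
- by apply: aeS f0 => t /= H tx; rewrite H.
Qed.

Lemma itg_ge0 f x y : mu.-integrable setT (EFin \o f) ->
  {ae mu, forall t, t \in `]x, y] -> 0 <= f t} -> 0 <= itg f x y.
Proof.
move=> intf f0.
have -> : itg f x y = itg (fun t => `|f t|) x y; last exact: Rintegral_ge0.
have intnf : mu.-integrable setT (EFin \o (fun t => `|f t|)).
  exact: integrable_norm.
apply/eqP; rewrite -subr_eq0 -itgB //; apply/eqP/itg_eq0.
  exact: (integrableB measurableT intf intnf).
by apply: aeS f0 => t /= H tx; rewrite ger0_norm ?subrr ?H.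
Qed.

Lemma le_itg f g x y : mu.-integrable setT (EFin \o f) ->
  mu.-integrable setT (EFin \o g) ->
  {ae mu, forall t, t \in `]x, y] -> f t <= g t} -> itg f x y <= itg g x y.
Proof.
move=> intf intg fg; rewrite -subr_ge0 -itgB //; apply: itg_ge0.
  exact: (integrableB measurableT intg intf).
by apply: aeS fg => t /= H tx; rewrite subr_ge0 H.
Qed.

Lemma itg_sum f (h : R) i j : mu.-integrable setT (EFin \o f) -> 0 <= h ->
  (i <= j)%N ->
  \sum_(i.+1 <= k < j.+1) itg f (k.-1%:R * h) (k%:R * h) =
  itg f (i%:R * h) (j%:R * h).
Proof.
move=> intf h0; elim: j => [|j IH].
  by rewrite leqn0 => /eqP ->; rewrite big_geq // itg_same.
rewrite leq_eqVlt => /predU1P[->|ij]; first by rewrite big_geq // itg_same.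
by rewrite big_nat_recr //= IH // itg_add // !ler_wpM2r ?ler_nat.
Qed.

Lemma itg_small f (eps : R) : mu.-integrable setT (EFin \o f) -> 0 < eps ->
  exists2 d : R, 0 < d & forall x y, x <= y -> y - x < d ->
    itg (fun t => `|f t|) x y < eps.
Proof.
move=> intf e0; have [d [d0 dP]] := integral_normr_continuous intf e0.
exists d => // x y xy yx; apply: dP => //.
rewrite /= lebesgue_measure_itv. by case: ifP; rewrite ?lte_fin.
Qed.

Lemma itg_abs_continuous f (l r : R) : mu.-integrable setT (EFin \o f) ->
  abs_continuous_on l r (itg f l).
Proof.
move=> intf eps e0; have [d [d0 dP]] := integral_normr_continuous intf e0.
exists d => // n p q pq tpq spq.
pose U := \big[setU/set0]_(i < n) `]p i, q i[%classic.
have mU : measurable U by apply: bigsetU_measurable.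
have intnf : mu.-integrable setT (EFin \o (fun t => `|f t|)).
  exact: integrable_norm.
have : (mu U < d%:E)%E.
  rewrite measure_bigsetU_ord //.
  apply: (@le_lt_trans _ _ (\sum_(i < n) (q i - p i)%:E)%E).
    apply: lee_sum => i _; rewrite /= lebesgue_measure_itv /= lte_fin.
    case: ifP => //= _; rewrite lee_fin subr_ge0.
    by have [/andP[]] := pq i.
  by rewrite sumEFin lte_fin.
move=> /(dP _ mU); apply: le_lt_trans.
rewrite /U /Rintegral integral_bigsetU_EFin //; last first.
- have /integrableP[h _] : mu.-integrable U (EFin \o (fun t => `|f t|)).
    exact: integrableS intnf.
  exact: h.
- by apply: sub_trivIset tpq.
- exact: index_enum_uniq.
rewrite -sum_fine; last first.
  move=> i _; apply: integrable_fin_num => //; exact: integrableS intnf.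
apply: ler_sum => i _; have [/andP[lp pq'] qr] := pq i.
rewrite (_ : _ - _ = itg f (p i) (q i)); last first.
  by rewrite -(@itg_add f l (p i) (q i)) ?lp //; ring.
apply: le_trans (itg_norm _ _ intf) _.
by rewrite /itg -(Rintegral_itv_bndo_bndc (a := BRight (p i))) //;
  exact: integrableS intnf.
Qed.

Lemma itg_derivable f (l : R) : mu.-integrable setT (EFin \o f) ->
  {ae mu, forall x, l < x -> is_derive x 1 (fun y => itg f l y) (f x)}.
Proof.
move=> intf.
have locf : locally_integrable setT f.
  by apply: open_integrable_locally => //; exact: openT.
apply: aeS (@FTC1 R f (BRight l) (fun y => intitv _ _ intf) locf) => x + lx.
move=> /(_ lx)[dF F'].
by split => //; rewrite -derive1E.
Qed.

End itg_theory.

(** * Derivatives relative to a set and absolute continuity *)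

Section derivatives.
Variable R : realType.
Local Notation mu := (leb R).
Implicit Types (A : set R) (f : R -> R).

Lemma is_derive_onP A f (x d : R) : is_derive_on A f x d <->
  forall eps, 0 < eps -> exists2 eta : R, 0 < eta &
    forall y, A y -> `|y - x| < eta ->
      `|f y - f x - d * (y - x)| <= eps * `|y - x|.
Proof.
split=> [/cvgrPdist_le H eps e0|H].
- have [eta /= eta0 Heta] := H _ e0; exists eta => // y Ay yx.
  have [->|ynx] := eqVneq y x; first by rewrite !subrr mulr0 subr0 normr0 mulr0.
  have := Heta y; rewrite /= distrC => /(_ yx ynx Ay).
  rewrite -(ler_pM2r (x := `|y - x|)) ?normr_gt0 ?subr_eq0 // -normrM.
  rewrite mulrBl divfK ?subr_eq0 //; congr (_ <= _).
  by rewrite distrC.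
- apply/cvgrPdist_le => eps e0; have [eta eta0 Heta] := H _ e0.
  exists eta => //= y; rewrite /= distrC => yx ynx Ay.
  rewrite -(ler_pM2r (x := `|y - x|)) ?normr_gt0 ?subr_eq0 // -normrM.
  by rewrite mulrBl divfK ?subr_eq0 // distrC; exact: Heta.
Qed.

Lemma is_derive_is_derive_on A f (x d : R) :
  is_derive x 1 f d -> is_derive_on A f x d.
Proof.
move=> [df <-]; apply/is_derive_onP => eps e0.
have /cvgrPdist_le/(_ _ e0)[eta /= eta0 Heta] := df.
exists eta => // y _ yx.
have [->|ynx] := eqVneq y x; first by rewrite !subrr mulr0 subr0 normr0 mulr0.
have := Heta (y - x); rewrite /= sub0r normrN subr_eq0 => /(_ yx ynx).
rewrite /GRing.scale /= mulr1 subrK -(ler_pM2r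
  (x := `|y - x|)) ?normr_gt0 ?subr_eq0 // -normrM.
rewrite mulrBl mulrAC mulVf ?subr_eq0 // mul1r => H.
by rewrite distrC.
Qed.

Lemma is_derive_on_is_derive f (l r x d : R) : x \in `]l, r[ ->
  is_derive_on `[l, r] f x d -> is_derive x 1 f d.
Proof.
rewrite in_itv /= => /andP[lx xr] /is_derive_onP H.
have lim : (fun h => h^-1 *: (f (h *: 1 + x) - f x)) @ 0^' --> d.
  apply/cvgrPdist_le => eps e0; have [eta eta0 Heta] := H _ e0.
  exists (Num.min eta (Num.min (x - l) (r - x))) => /=.
    by rewrite !lt_min eta0 !subr_gt0 lx.
  move=> h /=; rewrite sub0r normrN !lt_min => /and3P[h1 h2 h3] h0.
  have := Heta (h + x); rewrite /= in_itv /= addrK => Hh.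
  rewrite /GRing.scale /= mulr1 -(ler_pM2r (x := `|h|)) ?normr_gt0 // -normrM.
  rewrite mulrBl mulrAC mulVf // mul1r distrC; apply: Hh => //.
  by move: h2 h3; rewrite !ltr_norml => /andP[h2 h2'] /andP[h3 h3']; lra.
split; last by apply: cvg_lim.
by apply/cvg_ex; exists d.
Qed.

(** Each [x] has a window that [P] crosses from left to right; the supremum of the points where [P]
    holds is then one of them and cannot stop before [r]. It replaces covering arguments for
    properties built up along a segment. *)
Lemma real_induction (P : R -> Prop) (l r : R) : l <= r -> P l ->
  (forall x, l <= x <= r -> exists2 eta : R, 0 < eta & forall y z,
     l <= y <= x -> x <= z <= r -> x - y < eta -> z - x < eta -> P y -> P z) ->
  P r.
Proof.
move=> lr Pl step.
pose S := [set x | l <= x <= r /\ P x].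
have Sl : S l by rewrite /S /= lexx lr.
have supS : has_sup S.
  by split; [exists l|exists r => x [/andP[]]].
set s := sup S.
have ls : l <= s by apply: sup_upper_bound.
have sr : s <= r by apply: ge_sup => [|x [/andP[]] //]; exists l.
have [|eta eta0 Heta] := step s; first by rewrite ls sr.
have [y [/andP[ly yr] Py] ys] := sup_adherent eta0 supS.
have ys' : y <= s by apply: sup_upper_bound => //; rewrite /S /= ly yr.
have ext z : s <= z <= r -> z - s < eta -> P z.
  by move=> szr zs; apply: (Heta y) => //; [rewrite ly|rewrite ltrBlDl -ltrBlDr].
have [sr'|rs] := ltP s r; last first.
  by apply: ext; [rewrite sr lexx|rewrite (_ : r = s) ?subrr //; lra].
pose z := Num.min r (s + eta / 2).
have sz : s < z by rewrite lt_min sr' ltrDl divr_gt0.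
have zr : z <= r by rewrite ge_min lexx.
have : z <= s.
  apply: sup_upper_bound => //; split; first by rewrite zr (le_trans ls) // ltW.
  apply: ext; first by rewrite zr ltW.
  have : z <= s + eta / 2 by rewrite ge_min lexx orbT.
  by lra.
by rewrite leNgt sz.
Qed.

(* Real induction building, for every [x], finitely many disjoint intervals of a
   small open neighbourhood of the exceptional set which carry all but
   [eps * (x - l)] of the increment of [D] between [l] and [x]. *)
Lemma abs_continuous_derive0 (D : R -> R) (l r : R) : l <= r ->
  abs_continuous_on l r D ->
  {ae mu, forall x, x \in `[l, r] -> is_derive_on `[l, r] D x 0} ->
  D r = D l.
Proof.
move=> lr acD [N [mN N0 NP]].
suff H eps : 0 < eps -> `|D r - D l| <= eps * (r - l) + eps.
  apply/eqP; rewrite -subr_eq0 -normr_le0; apply/ler_addgt0Pl => e e0.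
  have rl : 0 < r - l + 1 by rewrite ltr_wpDl // subr_ge0.
  have := H (e / (r - l + 1)) (divr_gt0 e0 rl).
  by rewrite -{2}[_ / _]mulr1 -mulrDr divfK ?gt_eqF // addr0.
move=> e0; have [d d0 acd] := acD _ e0.
(* [U] has measure below the [d] of absolute continuity, so the increments of [D] over disjoint
   intervals in [U] add up to less than [eps]. *)
have [|U [oU NU muU]] := lebesgue_regularity_outer mN _ d0.
  by rewrite [ltLHS]N0.
have muUd : (mu U < d%:E)%E.
  rewrite (_ : U = N `|` (U `\` N)); last by rewrite setDUK.
  apply: le_lt_trans (measureU2 _ _ _) _ => //.
    by apply: measurableD => //; exact: measurable_realfun.open_measurable.
  by rewrite [X in (X + _)%E]N0 add0e.
pose P x := exists s : seq (R * R), [/\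
  forall a, a \in s -> [/\ l <= a.1 <= a.2, a.2 <= x & `]a.1, a.2[ `<=` U],
  pairwise (fun a b : R * R => b.2 <= a.1) s &
  `|D x - D l| <= eps * (x - l) + \sum_(a <- s) `|D a.2 - D a.1|].
suff [s [sP pw /le_trans]] : P r.
  apply; rewrite lerD2l; pose p (i : 'I_(size s)) := (nth (0, 0) s i).1.
  pose q (i : 'I_(size s)) := (nth (0, 0) s i).2.
  have mem_s (i : 'I_(size s)) : nth (0, 0) s i \in s by apply: mem_nth.
  have disj : trivIset [set: 'I_(size s)] (fun i => `]p i, q i[%classic).
    apply/trivIsetP => i j _ _ ij.
    wlog ltij : i j ij / (i < j)%N.
      move=> W; have [|ji] := ltnP i j; first exact: W.
      by rewrite setIC; apply: W; rewrite 1?eq_sym // ltn_neqAle eq_sym ij.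
    apply/seteqP; split=> // t /= []; rewrite !in_itv /= => /andP[pt _] /andP[_ tq].
    have /(pairwiseP (0, 0))/(_ i j) := pw; rewrite !inE !ltn_ord => /(_ isT isT ltij).
    by rewrite /p /q in pt tq *; lra.
  rewrite (big_nth (0, 0)) big_mkord; apply/ltW/(acd _ p q) => //.
  - by move=> i; have [? ? _] := sP _ (mem_s i).
  - rewrite -lte_fin; apply: (le_lt_trans _ muUd).
    pose V := \big[setU/set0]_(i < size s) `]p i, q i[%classic.
    have VU : V `<=` U.
      by rewrite /V -bigcup_seq; apply: bigcup_sub => i _; have [_ _] := sP _ (mem_s i).
    apply: (@le_trans _ _ (mu V)); last first.
      apply: le_measure => //; rewrite inE;
        last exact: measurable_realfun.open_measurable.
      exact: bigsetU_measurable.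
    rewrite measure_bigsetU_ord // -sumEFin.
    apply: lee_sum => i _; rewrite /= lebesgue_measure_itv /= lte_fin.
    case: ltP => //; have [/andP[_ pq] _ _] := sP _ (mem_s i).
    by move=> qp; rewrite lee_fin subr_le0.
apply: (@real_induction P l r) => //.
  by exists [::]; split; rewrite // big_nil !subrr mulr0 normr0 addr0.
(* On [N] the interval from [y] to [z] lies in [U] and joins the list; off [N] the derivative is
   zero and the increment is charged to [eps * (z - y)]. *)
move=> x /andP[lx xr]; have [xN|xN] := boolP (x \in N).
- have := oU x (NU _ (set_mem xN)) => /nbhs_ballP[eta /= eta0 Heta].
  exists eta => // y z /andP[ly yx] /andP[xz zr] xy zx [s [sP pw Ds]].
  exists ((y, z) :: s); split.
  + move=> a; rewrite inE => /predU1P[->|/sP[a1 a2 aU]] /=; last first.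
      by split=> //; lra.
    split; [by apply/andP; split; lra|by []|].
    move=> t /=; rewrite in_itv /= => /andP[yt tz]; apply: Heta.
    by rewrite -ball_normE /= ltr_norml; apply/andP; split; lra.
  + rewrite /= pw andbT; apply/allP => a /sP[_ ay _] //.
  + rewrite big_cons /=.
    have -> : D z - D l = (D z - D y) + (D y - D l) by ring.
    apply: le_trans (ler_normD _ _) _.
    have : eps * (y - l) <= eps * (z - l) by rewrite ler_pM2l //; lra.
    by lra.
- have xD : is_derive_on `[l, r] D x 0.
    have [//|nD] := pselect (is_derive_on `[l, r] D x 0); exfalso.
    move/negP : xN; apply; apply/mem_set/NP => /= H.
    by apply/nD/H; rewrite in_itv /= lx.
  have [eta eta0 Heta] := (is_derive_onP _ _ _ _).1 xD _ e0.
  exists eta => // y z /andP[ly yx] /andP[xz zr] xy zx [s [sP pw Ds]].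
  exists s; split=> //.
    by move=> a /sP[a1 a2 aU]; split=> //; lra.
  have := Heta y; rewrite mul0r subr0 /= in_itv /= ly => Hy.
  have := Heta z; rewrite mul0r subr0 /= in_itv /= zr => Hz.
  have {}Hy : `|D y - D x| <= eps * (x - y).
    rewrite -(@ger0_norm _ (x - y)) ?subr_ge0 // (distrC x); apply: Hy; first lra.
    by rewrite distrC ger0_norm ?subr_ge0.
  have {}Hz : `|D z - D x| <= eps * (z - x).
    rewrite -(@ger0_norm _ (z - x)) ?subr_ge0 //; apply: Hz; first lra.
    by rewrite ger0_norm ?subr_ge0.
  have -> : D z - D l = (D z - D x) - (D y - D x) + (D y - D l) by ring.
  apply: le_trans (ler_normD _ _) _.
  have := ler_normB (D z - D x) (D y - D x).
  by lra.
Qed.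

Lemma abs_continuousB (l r : R) f g : abs_continuous_on l r f ->
  abs_continuous_on l r g -> abs_continuous_on l r (fun x => f x - g x).
Proof.
move=> acf acg e e0; have e20 : 0 < e / 2 by rewrite divr_gt0.
have [d1 d10 H1] := acf _ e20; have [d2 d20 H2] := acg _ e20.
exists (Num.min d1 d2); first by rewrite lt_min d10.
move=> n p q pq tpq; rewrite lt_min => /andP[s1 s2].
rewrite (splitr e); apply: le_lt_trans (ltrD (H1 n p q pq tpq s1) (H2 n p q pq tpq s2)).
rewrite -big_split /=; apply: ler_sum => i _.
rewrite (_ : _ - _ - _ = (f (q i) - f (p i)) - (g (q i) - g (p i))); last by ring.
exact: ler_normB.
Qed.

Lemma abs_continuousS (l r l' r' : R) f : l <= l' -> r' <= r ->
  abs_continuous_on l r f -> abs_continuous_on l' r' f.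
Proof.
move=> ll rr acf e e0; have [d d0 H] := acf _ e0; exists d => // n p q pq.
apply: H => i; have [/andP[lp pq'] qr] := pq i.
by split; [rewrite pq' (le_trans ll)|apply: le_trans rr].
Qed.

Lemma is_derive_onS A B f (x d : R) : A `<=` B ->
  is_derive_on B f x d -> is_derive_on A f x d.
Proof.
move=> AB /is_derive_onP H; apply/is_derive_onP => e e0.
by have [eta eta0 He] := H _ e0; exists eta => // y /AB; exact: He.
Qed.

Lemma is_derive_onB A f g (x d d' : R) : is_derive_on A f x d ->
  is_derive_on A g x d' -> is_derive_on A (fun x => f x - g x) x (d - d').
Proof.
move=> fd gd; rewrite /is_derive_on; under eq_fun => y.
  rewrite (_ : _ / _ = (f y - f x) / (y - x) - (g y - g x) / (y - x)).
    over.
  by rewrite -mulrBl; congr (_ / _); ring.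
exact: cvgB.
Qed.

Lemma abs_continuous_cst (l r c : R) : abs_continuous_on l r (fun=> c).
Proof.
move=> e e0; exists 1 => // n p q _ _ _.
by rewrite big1 // => i _; rewrite subrr normr0.
Qed.

(** The difference of [f] and the integral of [psi] is absolutely continuous with zero derivative
    almost everywhere, hence constant. *)
Lemma abs_continuous_ftc f (psi : R -> R) (l r : R) :
  mu.-integrable setT (EFin \o psi) -> abs_continuous_on l r f ->
  {ae mu, forall x, x \in `[l, r] -> is_derive_on `[l, r] f x (psi x)} ->
  forall x y, l <= x <= y -> y <= r -> f y - f x = itg psi x y.
Proof.
move=> intp acf df.
pose D t := f t - itg psi l t.
have acD : abs_continuous_on l r D.
  by apply: abs_continuousB => //; exact: itg_abs_continuous.
have dD : {ae mu, forall x, x \in `[l, r] -> is_derive_on `[l, r] D x 0}.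
  apply: aeS (aeI df (aeI (itg_derivable l intp) (ae_neq l))) => x.
  move=> [fx [px xl]] xlr; rewrite -(subrr (psi x)).
  apply: is_derive_onB; first exact: fx.
  apply/is_derive_is_derive_on/px.
  by move: xlr; rewrite in_itv /= => /andP[lx _]; rewrite lt_neqAle eq_sym xl.
have H x : l <= x <= r -> D x = D l.
  move=> /andP[lx xr]; apply: abs_continuous_derive0 => //.
    exact: abs_continuousS acD.
  apply: aeS dD => t + tlx; have sub : `[l, x]%classic `<=` `[l, r].
    by apply: subset_itvl; rewrite bnd_simp.
  by move=> /(_ (sub _ tlx)); exact: is_derive_onS.
move=> x y /andP[lx xy] yr.
have := H x; rewrite lx (le_trans xy yr) => /(_ isT).
have := H y; rewrite yr (le_trans lx xy) => /(_ isT) <-.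
rewrite /D -(itg_add intp (y := x) (z := y)) ?lx //; lra.
Qed.

End derivatives.

(** * Continuous functions on a segment and eigenfunctions *)

Section continuity.
Variable R : realType.
Local Notation mu := (leb R).
Implicit Types (f : R -> R) (l r : R).

Lemma within_continuousP (A : set R) f : {within A, continuous f} <->
  forall x, A x -> forall eps, 0 < eps -> exists2 eta : R, 0 < eta &
    forall y, A y -> `|y - x| < eta -> `|f y - f x| < eps.
Proof.
rewrite subspace_continuousP; split=> H x Ax.
- move=> eps e0; have /cvgrPdist_lt/(_ _ e0)[eta /= eta0 He] := H x Ax.
  exists eta => // y Ay yx; have := He y; rewrite /= distrC => /(_ yx Ay).
  by rewrite distrC.
- apply/cvgrPdist_lt => eps e0; have [eta eta0 He] := H x Ax _ e0.
  exists eta => //= y; rewrite /= distrC => yx Ay.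
  by rewrite distrC; exact: He.
Qed.

Lemma segment_unif_continuous f l r : l <= r ->
  {within `[l, r], continuous f} ->
  forall eps, 0 < eps -> exists2 eta : R, 0 < eta &
    forall x y, l <= x <= r -> l <= y <= r -> `|y - x| < eta ->
      `|f y - f x| < eps.
Proof.
move=> lr /within_continuousP fc eps e0.
apply: (@real_induction R (fun r => exists2 eta : R, 0 < eta &
    forall x y, l <= x <= r -> l <= y <= r -> `|y - x| < eta ->
      `|f y - f x| < eps) l r) => //.
  exists 1 => // x y; rewrite -!eq_le => /eqP <- /eqP <- _.
  by rewrite subrr normr0.
move=> x /andP[lx xr]; have e20 : 0 < eps / 2 by rewrite divr_gt0.
have [|eta eta0 He] := fc x _ _ e20; first by rewrite /= in_itv /= lx.
exists (eta / 2); first by rewrite divr_gt0.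
move=> y z /andP[ly yx] /andP[xz zr] xy zx [d d0 Hd].
exists (Num.min d (eta / 2)); first by rewrite lt_min d0 divr_gt0.
have close s : l <= s <= z -> x - eta < s -> `|f s - f x| < eps / 2.
  move=> /andP[ls sz] xs; apply: He; first by rewrite /= in_itv /= ls (le_trans sz).
  by rewrite ltr_norml; apply/andP; split; lra.
move=> s t sz tz; rewrite lt_min => /andP[st st'].
have [/andP[ls _] /andP[lt _]] := (sz, tz).
have [sy|ys] := leP s y; have [ty|yt] := leP t y.
- by apply: Hd; rewrite ?ls ?lt.
all: rewrite ltr_norml in st'; case/andP: st' => st1 st2.
all: rewrite (_ : f t - f s = (f t - f x) - (f s - f x)); last by ring.
all: rewrite (splitr eps); apply: le_lt_trans (ler_normB _ _) (ltrD _ _).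
all: by apply: close => //; lra.
Qed.

Lemma segment_bounded f l r : l <= r -> {within `[l, r], continuous f} ->
  exists2 M : R, 0 < M & forall x, l <= x <= r -> `|f x| <= M.
Proof.
move=> lr fc; have fc' : {within `[l, r], continuous (fun x => `|f x|)}.
  move=> x; apply: cvg_norm; exact: fc.
have [c cP Hc] := EVT_max lr fc'.
exists (`|f c| + 1) => [|x xlr]; first by rewrite ltr_wpDl.
by apply: (le_trans (Hc x _)); rewrite ?lerDl // in_itv.
Qed.

(** The zero is the supremum of the points where [f <= 0]. With [first_zero] it cuts out the nodal
    interval around a point where an eigenfunction is positive. *)
Lemma last_zero f l x0 : l <= x0 -> {within `[l, x0], continuous f} ->
  f l = 0 -> 0 < f x0 ->
  exists2 p, l <= p < x0 & f p = 0 /\ forall x, p < x <= x0 -> 0 < f x.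
Proof.
move=> lx fc fl fx0; have /within_continuousP fc' := fc.
pose S := [set x | l <= x <= x0 /\ f x <= 0].
have Sl : S l by rewrite /S /= lexx lx fl.
have supS : has_sup S by split; [exists l|exists x0 => x [/andP[]]].
set p := sup S.
have lp : l <= p by apply: sup_upper_bound.
have px : p <= x0 by apply: ge_sup => [|x [/andP[]] //]; exists l.
have Sp x : l <= x <= x0 -> f x <= 0 -> x <= p.
  by move=> h1 h2; apply: sup_upper_bound.
have fp : f p <= 0.
  rewrite leNgt; apply/negP => fp0.
  have [|eta eta0 He] := fc' p _ _ fp0; first by rewrite /= in_itv /= lp.
  have [y [/andP[ly yx] fy] yp] := sup_adherent eta0 supS.
  have yp' : y <= p by apply: Sp => //; rewrite ly.
  have := He y; rewrite /= in_itv /= ly yx => /(_ isT).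
  rewrite distrC ger0_norm ?subr_ge0 // ltr_norml => H.
  have : p - y < eta by rewrite -/p in yp; lra.
  by move/H => /andP[]; lra.
have fcp : {within `[p, x0], continuous f}.
  by apply: continuous_subspaceW fc; apply: subset_itvr; rewrite bnd_simp.
have [|c] := IVT px fcp (v := 0).
  by rewrite ge_min le_max fp (ltW fx0) orbT.
rewrite in_itv /= => /andP[pc cx] fc0.
have cp : c = p.
  by apply/eqP; rewrite eq_le pc andbT Sp ?fc0 // cx (le_trans lp).
exists p.
  rewrite lp lt_neqAle px andbT; apply/eqP => px'.
  by move: fx0; rewrite -px' ltNge fp.
split; first by rewrite -cp.
move=> x /andP[px' xx]; rewrite ltNge; apply/negP => fx.
have xp : x <= p by apply: Sp; rewrite ?xx ?(le_trans lp (ltW px')).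
by move: xp; rewrite leNgt px'.
Qed.

Lemma first_zero f x0 r : x0 <= r -> {within `[x0, r], continuous f} ->
  f r = 0 -> 0 < f x0 ->
  exists2 q, x0 < q <= r & f q = 0 /\ forall x, x0 <= x < q -> 0 < f x.
Proof.
move=> xr fc fr fx0; have /within_continuousP fc' := fc.
have [||||p /andP[rp px] [fp Hp]] := @last_zero (fun x => f (- x)) (- r) (- x0).
- by rewrite lerN2.
- apply/within_continuousP => x /=; rewrite in_itv /= => /andP[h1 h2] eps e0.
  have [|eta eta0 He] := fc' (- x) _ _ e0; first by rewrite /= in_itv /=; lra.
  exists eta => // y; rewrite in_itv /= => /andP[h3 h4] yx; apply: He.
    by rewrite /= in_itv /=; lra.
  by rewrite -opprD normrN.
- by rewrite opprK.
- by rewrite opprK.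
exists (- p); first by lra.
split=> // x xx; rewrite -(opprK x); apply: Hp; lra.
Qed.

(** Only on [[l, r]] is [v] known to be bounded; cutting it off outside gives integrability on the
    whole line, the standing assumption of the lemmas on [itg]. *)
Lemma integrable_mul_continuous (a v : R -> R) l r : l <= r ->
  mu.-integrable setT (EFin \o a) -> {within `[l, r], continuous v} ->
  mu.-integrable setT (EFin \o (fun t => a t * (v \_ `[l, r]) t)).
Proof.
move=> lr inta vc.
have [M M0 HM] := segment_bounded lr vc.
have mv : measurable_fun setT (v \_ `[l, r]).
  apply/(measurable_restrictT _ _).1 => //.
  by apply: measurable_realfun.subspace_continuous_measurable_fun.
have bv : [bounded (v \_ `[l, r]) t | t in setT].
  exists M; split; first exact: num_real.
  move=> K MK t _ /=; rewrite patchE; case: ifPn => [|_].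
    by rewrite inE /= in_itv /= => /HM /le_trans; apply; exact: ltW.
  by rewrite normr0 ltW // (lt_trans M0).
by have := integrableMl measurableT inta mv bv.
Qed.

Lemma is_derive_on_continuous f f' l r :
  {in `[l, r], forall x, is_derive_on `[l, r] f x (f' x)} ->
  {within `[l, r], continuous f}.
Proof.
move=> df; apply/within_continuousP => x xlr eps e0.
have [eta eta0 He] := (is_derive_onP _ _ _ _).1 (df x xlr) _ ltr01.
pose K := 1 + `|f' x|.
have K0 : 0 < K by rewrite ltr_pwDl.
exists (Num.min eta (eps / K)); first by rewrite lt_min eta0 divr_gt0.
move=> y yA; rewrite lt_min => /andP[y1 y2].
apply: (@le_lt_trans _ _ (K * `|y - x|)); last by rewrite mulrC -ltr_pdivlMr.
have -> : f y - f x = (f y - f x - f' x * (y - x)) + f' x * (y - x) by ring.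
apply: le_trans (ler_normD _ _) _; rewrite mulrDl lerD //; first exact: He.
by rewrite normrM.
Qed.

Lemma is_derive_on_MVT f f' l r x y :
  {in `[l, r], forall x, is_derive_on `[l, r] f x (f' x)} ->
  l <= x -> x < y -> y <= r ->
  exists2 c, x < c < y & f y - f x = f' c * (y - x).
Proof.
move=> df lx xy yr; have fc := is_derive_on_continuous df.
have [||c] := @MVT R f f' x y xy.
- move=> t txy; apply: (is_derive_on_is_derive (l := l) (r := r)).
    by move: txy; rewrite !in_itv /= => /andP[h1 h2]; apply/andP; split; lra.
  by apply: df; move: txy; rewrite !in_itv /= => /andP[h1 h2]; apply/andP; split; lra.
- by apply: continuous_subspaceW fc; apply: subset_itv; rewrite bnd_simp.
by rewrite in_itv /= => cxy E; exists c.
Qed.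

(** Absolute continuity of [phi'] puts the equation in integrated form; the sign of [phi] is chosen
    so that it is positive somewhere. *)
Lemma eigenfunction_facts (a : R -> R) (al be lam : R) :
  mu.-integrable setT (EFin \o a) -> is_eigenvalue a al be lam ->
  exists phi phi' : R -> R, exists2 x0, al <= x0 <= be &
    [/\ [/\ phi al = 0, phi be = 0 & 0 < phi x0],
     {in `[al, be], forall x, is_derive_on `[al, be] phi x (phi' x)},
     {within `[al, be], continuous phi'} &
     forall x y, al <= x <= y -> y <= be ->
       phi' y - phi' x = - lam * itg (fun t => a t * (phi \_ `[al, be]) t) x y].
Proof.
move=> inta [phi [phi' [[dphi cphi' acphi' eqn] phial phibe [x0]]]].
rewrite in_itv /= => x0P phix0.
have al_be : al <= be by case/andP: x0P => /le_trans; apply.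
have intaf := integrable_mul_continuous al_be inta (is_derive_on_continuous dphi).
have H x y : al <= x <= y -> y <= be ->
    phi' y - phi' x = - lam * itg (fun t => a t * (phi \_ `[al, be]) t) x y.
  rewrite -itgZ //; apply: abs_continuous_ftc => //.
    exact: (integrableZl measurableT (- lam) intaf).
  apply: aeS eqn => t Ht tab; have [w dw wE] := Ht tab.
  rewrite patchE mem_set // (_ : _ * _ = w) //.
  by move: wE => /eqP; rewrite addr_eq0 => /eqP ->; ring.
have [phi0|phi0] := ltP 0 (phi x0).
  by exists phi, phi', x0 => //; split.
exists (fun x => 0 - phi x), (fun x => 0 - phi' x), x0 => //; split.
- by split; rewrite ?phial ?phibe ?subrr // sub0r oppr_gt0 lt_neqAle phix0.
- move=> x xP; apply: is_derive_onB; last exact: dphi.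
  exact: is_derive_is_derive_on.
- move=> x; apply: cvgB; [exact: cvg_cst|exact: cphi'].
- move=> x y xy yb; rewrite [in RHS](_ : (fun t => _) =
    (fun t => -1 * (a t * (phi \_ `[al, be]) t))); last first.
    apply/funext => t; rewrite !patchE; case: ifP => _; last by rewrite mulr0 mulr0.
    by ring.
  by rewrite itgZ // mulrCA -(H x y) //; ring.
Qed.

(** The zeros [p] and [q] bound the arch. The mean value theorem on either side of [x0] supplies
    [x1] and [x2] with [phi' x1 > 0 > phi' x2]; the drop of [phi'] between them is [lam] times an
    integral of [a * phi], so [lam] and the weight of []x1, x2]] are positive. The midpoints [x1']
    and [x2'] leave room for the mesh around this core. *)
Lemma eigenfunction_arch (a : R -> R) (al be lam : R) :
  mu.-integrable setT (EFin \o a) ->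
  {ae mu, forall x, x \in `[al, be] -> 0 <= a x} ->
  is_eigenvalue a al be lam ->
  exists (phi phi' : R -> R) (p q x1' x1 x2 x2' c : R),
    [/\ [/\ al <= p, q <= be, phi p = 0 & phi q = 0],
     [/\ forall x, p < x < q -> 0 < phi x,
     {in `[al, be], forall x, is_derive_on `[al, be] phi x (phi' x)},
     {within `[al, be], continuous phi'} &
     forall x y, al <= x <= y -> y <= be ->
       phi' y - phi' x = - lam * itg (fun t => a t * (phi \_ `[al, be]) t) x y],
     [/\ p < x1' < x1, x1 < x2, x2 < x2' < q, 0 < c &
       forall x, x1' <= x <= x2' -> 2 * c <= phi x] &
     0 < itg a x1 x2 /\ 0 < lam].
Proof.
move=> inta a0 /(eigenfunction_facts inta).
move=> [phi [phi' [x0 /andP[ax xb] [[phia phib phi0] dphi cphi' ftc]]]].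
have ab := le_trans ax xb.
have cphi := is_derive_on_continuous dphi.
have cl : {within `[al, x0], continuous phi}.
  by apply: continuous_subspaceW cphi; apply: subset_itvl; rewrite bnd_simp.
have [p /andP[ap px] [phip pP]] := last_zero ax cl phia phi0.
have cr : {within `[x0, be], continuous phi}.
  by apply: continuous_subspaceW cphi; apply: subset_itvr; rewrite bnd_simp.
have [q /andP[xq qb] [phiq qP]] := first_zero xb cr phib phi0.
have phi_pos x : p < x < q -> 0 < phi x.
  move=> /andP[h1 h2]; have [h|h] := leP x x0; first by apply: pP; rewrite h1.
  by apply: qP; rewrite h2 ltW.
have [x1 /andP[px1 x1x] E1] := is_derive_on_MVT dphi ap px xb.
have [x2 /andP[xx2 x2q] E2] := is_derive_on_MVT dphi ax xq qb.
have d1 : 0 < phi' x1.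
  rewrite -(pmulr_lgt0 (phi' x1) (x := x0 - p)) ?subr_gt0 // -E1 phip; lra.
have d2 : phi' x2 < 0.
  rewrite -(pmulr_llt0 (phi' x2) (x := q - x0)) ?subr_gt0 // -E2 phiq; lra.
have x12 : x1 < x2 by lra.
have intaf := integrable_mul_continuous ab inta cphi.
have [B B0 HB] := segment_bounded ab cphi.
have I0 : 0 <= itg (fun t => a t * (phi \_ `[al, be]) t) x1 x2.
  apply: itg_ge0 => //; apply: aeS a0 => t Ht.
  rewrite in_itv /= => /andP[t1 t2].
  have tab : t \in `[al, be] by rewrite in_itv /=; apply/andP; split; lra.
  rewrite patchE mem_set // mulr_ge0 ?Ht // ltW // phi_pos //.
  by apply/andP; split; lra.
have E : lam * itg (fun t => a t * (phi \_ `[al, be]) t) x1 x2 = phi' x1 - phi' x2.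
  by rewrite -opprB ftc ?mulNr ?opprK //; lra.
have lamI : 0 < lam * itg (fun t => a t * (phi \_ `[al, be]) t) x1 x2.
  by rewrite E; lra.
have lam0 : 0 < lam by apply: contraTT lamI; rewrite -!leNgt => ?; exact: mulr_le0_ge0.
have I1 : 0 < itg (fun t => a t * (phi \_ `[al, be]) t) x1 x2.
  by rewrite -(pmulr_rgt0 _ lam0).
have Ia : 0 < itg a x1 x2.
  rewrite -(pmulr_rgt0 _ B0); apply: lt_le_trans I1 _.
  rewrite -itgZ //; apply: le_itg => //.
    exact: (integrableZl measurableT B inta).
  apply: aeS a0 => t Ht; rewrite in_itv /= => /andP[t1 t2].
  have tab : al <= t <= be by apply/andP; split; lra.
  rewrite patchE mem_set /= ?in_itv //= mulrC ler_wpM2r ?Ht ?in_itv //.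
  exact: le_trans (ler_norm _) (HB _ tab).
pose x1' := (p + x1) / 2; pose x2' := (x2 + q) / 2.
have x12' : x1' <= x2' by rewrite /x1' /x2'; lra.
have [|c0] := @EVT_min R phi x1' x2' x12'.
  apply: continuous_subspaceW cphi; apply: subset_itv; rewrite bnd_simp /x1' /x2'; lra.
rewrite in_itv /= => /andP[c1 c2] Hc.
have phic : 0 < phi c0.
  by apply: phi_pos; rewrite /x1' /x2' in c1 c2; apply/andP; split; lra.
exists phi, phi', p, q, x1', x1, x2, x2', (phi c0 / 2); split=> //; split=> //.
- by rewrite /x1'; apply/andP; split; lra.
- by rewrite /x2'; apply/andP; split; lra.
- by rewrite divr_gt0.
- by move=> x xP; rewrite mulrC divfK // Hc // in_itv.
Qed.

End continuity.

(** * Large solutions *)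

Definition cell (R : realType) (a : R -> R) (h : R) (k : nat) : R :=
  itg a (k.-1%:R * h) (k%:R * h).

Section nodal_interval.
Variable R : realType.
Local Notation mu := (leb R).

(** The chord from [j] to the end of the interval beyond [k], where [e] is merely nonnegative,
    bounds [e k] from below by a fraction of [e j]. On the right the end is the first node past
    [be], possibly a ghost, and [j] itself may stick out by one cell; so the chord can have length
    [2 * (be - al)], and [k] is only known to be [eps / 2] from its end. *)
Lemma concave_lower_bound (al be h eps : R) N (e : nat -> R) j :
  0 <= al -> be <= N%:R * h -> 0 < h -> h <= be - al -> 2 * h <= eps ->
  (forall k, (k <= N.+1)%N -> 0 <= e k) -> (0 < j <= N)%N ->
  al <= j%:R * h -> j.-1%:R * h <= be ->
  (forall k, (0 < k <= N)%N -> al <= k.-1%:R * h -> k%:R * h <= be ->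
     0 <= d2 e k) ->
  forall k, (0 < k <= N)%N -> al + eps <= k%:R * h <= be - eps ->
    eps / (4 * (be - al)) * e j <= e k.
Proof.
move=> al0 beN h0 hba heps e0 /andP[j0 jN] alj jbe conc k /andP[k0 kN].
move=> /andP[alk kbe].
have ba0 : 0 < be - al by lra.
have ej0 : 0 <= e j by apply/e0/leqW.
have ek0 : 0 <= e k by apply/e0/leqW.
suff H (u v : R) : eps / 2 <= u * h -> v * h <= 2 * (be - al) ->
    u * e j <= v * e k -> eps / (4 * (be - al)) * e j <= e k.
  have be0 : 0 <= be / h by rewrite divr_ge0 ?(ltW h0) //; lra.
  have alh0 : 0 <= al / h by rewrite divr_ge0 // ltW.
  have [jk|/ltnW kj] := leqP j k.
  - pose q := (Num.truncn (be / h)).+1.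
    have qbe : be < q%:R * h by rewrite -ltr_pdivrMr // truncnS_gt.
    have qbe' i : (i < q)%N -> i%:R * h <= be.
      rewrite ltnS => iq; rewrite -ler_pdivlMr //.
      apply: (@le_trans _ _ (Num.truncn (be / h))%:R); first by rewrite ler_nat.
      by rewrite truncn_le.
    have kq : (k <= q)%N.
      rewrite -(ler_nat R) -(ler_pM2r h0); lra.
    have qN : (q <= N.+1)%N.
      rewrite ltnS -(ler_nat R) -(ler_pM2r h0); apply: le_trans beN.
      exact: qbe'.
    have := @concave_chord R e j q k; rewrite jk kq => /(_ isT) ch.
    apply: (H (q - k)%:R (q - j)%:R).
    + by rewrite natrB // mulrBl; lra.
    + have := qbe' q.-1 (ltnSn _); rewrite natrB ?(leq_trans jk) // mulrBl.
      by rewrite /q -natr1 /= mulrDl mul1r; lra.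
    + apply: le_trans (ch _); first by rewrite lerDl mulr_ge0 // e0.
      move=> i /andP[ji iq]; have i0 : (0 < i)%N by apply: leq_trans ji.
      apply: conc; last exact: qbe'.
        by rewrite i0 -ltnS (leq_trans iq).
      apply: le_trans alj _; rewrite ler_pM2r // ler_nat.
      by rewrite -ltnS prednK.
  - pose p := (Num.truncn (al / h)).+1.
    have pal : al < p%:R * h by rewrite -ltr_pdivrMr // truncnS_gt.
    have pal' : p.-1%:R * h <= al by rewrite -ler_pdivlMr // truncn_le.
    have pE : p%:R * h = p.-1%:R * h + h by rewrite /p -natr1 mulrDl mul1r.
    have pk : (p <= k)%N.
      by rewrite /p -(ltr_nat R) -(ltr_pM2r h0) -/(p.-1); lra.
    have jE : j%:R * h = j.-1%:R * h + h.
      by rewrite -[in LHS](prednK j0) -natr1 mulrDl mul1r.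
    have := @concave_chord R e p j k; rewrite pk kj => /(_ isT) ch.
    apply: (H (k - p)%:R (j - p)%:R).
    + by rewrite natrB // mulrBl; lra.
    + by rewrite natrB ?(leq_trans pk) // mulrBl; lra.
    + apply: le_trans (ch _).
        by rewrite lerDr mulr_ge0 // e0 // (leq_trans pk) // leqW.
      move=> i /andP[pi ij]; have i0 : (0 < i)%N by apply: leq_trans pi.
      apply: conc.
      * by rewrite i0 (leq_trans (ltnW ij)).
      * apply: le_trans (ltW pal) _; rewrite ler_pM2r // ler_nat.
        by rewrite -ltnS prednK.
      * apply: le_trans jbe; rewrite ler_pM2r // ler_nat.
        by rewrite -ltnS prednK.
move=> uh vh uv; rewrite mulrAC ler_pdivrMr ?mulr_gt0 //.
have h1 : eps / 2 * e j <= u * h * e j by rewrite ler_wpM2r.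
have h2 : v * h * e k <= 2 * (be - al) * e k by rewrite ler_wpM2r.
have h3 : h * (u * e j) <= h * (v * e k) by rewrite ler_pM2l.
lra.
Qed.

(** Each step replaces [phi' c], with [c] from the mean value theorem, by the value at the left
    node, an error of at most [h * w]. *)
Lemma euler_sum (phi phi' : R -> R) (al be h w q : R) k0 k :
  {in `[al, be], forall x, is_derive_on `[al, be] phi x (phi' x)} ->
  0 < h -> al <= k0%:R * h -> q <= be ->
  (forall s t, al <= s <= be -> al <= t <= be -> `|t - s| <= h ->
     `|phi' t - phi' s| <= w) ->
  (k0 <= k)%N -> k%:R * h <= q ->
  `|phi (k0%:R * h) + \sum_(k0 <= i < k) h * phi' (i%:R * h) - phi (k%:R * h)|
    <= (k - k0)%:R * h * w.
Proof.
move=> dphi h0 alk0 qbe phiw; elim: k => [|k IH].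
  by rewrite leqn0 => /eqP -> _; rewrite big_geq // addr0 subrr normr0 mul0r mul0r.
rewrite leq_eqVlt => /predU1P[<- _|].
  by rewrite big_geq // addr0 subrr normr0 subnn !mul0r.
rewrite ltnS => k0k kq.
have kE : k.+1%:R * h = k%:R * h + h by rewrite -natr1 mulrDl mul1r.
have k0k' : k0%:R * h <= k%:R * h by rewrite ler_pM2r // ler_nat.
have [||//|c /andP[c1 c2] E] :=
  is_derive_on_MVT dphi (x := k%:R * h) (y := k.+1%:R * h); try lra.
rewrite big_nat_recr //= subSn //.
have -> : (k - k0).+1%:R * h * w = (k - k0)%:R * h * w + h * w.
  by rewrite -natr1; ring.
rewrite (_ : _ - _ = (phi (k0%:R * h) + \sum_(k0 <= i < k) h * phi' (i%:R * h)
   - phi (k%:R * h)) + h * (phi' (k%:R * h) - phi' c)); last first.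
  by move: E; rewrite kE addrAC subrr add0r => E; lra.
apply: le_trans (ler_normD _ _) _; apply: lerD; first by apply: IH => //; lra.
rewrite normrM gtr0_norm // ler_pM2l //; apply: phiw.
- by apply/andP; split; lra.
- by apply/andP; split; lra.
- by rewrite ler_norml; apply/andP; split; lra.
Qed.

Lemma cell_ge0 (a : R -> R) (al be h : R) k :
  mu.-integrable setT (EFin \o a) ->
  {ae mu, forall x, x \in `[al, be] -> 0 <= a x} ->
  al <= k.-1%:R * h -> k%:R * h <= be -> 0 <= cell a h k.
Proof.
move=> inta a0 alk kbe; apply: itg_ge0 => //; apply: aeS a0 => t Ht.
rewrite in_itv /= => /andP[t1 t2]; apply: Ht; rewrite in_itv /=.
by apply/andP; split; lra.
Qed.

(* The test sequence [psi] is the positive part of [P - delta], where [P] is the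
   Euler polygon of [phi]: its second differences are exactly integrals of
   [lam * a * phi] over the cells, and truncating at level [delta] removes all
   boundary terms. *)
Lemma arch_contradiction (a phi phi' : R -> R)
    (al be lam p q x1' x1 x2 x2' c T L theta M : R) :
  mu.-integrable setT (EFin \o a) ->
  {ae mu, forall x, x \in `[al, be] -> 0 <= a x} ->
  0 <= al -> be <= T -> al <= p -> q <= be -> phi p = 0 -> phi q = 0 ->
  {in `[al, be], forall x, is_derive_on `[al, be] phi x (phi' x)} ->
  {within `[al, be], continuous phi'} ->
  (forall x y, al <= x <= y -> y <= be ->
     phi' y - phi' x = - lam * itg (fun t => a t * (phi \_ `[al, be]) t) x y) ->
  p < x1' -> x1' < x1 -> x1 < x2 -> x2 < x2' -> x2' < q -> 0 < c ->
  (forall x, x1' <= x <= x2' -> 2 * c <= phi x) ->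
  0 < itg a x1 x2 -> 0 < lam -> lam < L -> 0 < theta -> 0 <= M ->
  exists eps H : R, [/\ 0 < eps, 0 < H & forall N (h rho : R) (e : nat -> R),
    (0 < N)%N -> 0 < h < H -> N%:R * h = T ->
    \sum_(1 <= k < N.+1) `|cell a h k| <= M -> 0 < rho ->
    (forall k, (0 < k <= N)%N -> 0 <= e k <= rho) ->
    (forall k, (0 < k <= N)%N -> x1' <= k%:R * h <= x2' ->
       theta * rho <= e k) ->
    ~ (forall k, (0 < k <= N)%N -> al + eps <= k%:R * h <= be - eps ->
       h * (L * cell a h k * e k) <= d2 e k)].
Proof.
move=> inta a0 al0 beT alp qbe phip phiq dphi cphi' ftc px1' x1'x1 x12 x2x2'.
move=> x2'q c0 phic acore0 lam0 lamL theta0 M0.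
have L0 : 0 < L by lra.
have al_be : al <= be by lra.
have T0 : 0 < T by lra.
set kappa := L - lam; have kappa0 : 0 < kappa by rewrite subr_gt0.
set A := itg a x1 x2 in acore0.
(* [e1] is the loss allowed per unit of weight, relative to [rho]: over the total weight [M] it
   costs at most half of what the core yields. *)
pose e1 := Num.min (kappa * c / 2) (theta * kappa * c * A / (4 * (M + 1))).
have e10 : 0 < e1.
  rewrite lt_min !divr_gt0 ?mulr_gt0 //; lra.
have e1_le : e1 <= kappa * c / 2 by rewrite ge_min lexx.
have e1_le' : e1 * M <= theta * kappa * c * A / 4.
  have : e1 <= theta * kappa * c * A / (4 * (M + 1)) by rewrite ge_min lexx orbT.
  rewrite ler_pdivlMr; last by lra.
  have : 0 <= e1 * M by rewrite mulr_ge0 // ltW.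
  by lra.
(* [delta] is the truncation level and [eta], below, the error of the polygon; together they keep
   [L * delta + 2 * lam * eta] below [e1]. *)
pose delta := Num.min (c / 2) (e1 / (4 * L)).
have delta0 : 0 < delta by rewrite lt_min !divr_gt0 ?mulr_gt0.
have deltac : delta <= c / 2 by rewrite ge_min lexx.
have deltaL : L * delta <= e1 / 4.
  have : delta <= e1 / (4 * L) by rewrite ge_min lexx orbT.
  by rewrite ler_pdivlMr ?mulr_gt0 //; lra.
pose eta := Num.min (delta / 2) (e1 / (4 * lam)).
have eta0 : 0 < eta by rewrite lt_min !divr_gt0 ?mulr_gt0.
have etad : eta <= delta / 2 by rewrite ge_min lexx.
have etal : lam * eta <= e1 / 4.
  have : eta <= e1 / (4 * lam) by rewrite ge_min lexx orbT.
  by rewrite ler_pdivlMr ?mulr_gt0 //; lra.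
have kappaE : kappa = L - lam by [].
clearbody eta delta e1 kappa.
have cphi := is_derive_on_continuous dphi.
have [H1 H10 HH1] := segment_unif_continuous al_be cphi eta0.
have [H2 H20 HH2] := segment_unif_continuous al_be cphi' (divr_gt0 eta0 T0).
have d20 : 0 < delta / 2 by rewrite divr_gt0.
have [eps eps0 Heps] := segment_unif_continuous al_be cphi d20.
exists eps, (Num.min (Num.min H1 H2) (Num.min (eps / 2)
  (Num.min (x1 - x1') (x2' - x2)))); split=> //.
  by rewrite !lt_min H10 H20 divr_gt0 //= !subr_gt0 x1'x1.
move=> N h rho e N0 /andP[h0]; rewrite !lt_min.
move=> /and3P[/andP[hH1 hH2] heps /andP[hx1 hx2]] hT aM rho0 eB ecore esup.
pose t (k : nat) := k%:R * h.
have tS k : t k.+1 = t k + h by rewrite /t -natr1 mulrDl mul1r.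
have tP k : (0 < k)%N -> t k = t k.-1 + h.
  by move=> k0; rewrite -[in LHS](prednK k0) tS.
have t_le i j : (i <= j)%N -> t i <= t j by move=> ij; rewrite ler_pM2r ?ler_nat.
have t_lt i j : t i < t j -> (i < j)%N by rewrite ltr_pM2r // ltr_nat.
have tN : t N = T by [].
have tE k : t k = k%:R * h by [].
pose k0 := (Num.truncn (p / h)).+1.
have p0 : 0 <= p by exact: le_trans alp.
have pk0 : p < t k0 by rewrite /t -ltr_pdivrMr // truncnS_gt.
have k0p k : p < t k -> (k0 <= k)%N.
  move=> pk; rewrite -(ltr_nat R) -(ltr_pM2r h0); apply: le_lt_trans pk.
  by rewrite -ler_pdivlMr // truncn_le divr_ge0 // ltW.
clearbody k0.
pose P k := phi (t k0) + \sum_(k0 <= i < k) h * phi' (t i).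
have PS k : (k0 <= k)%N -> P k.+1 = P k + h * phi' (t k).
  by move=> k0k; rewrite /P big_nat_recr //= addrA.
have Pphi k : (k0 <= k)%N -> t k <= q -> `|P k - phi (t k)| <= eta.
  move=> k0k kq.
  have w0 : 0 <= eta / T by rewrite ltW // divr_gt0.
  have := euler_sum (w := eta / T) dphi h0 (_ : al <= k0%:R * h) qbe _ k0k kq.
  move=> /(_ _ _)/le_trans; apply.
  - by rewrite (le_trans alp) // ltW.
  - move=> u v uP vP uv; apply/ltW/HH2 => //; exact: le_lt_trans uv hH2.
  - have E : T * (eta / T) = eta by rewrite mulrC divfK // gt_eqF.
    rewrite -[leRHS]E ler_wpM2r // natrB // mulrBl.
    by rewrite -/(t k) -/(t k0); clear -pk0 kq p0 qbe beT tN hT; rewrite -tN; lra.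
clearbody P.
(* The support of [psi]. There [phi] is at least [delta / 2], so uniform continuity keeps it [eps]
   away from [p] and [q], which are zeros; since [2 * h < eps], neighbours of such nodes are still
   inside the arch. *)
pose S k := [&& (k0 <= k)%N, t k <= q & delta < P k].
have Sin k : S k -> [/\ p + eps <= t k, t k <= q - eps & delta < P k].
  move=> /and3P[k0k kq dP]; have pk : p < t k by rewrite (lt_le_trans pk0) ?t_le.
  have phik : delta / 2 <= phi (t k).
    have := Pphi k k0k kq; rewrite ler_norml => /andP[_].
    by clear -dP etad; lra.
  have kP : al <= t k <= be.
    by rewrite (le_trans alp (ltW pk)) (le_trans kq).
  split=> //; rewrite leNgt; apply/negP => lt.
  - have pP : al <= p <= be by rewrite alp (le_trans (ltW pk) (le_trans kq qbe)).
    have : `|t k - p| < eps by rewrite gtr0_norm ?subr_gt0 // ltrBlDl.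
    move/(Heps p (t k) pP kP); rewrite phip subr0 => /(le_lt_trans (ler_norm _)).
    by rewrite ltNge phik.
  - have qP : al <= q <= be by rewrite qbe (le_trans (le_trans alp (ltW pk)) kq).
    have : `|t k - q| < eps by rewrite distrC ger0_norm ?subr_ge0 //; clear -lt; lra.
    move/(Heps q (t k) qP kP); rewrite phiq subr0 => /(le_lt_trans (ler_norm _)).
    by rewrite ltNge phik.
have S_nbrs k : S k -> [/\ (1 < k < N)%N, (k0 < k)%N & t k.+1 <= q].
  move=> Sk; have [k1 k2 _] := Sin _ Sk; split.
  - have t0 : t 0%N = 0 by rewrite /t mul0r.
    apply/andP; split; apply: t_lt; rewrite ?tS ?t0 ?tN;
      clear -k1 k2 p0 heps qbe beT eps0; lra.
  - have : (0 < k)%N by apply: t_lt; rewrite /t mul0r -/(t k); clear -k1 p0 eps0; lra.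
    move=> kp; rewrite -(prednK kp) ltnS; apply: k0p.
    by rewrite (tP _ kp) in k1; clear -k1 heps eps0; lra.
  - by rewrite tS; clear -k2 heps eps0; lra.
pose psi k := if (k0 <= k)%N && (t k <= q) then Num.max (P k - delta) 0 else 0.
have psi_ge0 k : 0 <= psi k by rewrite /psi; case: ifP => // _;
  rewrite le_max lexx orbT.
have psi_ge k : (k0 <= k)%N -> t k <= q -> P k - delta <= psi k.
  by move=> h1 h2; rewrite /psi h1 h2 le_max lexx.
have psiS k : S k -> psi k = P k - delta.
  by move=> /and3P[h1 h2 h3]; rewrite /psi h1 h2 max_l // subr_ge0 ltW.
have psiNS k : ~~ S k -> psi k = 0.
  rewrite /psi /S; case: (k0 <= k)%N => //=; case: (t k <= q) => //=.
  by rewrite -leNgt => h1; rewrite max_r // subr_le0.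
have psi_bd k : ~~ (1 < k < N)%N -> psi k = 0.
  by move=> kN; apply: psiNS; apply: contra kN => /S_nbrs[].
have := @summation_by_parts R e psi N N0.
have [z0 z1 zN zN1] : [/\ psi 0%N = 0, psi 1%N = 0, psi N = 0 & psi N.+1 = 0].
  by split; apply: psi_bd; clear; lia.
move=> /(_ z0 z1 zN zN1) parts.
(* This is [L * (P k - delta) - lam * (P k + 2 * eta)], the coefficient left when the inequalities
   for [d2 e] and [d2 psi] are combined. *)
pose b k := kappa * P k - L * delta - 2 * lam * eta.
have a_ge0 k : S k -> 0 <= cell a h k.
  move=> Sk; have [k1 k2 _] := Sin _ Sk; apply: (cell_ge0 inta a0); rewrite -/(t _).
    have [/andP[k3 _] _ _] := S_nbrs _ Sk; rewrite (tP k (ltnW k3)) in k1.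
    by clear -k1 alp heps eps0; lra.
  by clear -k2 qbe eps0; lra.
(* One [eta] pays for replacing [phi] by the polygon at the node, the other for the variation of
   [phi] over the cell. *)
have d2psi k : S k -> d2 psi k <= h * (lam * (P k + 2 * eta) * cell a h k).
  move=> Sk; have [k1 k2 k3] := Sin _ Sk; have [/andP[k4 k5] k6 k7] := S_nbrs _ Sk.
  have kp : (0 < k)%N by apply: ltnW.
  have tk := tP _ kp.
  have hm : (k0 <= k.-1)%N by rewrite -ltnS prednK.
  have h1 := psi_ge k.-1 hm _; have h2 := psi_ge k.+1 (leqW (ltnW k6)) k7.
  have {}h1 : P k.-1 - delta <= psi k.-1.
    by apply: h1; clear -tk k2 eps0 h0; lra.
  have E1 := PS k (ltnW k6).
  have E2 := PS k.-1 hm; rewrite prednK // in E2.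
  have E3 : phi' (t k) - phi' (t k.-1) = - lam * itg (fun t => a t *
    (phi \_ `[al, be]) t) (t k.-1) (t k).
    apply: ftc; last by clear -k2 qbe eps0; lra.
    by clear -k1 tk alp heps eps0 h0; apply/andP; split; lra.
  have intaf := integrable_mul_continuous al_be inta cphi.
  have E4 : itg (fun t => a t * (phi \_ `[al, be]) t) (t k.-1) (t k) <=
      (P k + 2 * eta) * cell a h k.
    rewrite /cell -itgZ //; apply: le_itg => //.
      exact: (integrableZl measurableT (P k + 2 * eta) inta).
    apply: aeS a0 => s Hs; rewrite in_itv /= => /andP[s1 s2].
    have sab : al <= s <= be.
      by clear -s1 s2 k1 k2 tk alp qbe heps eps0; apply/andP; split; lra.
    rewrite patchE mem_set /= ?in_itv //= mulrC ler_wpM2r ?Hs ?in_itv //.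
    have kab : al <= t k <= be.
      by clear -k1 k2 alp qbe eps0; apply/andP; split; lra.
    have sk : `|s - t k| < H1.
      by rewrite ler0_norm ?subr_le0 //; clear -s1 tk hH1; lra.
    have := HH1 _ _ kab sab sk; rewrite ltr_norml => /andP[_ Hs''].
    have kq : t k <= q by clear -k2 eps0; lra.
    have := Pphi k (ltnW k6) kq; rewrite ler_norml => /andP[Hp' _].
    by clear -Hp' Hs''; lra.
  rewrite /d2 psiS //.
  apply: (@le_trans _ _ (h * (phi' (t k.-1) - phi' (t k)))).
    by rewrite mulrBr; clear -h1 h2 E1 E2; lra.
  rewrite ler_pM2l // -opprB E3 mulNr opprK -mulrA ler_pM2l //.
have termwise k : (0 < k <= N)%N ->
    (if S k then h * (cell a h k * e k * b k) else 0)
      <= psi k * d2 e k - e k * d2 psi k.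
  move=> kN; have /andP[ek0 ekr] := eB _ kN.
  have [Sk|Sk] := boolP (S k); last first.
    rewrite (psiNS _ Sk) mul0r sub0r oppr_ge0 mulr_ge0_le0 // /d2 (psiNS _ Sk).
    by have := psi_ge0 k.-1; have := psi_ge0 k.+1; clear; lra.
  have [k1 k2 k3] := Sin _ Sk.
  have /esup : (0 < k <= N)%N by [].
  have -> : (al + eps <= k%:R * h <= be - eps) = true.
    by rewrite -/(t k); clear -k1 k2 alp qbe; apply/andP; split; lra.
  move=> /(_ isT) h1; have h2 := d2psi _ Sk.
  rewrite (psiS _ Sk).
  have h3 : (P k - delta) * (h * (L * cell a h k * e k)) <= (P k - delta) * d2 e k.
    by rewrite ler_wpM2l // subr_ge0 ltW.
  have h4 := ler_wpM2l ek0 h2.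
  rewrite /b kappaE; clear -h3 h4; lra.
have le0 : \sum_(1 <= k < N.+1) (if S k then cell a h k * e k * b k else 0) <= 0.
  rewrite -(pmulr_rle0 _ h0) mulr_sumr.
  apply: (@le_trans _ _ (\sum_(1 <= k < N.+1) (psi k * d2 e k - e k * d2 psi k))).
    rewrite big_nat [leRHS]big_nat; apply: ler_sum => k kN.
    by have := termwise k kN; case: (S k); rewrite ?mulr0.
  by rewrite sumrB parts subrr.
(* These nodes enclose []x1, x2]] within one mesh width: the cells between them carry at least the
   weight [A], and their nodes stay where [phi >= 2 * c]. *)
pose c1 := Num.truncn (x1 / h); pose c2 := (Num.truncn (x2 / h)).+1.
have c1x : t c1 <= x1.
  rewrite /t -ler_pdivlMr // truncn_le divr_ge0 ?(ltW h0) //.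
  by clear -p0 px1' x1'x1; lra.
have xc1 : x1 < t c1.+1 by rewrite /t -ltr_pdivrMr // truncnS_gt.
have xc2 : x2 < t c2 by rewrite /t -ltr_pdivrMr // truncnS_gt.
have c2x : t c2.-1 <= x2.
  by rewrite /t -ler_pdivlMr // truncn_le divr_ge0 ?(ltW h0) //;
    clear -p0 px1' x1'x1 x12; lra.
have c2E : t c2 = t c2.-1 + h by apply: tP.
have c1E := tS c1.
clearbody c1 c2.
have c12 : (c1 <= c2)%N by apply/ltnW/t_lt; clear -c1x xc2 x12; lra.
have c2N : (c2 <= N)%N.
  by apply/ltnW/t_lt; rewrite tN; clear -c2E c2x hx2 x2'q qbe beT; lra.
have a_ge0' s u : al <= s -> u <= be -> 0 <= itg a s u.
  move=> als ube; apply: itg_ge0 => //; apply: aeS a0 => v Hv.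
  rewrite in_itv /= => /andP[v1 v2]; apply: Hv; rewrite in_itv /=.
  by rewrite (le_trans als (ltW v1)) (le_trans v2).
have coreA : A <= \sum_(c1.+1 <= k < c2.+1) cell a h k.
  rewrite /cell (itg_sum inta (ltW h0) c12) -/(t c1) -/(t c2).
  rewrite -(itg_add inta (x := t c1) (y := x1) (z := t c2)); last first.
    by clear -c1x xc2 x12; apply/andP; split; lra.
  rewrite -(itg_add inta (x := x1) (y := x2) (z := t c2)); last by rewrite !ltW.
  have := a_ge0' (t c1) x1; have := a_ge0' x2 (t c2); rewrite -/A.
  move=> h1 h2; have {}h1 : 0 <= itg a x2 (t c2).
    by clear -h1 alp px1' x1'x1 x12 c2E c2x hx2 x2'q qbe; apply: h1; lra.
  have {}h2 : 0 <= itg a (t c1) x1.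
    by clear -h2 alp px1' c1E xc1 hx1 x12 x2x2' x2'q qbe; apply: h2; lra.
  by rewrite addrCA lerDl addr_ge0.
have core k : (c1 < k <= c2)%N -> [/\ S k, c <= P k & theta * rho <= e k].
  move=> /andP[ck kc]; have k1 := t_le _ _ ck; have k2 := t_le _ _ kc.
  have k0k : (k0 <= k)%N by apply: k0p; clear -k1 xc1 px1' x1'x1; lra.
  have kq : t k <= q by clear -k2 c2E c2x hx2 x2'q; lra.
  have Pc : c <= P k.
    have := Pphi k k0k kq; rewrite ler_norml => /andP[h1 _].
    have := phic (t k); rewrite (_ : (_ <= _ <= _) = true).
      by move=> /(_ isT); clear -h1 etad deltac c0; lra.
    by clear -k1 k2 xc1 x1'x1 c2E c2x hx2; apply/andP; split; lra.
  split=> //; first by rewrite /S k0k kq /=; clear -deltac c0 Pc; lra.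
  apply: ecore; first by rewrite (leq_trans _ ck) //= (leq_trans kc).
  by rewrite -/(t k); clear -k1 k2 xc1 x1'x1 c2E c2x hx2; apply/andP; split; lra.
pose C := theta * rho * (kappa * c / 2).
have C0 : 0 < C by rewrite !mulr_gt0 // ?divr_gt0 ?mulr_gt0.
(* On the core [b k >= kappa * c / 2] and [e k >= theta * rho]; elsewhere on [S] only [b k >= - e1]
   is available. *)
have lower k : (0 < k <= N)%N ->
   (if (c1 < k <= c2)%N then C * cell a h k else 0) - e1 * rho * `|cell a h k|
     <= (if S k then cell a h k * e k * b k else 0).
  move=> kN; have /andP[ek0 ekr] := eB _ kN.
  have ea0 : 0 <= e1 * rho * `|cell a h k| by rewrite !mulr_ge0 // ltW.
  have [ck|_] := boolP (c1 < k <= c2)%N.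
    have [Sk cP thk] := core k ck; rewrite Sk.
    have ak := a_ge0 _ Sk.
    have bk : kappa * c / 2 <= b k.
      have : kappa * c <= kappa * P k by rewrite ler_pM2l.
      by rewrite /b; clear -e1_le deltaL etal e10; lra.
    apply: (@le_trans _ _ (C * cell a h k)); first by clear -ea0; lra.
    rewrite mulrC -mulrA ler_wpM2l // /C; apply: ler_pM => //.
      by rewrite mulr_ge0 // ltW.
    by rewrite ltW // divr_gt0 ?mulr_gt0.
  rewrite sub0r; case: ifP => [Sk|_]; last by rewrite oppr_le0.
  have ak := a_ge0 _ Sk; have [_ _ dP] := Sin _ Sk.
  have bk : - e1 <= b k.
    have : 0 <= kappa * P k by rewrite mulr_ge0 ?(ltW kappa0) //; clear -dP delta0; lra.
    by rewrite /b; clear -deltaL etal e10; lra.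
  rewrite ger0_norm //.
  have h1 : cell a h k * e k * - e1 <= cell a h k * e k * b k.
    by rewrite ler_wpM2l // mulr_ge0.
  have h2 : cell a h k * e k * e1 <= cell a h k * rho * e1.
    by rewrite ler_wpM2r ?(ltW e10) // ler_wpM2l.
  by clear -h1 h2; lra.
suff : 0 < \sum_(1 <= k < N.+1) (if S k then cell a h k * e k * b k else 0).
  by rewrite ltNge le0.
apply: (@lt_le_trans _ _ (\sum_(1 <= k < N.+1)
   ((if (c1 < k <= c2)%N then C * cell a h k else 0) - e1 * rho * `|cell a h k|))).
  rewrite sumrB -mulr_sumr.
  have -> : \sum_(1 <= k < N.+1) (if (c1 < k <= c2)%N then C * cell a h k else 0) =
     C * \sum_(c1.+1 <= k < c2.+1) cell a h k.
    rewrite mulr_sumr -big_mkcond /= [RHS](big_nat_widen _ _ N.+1) //=.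
    rewrite [RHS](big_nat_widenl _ 1) //=; apply: eq_bigl => k.
    by rewrite ltnS andbC.
  have h1 : C * A <= C * \sum_(c1.+1 <= k < c2.+1) cell a h k by rewrite ler_pM2l.
  have h2 : e1 * rho * \sum_(1 <= k < N.+1) `|cell a h k| <= e1 * rho * M.
    by rewrite ler_wpM2l // mulr_ge0 // ltW.
  have h3 := ler_wpM2l (ltW rho0) e1_le'.
  have h4 : 0 < theta * kappa * c * A by rewrite !mulr_gt0.
  have h5 : 0 < rho * (theta * kappa * c * A) by rewrite mulr_gt0.
  apply: (@lt_le_trans _ _ (C * A - e1 * rho * M)); last by clear -h1 h2; lra.
  by rewrite /C; clear -h3 h5; lra.
by rewrite big_nat [leRHS]big_nat; apply: ler_sum => k /lower.
Qed.

End nodal_interval.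

Section large_solutions.
Variable R : realType.
Local Notation mu := (leb R).

Lemma sum_cell (a : R -> R) (h T : R) N :
  mu.-integrable setT (EFin \o a) -> 0 <= h -> N%:R * h = T ->
  \sum_(1 <= k < N.+1) cell a h k = itg a 0 T.
Proof. by move=> inta h0 <-; rewrite /cell (itg_sum inta h0 (leq0n N)) mul0r. Qed.

Lemma sum_norm_cell (a : R -> R) (h T : R) N :
  mu.-integrable setT (EFin \o a) -> 0 <= h -> N%:R * h = T ->
  \sum_(1 <= k < N.+1) `|cell a h k| <= itg (fun t => `|a t|) 0 T.
Proof.
move=> inta h0 hT.
have intna : mu.-integrable setT (EFin \o (fun t => `|a t|)).
  exact: integrable_norm.
rewrite -(sum_cell intna h0 hT); apply: ler_sum => k _; exact: itg_norm.
Qed.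

(** By concavity [e] is at least [theta] times its maximum on the core and [theta2] times it at
    distance [eps] from the ends, hence above [s0] once the maximum reaches [s0 / theta2]. There
    [g (e k) >= L * e k] and the arch comparison applies; the forcing only helps, the cells inside
    having nonnegative weight. *)
Lemma no_large_solution_itv (a g : R -> R) (al be lam T L s0 : R) :
  mu.-integrable setT (EFin \o a) ->
  {ae mu, forall x, x \in `[al, be] -> 0 <= a x} ->
  0 <= al -> be <= T -> is_eigenvalue a al be lam -> lam < L ->
  (forall s, s0 <= s -> L * s <= g s) -> 0 < s0 ->
  exists r H : R, [/\ 0 < r, 0 < H, forall N (h t : R) (e : nat -> R) j,
    0 < h < H -> N%:R * h = T ->
    (forall k, (k <= N.+1)%N -> 0 <= e k) ->
    (forall k, (0 < k <= N)%N -> e k <= e j) -> (0 < j <= N)%N ->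
    al <= j%:R * h -> j.-1%:R * h <= be -> r <= e j -> 0 <= t ->
    (forall s, 0 <= s -> 0 <= g s) ->
    ~ (forall k, (0 < k <= N)%N ->
       d2 e k = h * (cell a h k * g (e k) + t * Num.max (cell a h k) 0)) &
  forall N (h : R), 0 < h < H -> N%:R * h = T ->
    exists2 k, (0 < k <= N)%N & 0 < cell a h k].
Proof.
move=> inta a0 al0 beT eig lamL gL s00.
have [phi [phi' [p [q [x1' [x1 [x2 [x2' [c]]]]]]]]] := eigenfunction_arch inta a0 eig.
move=> [[alp qbe phip phiq] [_ dphi cphi' ftc]].
move=> [/andP[px1' x1'x1] x12 /andP[x2x2' x2'q] c0 phic] [acore lam0].
have L0 : 0 < L := lt_trans lam0 lamL.
have ba0 : 0 < be - al by lra.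
pose ec := Num.min (x1' - al) (be - x2').
have ec0 : 0 < ec by rewrite lt_min !subr_gt0; apply/andP; split; lra.
have ecl : ec <= x1' - al by rewrite ge_min lexx.
have ecr : ec <= be - x2' by rewrite ge_min lexx orbT.
pose theta := ec / (4 * (be - al)).
have theta0 : 0 < theta by rewrite divr_gt0 ?mulr_gt0.
have M0 : 0 <= itg (fun t => `|a t|) 0 T by apply: Rintegral_ge0.
have [eps [H [eps0 H0 HH]]] := arch_contradiction inta a0 al0 beT alp qbe phip
  phiq dphi cphi' ftc px1' x1'x1 x12 x2x2' x2'q c0 phic acore lam0 lamL theta0 M0.
pose theta2 := eps / (4 * (be - al)).
have theta20 : 0 < theta2 by rewrite divr_gt0 ?mulr_gt0.
exists (s0 / theta2), (Num.min H (Num.min (be - al) (Num.min (ec / 2) (eps / 2)))).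
split; [exact: divr_gt0|by rewrite !lt_min H0 ba0 !divr_gt0| |]; last first.
  move=> N h /andP[h0]; rewrite lt_min => /andP[hH _] hT.
  have N0 : (0 < N)%N.
    by case: N hT => //; rewrite mul0r; move: (x12) => _ E; exfalso; lra.
  (* If no cell had positive weight, the constant 1 would satisfy the inequality excluded by the
     arch comparison. *)
  apply: contrapT => none; apply: (HH N h 1 (fun=> 1)) => //.
  - by rewrite h0.
  - exact: sum_norm_cell (ltW h0) hT.
  - by move=> k _; rewrite ler01 lexx.
  - by move=> k _ _; rewrite mulr1 ler_pdivrMr ?mulr_gt0 //; lra.
  - move=> k kN _; rewrite mulr1 (_ : d2 _ _ = 0); last by rewrite /d2; ring.
    rewrite pmulr_rle0 // pmulr_rle0 // leNgt; apply/negP => ck.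
    by apply: none; exists k.
move=> N h t e j /andP[h0]; rewrite !lt_min => /and4P[hH hba hec heps] hT.
move=> e0 emax jN alj jbe rj t0 g0 eqn.
have /andP[j0 _] := jN.
have ej0 : 0 < e j by rewrite (lt_le_trans _ rj) // divr_gt0.
have eN k : (0 < k <= N)%N -> 0 <= e k by move=> /andP[_ kN]; apply/e0/leqW.
have conc k : (0 < k <= N)%N -> al <= k.-1%:R * h -> k%:R * h <= be -> 0 <= d2 e k.
  move=> kN alk kbe; rewrite eqn // mulr_ge0 ?(ltW h0) //.
  have ck := cell_ge0 inta a0 alk kbe.
  by rewrite addr_ge0 // mulr_ge0 ?le_max ?ck // g0 // eN.
have beN : be <= N%:R * h by rewrite hT.
have hec' : 2 * h <= ec by clear -hec; lra.
have heps' : 2 * h <= eps by clear -heps; lra.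
apply: (HH N h (e j) e) => //.
- by case: (N) jN => //; case: (j) j0.
- by rewrite h0.
- exact: sum_norm_cell (ltW h0) hT.
- by move=> k kN; rewrite eN // emax.
- move=> k kN /andP[k1 k2].
  apply: (concave_lower_bound al0 beN h0 (ltW hba) hec' e0 jN alj jbe conc kN).
  by clear -k1 k2 ecl ecr; apply/andP; split; lra.
- move=> k kN kP.
  have := concave_lower_bound al0 beN h0 (ltW hba) heps' e0 jN alj jbe conc kN kP.
  rewrite -/theta2 => ek.
  have sk : s0 <= e k.
    apply: le_trans ek; rewrite mulrC -ler_pdivrMr //.
  have ck : 0 <= cell a h k.
    apply: (cell_ge0 inta a0); move: kP => /andP[k1 k2].
      have kE : k%:R * h = k.-1%:R * h + h.
        have /andP[kp _] := kN.
        by rewrite -[in LHS](prednK kp) -natr1 mulrDl mul1r.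
      by clear -kE k1 heps' eps0 h0; lra.
    by clear -k2 eps0; lra.
  rewrite eqn // ler_pM2l // -mulrA mulrCA.
  apply: (@le_trans _ _ (cell a h k * g (e k))); first by rewrite ler_wpM2l // gL.
  by rewrite lerDl mulr_ge0 // le_max lexx orbT.
Qed.

Lemma exists_max_node (e : nat -> R) N : (0 < N)%N ->
  exists2 j, (0 < j <= N)%N & forall k, (0 < k <= N)%N -> e k <= e j.
Proof.
elim: N => // N IH _; have [->|] := posnP N.
  by exists 1%N => // k; case: k => [|[|]].
move=> /IH[j /andP[j0 jN] jmax].
have [h|h] := leP (e j) (e N.+1).
- exists N.+1; rewrite ?leqnn // => k /andP[k0].
  rewrite leq_eqVlt => /predU1P[->//|]; rewrite ltnS => kN.
  by apply: le_trans h; apply: jmax; rewrite k0.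
- exists j; first by rewrite j0 leqW.
  move=> k /andP[k0]; rewrite leq_eqVlt => /predU1P[->|]; first exact: ltW.
  by rewrite ltnS => kN; apply: jmax; rewrite k0.
Qed.

(** Discrete strong maximum principle: at a maximal node [d2 e] is nonnegative, while [a j <= 0]
    makes the right-hand side nonpositive; hence [a j = 0] and both neighbours are maximal. Spread
    over all nodes, this contradicts the negative sum. *)
Lemma max_node_positive (b : boundary_type) (a : nat -> R) (g : R -> R)
    (h t rho : R) N (e : nat -> R) :
  (0 < N)%N -> 0 < h -> 0 < rho -> 0 <= t -> 0 < g rho -> discrete_bc b N e ->
  (forall k, (0 < k <= N)%N -> e k <= rho) ->
  (exists2 j, (0 < j <= N)%N & e j = rho) ->
  (forall k, (0 < k <= N)%N ->
     d2 e k = h * (a k * g (e k) + t * Num.max (a k) 0)) ->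
  \sum_(1 <= k < N.+1) a k < 0 ->
  exists2 j, (0 < j <= N)%N & e j = rho /\ 0 < a j.
Proof.
move=> N0 h0 rho0 t0 g0 bc emax [j0 j0N ej0] eqn suma.
apply: contrapT => none.
have a_le j : (0 < j <= N)%N -> e j = rho -> a j <= 0.
  by move=> jN ej; rewrite leNgt; apply/negP => aj; apply: none; exists j.
have emax' k : (k <= N.+1)%N -> e k <= rho.
  case: k => [_|k]; first by case: b bc => -[-> _]; apply: emax; rewrite ?leqnn ?N0.
  rewrite leq_eqVlt => /predU1P[[->]|kN]; last by apply: emax.
  by case: b bc => -[_ ->]; apply: emax; rewrite ?leqnn ?N0.
have step j : (0 < j <= N)%N -> e j = rho ->
    [/\ e j.-1 = rho, e j.+1 = rho & a j = 0].
  move=> jN ej; have aj := a_le _ jN ej; have /andP[jp jN'] := jN.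
  have := eqn _ jN; rewrite max_r // mulr0 addr0 ej => E.
  have h1 : e j.-1 <= rho by apply: emax'; rewrite (leq_trans (leq_pred _)) // leqW.
  have h2 : e j.+1 <= rho by apply: emax'.
  have E' : 0 <= a j * g rho.
    rewrite -(pmulr_rge0 _ h0) -E /d2 ej; lra.
  have aj0 : a j = 0.
    by apply/eqP; rewrite eq_le aj -(pmulr_lge0 _ g0).
  by move: E; rewrite aj0 mul0r mulr0 /d2 ej => E; split=> //; lra.
have up d : (j0 + d <= N)%N -> e (j0 + d)%N = rho.
  elim: d => [|d IH]; first by rewrite addn0.
  rewrite addnS => jd; have /andP[jp _] := j0N.
  have jdN : (0 < j0 + d <= N)%N by rewrite addn_gt0 jp (ltnW jd).
  by have [] := step _ jdN (IH (ltnW jd)).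
have down d : (d < j0)%N -> e (j0 - d)%N = rho.
  elim: d => [|d IH]; first by rewrite subn0.
  move=> jd; rewrite subnS; have /andP[_ jn] := j0N.
  have jdN : (0 < j0 - d <= N)%N.
    by rewrite subn_gt0 (ltnW jd) (leq_trans (leq_subr _ _)).
  by have [] := step _ jdN (IH (ltnW jd)).
have all_a k : (0 < k <= N)%N -> a k = 0.
  move=> kN; have /andP[kp kN'] := kN.
  suff /(step _ kN)[] : e k = rho by [].
  have [jk|kj] := leqP j0 k; first by rewrite -(subnKC jk) up // subnKC.
  by rewrite -(subKn (ltnW kj)) down // -subn_gt0 subKn // ltnW.
by move: suma; rewrite big_nat big1 ?ltxx // => k /all_a.
Qed.

(** The maximum is attained at a cell of positive weight. Such a cell meets some [[al i, be i]],
    since otherwise [a <= 0] almost everywhere on it, and the bound for that interval applies. *)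
Lemma no_large_solution (a g : R -> R) m (al be lam : 'I_m -> R) (T L s0 : R) :
  (0 < m)%N -> 0 < T -> mu.-integrable setT (EFin \o a) ->
  (forall i, {ae mu, forall x, x \in `[al i, be i] -> 0 <= a x}) ->
  (forall i, 0 <= al i /\ be i <= T) ->
  {ae mu, forall x, x \in `[0, T] -> (forall i, x \notin `[al i, be i]) -> a x <= 0} ->
  itg a 0 T < 0 ->
  (forall i, is_eigenvalue a (al i) (be i) (lam i)) -> (forall i, lam i < L) ->
  (forall s, s0 <= s -> L * s <= g s) -> 0 < s0 ->
  (forall s, 0 < s -> 0 < g s) -> g 0 = 0 ->
  exists (r : R) N0, [/\ 0 < r, (0 < N0)%N, forall b N (h t : R) (e : nat -> R),
    (N0 <= N)%N -> N%:R * h = T -> discrete_bc b N e ->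
    (forall k, (0 < k <= N)%N -> 0 <= e k) -> 0 <= t ->
    (forall k, (0 < k <= N)%N ->
       d2 e k = h * (cell a h k * g (e k) + t * Num.max (cell a h k) 0)) ->
    forall k, (0 < k <= N)%N -> e k < r &
  forall N (h : R), (N0 <= N)%N -> N%:R * h = T ->
    exists2 k, (0 < k <= N)%N & 0 < cell a h k].
Proof.
move=> m0 T0 inta a0 albe aneg aT eig lamL gL s00 gpos g00.
have /choice[rH rHP] : forall i, exists rH : R * R, [/\ 0 < rH.1, 0 < rH.2,
  forall N (h t : R) (e : nat -> R) j,
    0 < h < rH.2 -> N%:R * h = T ->
    (forall k, (k <= N.+1)%N -> 0 <= e k) ->
    (forall k, (0 < k <= N)%N -> e k <= e j) -> (0 < j <= N)%N ->
    al i <= j%:R * h -> j.-1%:R * h <= be i -> rH.1 <= e j -> 0 <= t ->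
    (forall s, 0 <= s -> 0 <= g s) ->
    ~ (forall k, (0 < k <= N)%N ->
       d2 e k = h * (cell a h k * g (e k) + t * Num.max (cell a h k) 0)) &
  forall N (h : R), 0 < h < rH.2 -> N%:R * h = T ->
    exists2 k, (0 < k <= N)%N & 0 < cell a h k].
  move=> i; have [al0 beT] := albe i.
  have [r [H rH]] := no_large_solution_itv inta (a0 i) al0 beT (eig i) (lamL i) gL s00.
  by exists (r, H).
(* Sums of the finitely many radii, and in [K] of the reciprocals of the mesh bounds, serve as
   common bounds. *)
pose r := 1 + \sum_i (rH i).1.
have r_ge i : (rH i).1 <= r.
  rewrite /r (bigD1 i) //= addrCA lerDl addr_ge0 // sumr_ge0 // => k _.
  by have [/ltW] := rHP k.
have r0 : 0 < r.
  by rewrite ltr_pwDl // sumr_ge0 // => k _; have [/ltW] := rHP k.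
pose K := 1 + \sum_i ((rH i).2)^-1.
have K0 : 0 < K.
  by rewrite ltr_pwDl // sumr_ge0 // => k _; have [_ /ltW] := rHP k; rewrite invr_ge0.
have K_ge i : ((rH i).2)^-1 < K.
  rewrite /K (bigD1 i) //= addrCA ltrDl ltr_pwDl // sumr_ge0 // => k _.
  by have [_ /ltW] := rHP k; rewrite invr_ge0.
have g0 s : 0 <= s -> 0 <= g s.
  by rewrite le_eqVlt => /predU1P[<-|/gpos/ltW]; rewrite ?g00.
have mesh N h : ((Num.truncn (T * K)).+1 <= N)%N -> N%:R * h = T ->
    0 < h /\ forall i, h < (rH i).2.
  move=> N0N hT; have N0' : 0 < N%:R :> R by rewrite ltr0n (leq_trans _ N0N).
  have h0 : 0 < h by rewrite -(pmulr_rgt0 _ N0') hT.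
  have hK : h * K < 1.
    have : T * K < N%:R by apply: lt_le_trans (truncnS_gt _) _; rewrite ler_nat.
    by rewrite -hT -mulrA -[ltRHS]mulr1 ltr_pM2l.
  split=> // i; have [_ H0 _ _] := rHP i.
  rewrite -[ltRHS]invrK -(ltr_pM2r (x := ((rH i).2)^-1)) ?invr_gt0 //.
  rewrite mulVf ?gt_eqF ?invr_gt0 //; apply: lt_trans hK.
  by rewrite ltr_pM2l.
exists r, (Num.truncn (T * K)).+1; split=> //; last first.
  move=> N h N0N hT; have [h0 hH] := mesh _ _ N0N hT.
  have [_ _ _ H] := rHP (Ordinal m0); apply: H hT; by rewrite h0 hH.
move=> b N h t e N0N hT bc e0 t0 eqn.
have N0 : (0 < N)%N by apply: leq_trans N0N.
have [h0 hH] := mesh _ _ N0N hT.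
have e0' k : (k <= N.+1)%N -> 0 <= e k.
  case: k => [_|k]; first by case: b bc => -[-> _]; apply: e0; rewrite ?leqnn ?N0.
  rewrite leq_eqVlt => /predU1P[[->]|kN]; last by apply: e0.
  by case: b bc => -[_ ->]; apply: e0; rewrite ?leqnn ?N0.
have [j jN jmax] := exists_max_node e N0.
suff ejr : e j < r by move=> k kN; exact: le_lt_trans (jmax k kN) ejr.
rewrite ltNge; apply/negP => rj.
have ej0 : 0 < e j := lt_le_trans r0 rj.
have sum0 : \sum_(1 <= k < N.+1) cell a h k < 0 by rewrite (sum_cell inta (ltW h0) hT).
have [//|j' j'N [ej' aj']] := max_node_positive N0 h0 ej0 t0
  (gpos _ ej0) bc jmax _ eqn sum0.
  by exists j.
have [i [ji ij]] : exists i, al i <= j'%:R * h /\ j'.-1%:R * h <= be i.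
  apply: contrapT => none; move: aj'; apply/negP; rewrite -leNgt.
  rewrite -[leRHS](_ : itg (fun=> 0) (j'.-1%:R * h) (j'%:R * h) = 0); last first.
    by rewrite /itg Rintegral_cst // mul0r.
  have int0 : mu.-integrable setT (EFin \o (fun _ : R => 0 : R)) by exact: integrable0.
  apply: le_itg => //; apply: aeS aneg => x Hx.
  rewrite in_itv /= => /andP[x1 x2]; apply: Hx.
    rewrite in_itv /= (le_trans _ (ltW x1)) ?mulr_ge0 ?(ltW h0) //=.
    apply: le_trans x2 _; rewrite -hT ler_pM2r // ler_nat.
    by case/andP: j'N.
  move=> i; apply/negP; rewrite in_itv /= => /andP[x3 x4]; apply: none.
  by exists i; split; [exact: le_trans x2|exact: le_trans (ltW x1) x4].
have [_ _ HH _] := rHP i.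
apply: (HH N h t e j') => //.
- by rewrite h0 hH.
- by rewrite ej'.
- by rewrite ej' (le_trans (r_ge i)).
Qed.

End large_solutions.

(** * Existence for the discrete problem *)

Definition node (b : boundary_type) (n k : nat) : 'I_n.+1 :=
  if k is k'.+1 then
    if (k' <= n)%N then inord k'
    else match b with Neumann => ord_max | Periodic => ord0 end
  else match b with Neumann => ord0 | Periodic => ord_max end.

(** Ghosts repeat an actual entry, so every vector satisfies the boundary condition by construction,
    and bounds on the entries hold at all [k]. *)
Definition extend (R : realType) (b : boundary_type) n (x : 'rV[R]_n.+1)
  (k : nat) : R := x ord0 (node b n k).

Section discrete_existence.
Variable R : realType.

Lemma node_ord (b : boundary_type) n (j : 'I_n.+1) : node b n j.+1 = j.
Proof. by rewrite /node -ltnS ltn_ord inord_val. Qed.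

Lemma node_inord n k : (0 < k <= n.+1)%N -> exists j : 'I_n.+1, k = j.+1.
Proof. by case: k => // k kn; exists (Ordinal (kn : (k < n.+1)%N)). Qed.

Lemma extend_bc (b : boundary_type) n (x : 'rV[R]_n.+1) : discrete_bc b n.+1
  (extend b x).
Proof.
have E0 : node b n 1 = ord0 by apply/val_inj; rewrite (node_ord b ord0).
have En : node b n n.+1 = ord_max by rewrite (node_ord b ord_max).
have EN : node b n n.+2 = if b is Neumann then ord_max else ord0.
  by rewrite /node ltnn; case: (b).
by move: E0 En EN; rewrite /extend; case: b => E0 En EN; split; rewrite ?EN ?En ?E0.
Qed.

Lemma sum_nodes (f : nat -> R) n :
  \sum_(1 <= k < n.+2) f k = \sum_(j < n.+1) f j.+1.
Proof. by rewrite big_add1 /= big_mkord. Qed.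

(* Explicit Euler step for [x' = - d2 x + h (a g(x) + tau a^+)], where [tau] is
   switched on beyond the a priori bound [r']: it keeps the cone invariant, and
   expands it at radius [r' + 1]. *)
Lemma discrete_solution (b : boundary_type) n (g : R -> R) (a : nat -> R)
  (h r r' K : R) :
  {within `[0, +oo[, continuous g} -> (forall s, 0 <= s -> 0 <= g s) ->
  0 < h -> 0 < r -> r < r' -> 0 <= K ->
  (forall s, 0 <= s <= r' + 1 -> g s <= K * s) ->
  (exists2 k, (0 < k <= n.+1)%N & 0 < a k) ->
  (forall kappa e, discrete_bc b n.+1 e ->
     (forall k, (0 < k <= n.+1)%N -> 0 <= e k <= r) ->
     (exists2 k, (0 < k <= n.+1)%N & e k = r) -> 0 <= kappa ->
     ~ (forall k, (0 < k <= n.+1)%N -> d2 e k + kappa * e k = h * (a k * g (e k)))) ->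
  (forall t e, discrete_bc b n.+1 e ->
     (forall k, (0 < k <= n.+1)%N -> 0 <= e k) -> 0 <= t ->
     (forall k, (0 < k <= n.+1)%N ->
        d2 e k = h * (a k * g (e k) + t * Num.max (a k) 0)) ->
     forall k, (0 < k <= n.+1)%N -> e k < r') ->
  exists e, [/\ discrete_bc b n.+1 e,
    forall k, 0 <= e k <= r',
    exists2 k, (0 < k <= n.+1)%N & r <= e k &
    forall k, (0 < k <= n.+1)%N -> d2 e k = h * (a k * g (e k))].
Proof.
move=> gc g0 h0 r0 rr' K0 gK [ka kaN aka] small large.
pose s := r' + 1; have s0 : 0 < s by rewrite /s; lra.
pose A := \sum_(1 <= k < n.+2) `|a k|.
have A0 : 0 <= A by apply: sumr_ge0.
have aA (j : 'I_n.+1) : `|a j.+1| <= A.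
  by rewrite /A sum_nodes (bigD1 j) //= lerDl sumr_ge0.
pose Ap := \sum_(1 <= k < n.+2) Num.max (a k) 0.
have maxa0 k : 0 <= Num.max (a k) 0 by rewrite le_max lexx orbT.
have Ap0 : 0 < Ap.
  have [j kj] := @node_inord n _ kaN.
  rewrite /Ap sum_nodes (bigD1 j) //= ltr_pwDl ?sumr_ge0 //.
  by rewrite -kj lt_max aka.
(* At radius [s] one has [tau = B], so the forcing contributes [K * s * A + 1], one more than the
   negative part of the other terms can take away. *)
pose B := (K * s * A + 1) / Ap.
have B0 : 0 < B by rewrite divr_gt0 // ltr_wpDl // !mulr_ge0 // ltW.
have BAp : B * Ap = K * s * A + 1 by rewrite divfK // gt_eqF.
pose tau (x : R) := B * Num.max 0 (x - r').
have tau0 x : 0 <= tau x by rewrite mulr_ge0 ?(ltW B0) // le_max lexx.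
(* Truncation to [[0, s]], where [g] is continuous and at most [K] times its argument; it makes the
   step continuous on the whole space. *)
pose tr (x : R) := Num.min (Num.max x 0) s.
have trB x : 0 <= tr x <= s.
  by rewrite le_min ge_min lexx le_max lexx !orbT ltW.
have tr_id x : 0 <= x <= s -> tr x = x.
  by move=> /andP[x0 xs]; rewrite /tr max_l // min_l.
have tr_le x : 0 <= x -> tr x <= x.
  by move=> x0; rewrite /tr max_l // ge_min lexx.
(* At most half of an entry pays for the diagonal of [d2] and a quarter for the negative part of
   [a * g]. Hence [F x >= x / 4] entrywise: the cone is kept, and in it [F] vanishes only at 0. *)
pose eps := (4 * (1 + h * (K * A)))^-1.
have hKA : 0 <= h * (K * A) by rewrite !mulr_ge0 // ltW.
have eps0 : 0 < eps by rewrite invr_gt0 mulr_gt0 // ltr_pwDl.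
have epsE : eps * (4 * (1 + h * (K * A))) = 1.
  by rewrite mulVf // gt_eqF // mulr_gt0 // ltr_pwDl.
pose V (x : 'rV[R]_n.+1) (k : nat) := - d2 (extend b x) k +
  h * (a k * g (tr (extend b x k)) + tau `|x| * Num.max (a k) 0).
pose F (x : 'rV[R]_n.+1) : 'rV[R]_n.+1 := \row_j (x ord0 j + eps * V x j.+1).
have extE (x : 'rV[R]_n.+1) (j : 'I_n.+1) : extend b x j.+1 = x ord0 j.
  by rewrite /extend node_ord.
have ext0 (x : 'rV[R]_n.+1) k : (forall i, 0 <= x ord0 i) -> 0 <= extend b x k.
  by move=> x0; exact: x0.
have ext_le (x : 'rV[R]_n.+1) k : (forall i, 0 <= x ord0 i) -> extend b x k <= `|x|.
  by move=> x0; apply: le_trans (ler_norm _) (le_coord_norm _ _).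
have F_ge (x : 'rV[R]_n.+1) j : (forall i, 0 <= x ord0 i) -> x ord0 j / 4 <= F x ord0 j.
  move=> x0; rewrite mxE /V /d2 extE /=.
  have h1 := ext0 x j x0; have h2 := ext0 x j.+2 x0.
  have trx := trB (x ord0 j).
  have h3 : - (A * (K * x ord0 j)) <= a j.+1 * g (tr (x ord0 j)).
    rewrite lerNl -mulNr; apply: le_trans (ler_norm _) _.
    have /andP[t0 _] := trx.
    rewrite normrM normrN (ger0_norm (g0 _ t0)); apply: ler_pM => //; first exact: g0.
    by apply: le_trans (gK _ trx) _; rewrite ler_wpM2l // tr_le.
  have h4 : 0 <= tau `|x| * Num.max (a j.+1) 0 by rewrite mulr_ge0.
  have h5 : 2 * eps <= 2^-1 :> R.
    have : 0 <= eps * (h * (K * A)) by rewrite mulr_ge0 // ltW.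
    by clear -epsE; lra.
  have h6 : 0 <= eps * h by rewrite mulr_ge0 // ltW.
  have h7 : 0 <= eps * extend b x j by rewrite mulr_ge0 // ltW.
  have h8 : 0 <= eps * extend b x j.+2 by rewrite mulr_ge0 // ltW.
  have h9 := ler_wpM2l h6 h3; have h10 := mulr_ge0 h6 h4.
  have h11 : x ord0 j * (eps * (4 * (1 + h * (K * A)))) = x ord0 j.
    by rewrite epsE mulr1.
  have xj := x0 j; have h12 := ler_wpM2l xj h5.
  have h13 : 0 <= x ord0 j * eps by rewrite mulr_ge0 // ltW.
  by clear -h7 h8 h9 h10 h11 h12 h13 xj; lra.
have Fpos (x : 'rV[R]_n.+1) : (forall i, 0 <= x ord0 i) -> forall i, 0 <= F x ord0 i.
  by move=> x0 i; apply: le_trans (F_ge x i x0); rewrite divr_ge0.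
have sumF (x : 'rV[R]_n.+1) :
    \sum_j F x ord0 j = \sum_j x ord0 j + eps * \sum_(j < n.+1) V x j.+1.
  under eq_bigr do rewrite mxE.
  by rewrite big_split /= mulr_sumr.
have VE (x : 'rV[R]_n.+1) (mu : R) : F x = mu *: x ->
    forall k, (0 < k <= n.+1)%N -> eps * V x k = (mu - 1) * extend b x k.
  move=> /rowP FE k /(@node_inord n _)[j ->]; have := FE j; rewrite !mxE extE.
  by clear; lra.
have gtr_c (x0 : R) : {for x0, continuous (fun x => g (tr x))}.
  apply/cvgrPdist_lt => e e0.
  have [|eta eta0 He] := (within_continuousP _ _).1 gc (tr x0) _ _ e0.
    by rewrite /= in_itv /= andbT; have /andP[] := trB x0.
  have trc : tr x @[x --> x0] --> tr x0.
    by apply: cvg_min; [apply: cvg_max|]; [exact: cvg_id|exact: cvg_cst|exact: cvg_cst].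
  have /cvgrPdist_lt/(_ _ eta0) := trc.
  apply: filterS => x; rewrite distrC => xx0; rewrite distrC; apply: He => //.
  by rewrite /= in_itv /= andbT; have /andP[] := trB x.
have Fc : continuous F.
  move=> x0; suff H (G : set_system 'rV[R]_n.+1) : Filter G ->
      (forall i, v ord0 i @[v --> G] --> x0 ord0 i) -> `|v| @[v --> G] --> `|x0| ->
      F v @[v --> G] --> F x0.
    by apply: (H (nbhs x0)) => [i|]; [exact: coord_continuous|exact: norm_continuous].
  move=> FG ci cn; apply: cvg_rowP => j; rewrite mxE.
  rewrite [X in X @ _ --> _](_ : _ = fun x : 'rV[R]_n.+1 =>
    x ord0 j + eps * V x j.+1); last by apply/funext => v; rewrite mxE.
  have ce k : extend b v k @[v --> G] --> extend b x0 k by exact: ci.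
  apply: cvgD; first exact: ci.
  apply: cvgM; first exact: cvg_cst.
  apply: cvgD.
    apply: cvgN; apply: cvgB; last exact: ce.
    by apply: cvgB; last exact: ce; apply: cvgM; [exact: cvg_cst|exact: ce].
  apply: cvgM; first exact: cvg_cst.
  apply: cvgD.
    apply: cvgM; first exact: cvg_cst.
    exact: cvg_comp (ce j.+1) (gtr_c _).
  apply: cvgM; last exact: cvg_cst.
  apply: cvgM; first exact: cvg_cst.
  apply: cvg_max; first exact: cvg_cst.
  by apply: cvgB => //; exact: cvg_cst.
have rs : r < s by rewrite /s; lra.
have [|||x [x0 /andP[xr xs] Fx]] := @cone_fixed_point R n F r s r0 rs Fc Fpos.
- move=> x x0 /andP[rx _]; apply/eqP => Fx0.
  have [j xj] := norm_coord x.
  have := F_ge x j x0; rewrite Fx0 mxE.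
  by rewrite -(ger0_norm (x0 j)) -xj; clear -rx r0; lra.
(* At radius [r] both the truncation and [tau] are inactive, and [small] applies with
   [kappa = (mu - 1) / eps]. *)
- move=> x mu x0 xr Fx; rewrite ltNge; apply/negP => mu1.
  apply: (small ((mu - 1) / eps) (extend b x)).
  + exact: extend_bc.
  + by move=> k _; rewrite ext0 // -xr ext_le.
  + have [j xj] := norm_coord x; exists j.+1; first by rewrite ltn_ord.
    by rewrite extE -xr xj ger0_norm.
  + by rewrite divr_ge0 ?subr_ge0 // ltW.
  + move=> k kn; have := VE _ _ Fx k kn.
    have kr : extend b x k <= r by rewrite -xr ext_le.
    rewrite /V tr_id ?ext0 //=; last by rewrite (le_trans kr) ?(ltW rs).
    rewrite /tau xr max_l ?subr_le0 ?(ltW rr') // mulr0 mul0r addr0 => E.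
    by rewrite mulrAC -E mulrAC divff ?gt_eqF // mul1r addrA subrr add0r.
- move=> x mu x0 xs Fx.
  have trx k : tr (extend b x k) = extend b x k.
    by rewrite tr_id // ext0 //= -xs ext_le.
  (* [d2] sums to zero, so the total of the entries changes by the forcing and the nonlinear term
     only; the choice of [B] makes it grow. *)
  have sumV : 0 < \sum_(j < n.+1) V x j.+1.
    rewrite -(sum_nodes (V x)) big_split /= sumrN (sum_d2 (extend_bc b x)) oppr0 add0r.
    rewrite -mulr_sumr pmulr_rgt0 // big_split /= -mulr_sumr.
    rewrite xs /tau /s addrAC subrr add0r max_r ?ler01 // mulr1 BAp.
    suff : - (K * s * A) <= \sum_(1 <= k < n.+2) a k * g (tr (extend b x k)).
      by clear; lra.
    rewrite /A mulr_sumr -sumrN; apply: ler_sum => k _.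
    rewrite lerNl -mulNr; apply: le_trans (ler_norm _) _.
    have /andP[t0 ts] := trB (extend b x k).
    rewrite normrM normrN (ger0_norm (g0 _ t0)) mulrC ler_wpM2r //.
    by apply: le_trans (gK _ (trB _)) _; rewrite ler_wpM2l.
  have xs0 : 0 < \sum_j x ord0 j.
    have [j xj] := norm_coord x; rewrite (bigD1 j) //= ltr_pwDl ?sumr_ge0 //.
    by rewrite -(ger0_norm (x0 j)) -xj xs.
  rewrite -(ltr_pM2r xs0) mul1r.
  have := sumF x; rewrite Fx; under eq_bigr do rewrite mxE.
  rewrite -mulr_sumr => ->; by rewrite ltrDl mulr_gt0.
have x0' k : 0 <= extend b x k <= s by rewrite ext0 //= (le_trans (ext_le _ _ x0)).
have eqn k : (0 < k <= n.+1)%N -> d2 (extend b x) k =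
    h * (a k * g (extend b x k) + tau `|x| * Num.max (a k) 0).
  have Fx1 : F x = 1 *: x by rewrite Fx scale1r.
  move=> /(VE _ _ Fx1); rewrite subrr mul0r => /eqP.
  rewrite mulf_eq0 gt_eqF //= /V tr_id // addrC subr_eq0 => /eqP -> //.
(* A fixed point solves the problem with a constant forcing factor, so its norm is below [r'], where
   [tau] vanishes. *)
have lt := large _ _ (extend_bc b x) (fun k _ => ext0 _ _ x0) (tau0 _) eqn.
have [j xj] := norm_coord x; rewrite ger0_norm // in xj.
have xr' : `|x| < r' by rewrite xj -extE; apply: lt; rewrite ltn_ord.
exists (extend b x); split.
- exact: extend_bc.
- by move=> k; rewrite ext0 //= (le_trans (ext_le _ _ x0)) // ltW.
- by exists j.+1; [rewrite ltn_ord|rewrite extE -xj].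
- move=> k kn; rewrite eqn // /tau max_l ?subr_le0 ?(ltW xr') //.
  by rewrite mulr0 mul0r addr0.
Qed.
End discrete_existence.

(** * Passage to the limit *)

Section compactness.
Variable R : realType.

(** A cluster point in a product of segments is not the limit of a subsequence, but arbitrarily late
    terms are close to it at any finite set of points, and this is all that is used. *)
Lemma cluster_pointwise (U : nat -> R -> R) (B : R) :
  (forall n x, `|U n x| <= B) ->
  exists u : R -> R, forall (s : seq R) (zeta : R) n0, 0 < zeta ->
    exists2 n, (n0 <= n)%N & forall x, x \in s -> `|U n x - u x| < zeta.
Proof.
move=> UB.
have cpt := @tychonoff R (fun=> R) (fun=> `[- B, B]%classic)
  (fun=> @segment_compact R _ _).
have [|u [_ ucl]] := cpt ((U : nat -> prod_topology (fun _ : R => R)) @ \oo) _.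
  by exists 0%N => // n _ x; rewrite /= in_itv /= -ler_norml.
exists u => s zeta n0 zeta0.
have Un0 : (U @ \oo) [set f | exists2 n, (n0 <= n)%N & f = U n].
  by exists n0 => // n nn; exists n.
have us : nbhs (u : prod_topology (fun _ : R => R))
    [set f | forall x, x \in s -> `|f x - u x| < zeta].
  have FF : Filter (nbhs (u : prod_topology (fun _ : R => R))) := nbhs_filter _.
  elim: s => [|x s IH]; first exact: (@filterS _ _ FF _ _ _ (@filterT _ _ FF)).
  have ux : nbhs (u : prod_topology (fun _ : R => R)) [set f | `|f x - u x| < zeta].
    have ball_ux : nbhs (u x) [set y | `|y - u x| < zeta].
      by apply/nbhs_ballP; exists zeta => // y; rewrite -ball_normE /= distrC.
    exact: (@proj_continuous R (fun=> R) x u _ ball_ux).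
  apply: (@filterS _ _ FF _ _ _ (@filterI _ _ FF _ _ ux IH)) => f [fx fs] y.
  by rewrite inE => /predU1P[->|/fs].
have [_ [[n nn ->] H]] := ucl _ _ Un0 us.
by exists n.
Qed.

Lemma cluster_uniform (U : nat -> R -> R) (B C T : R) : 0 < T -> 0 <= C ->
  (forall n x, `|U n x| <= B) ->
  (forall n x y, 0 <= x <= T -> 0 <= y <= T ->
     `|U n y - U n x| <= C * (`|y - x| + T / n.+1%:R)) ->
  exists u : R -> R, forall (zeta : R) n0, 0 < zeta ->
    exists2 n, (n0 <= n)%N & `|U n (- 1) - u (- 1)| <= zeta /\
      forall x, 0 <= x <= T -> `|U n x - u x| <= zeta.
Proof.
move=> T0 C0 UB Ulip; have [u uP] := cluster_pointwise UB.
have mesh d : 0 < d -> exists n0, forall n, (n0 <= n)%N -> T / n.+1%:R <= d.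
  move=> d0; exists (Num.truncn (T / d)) => n dn.
  rewrite ler_pdivrMr ?ltr0n // mulrC -ler_pdivrMr //.
  by apply/ltW/(lt_le_trans (truncnS_gt _)); rewrite ler_nat.
have ulip x y : 0 <= x <= T -> 0 <= y <= T -> `|u y - u x| <= C * `|y - x|.
  move=> xT yT; apply/ler_addgt0Pr => d d0.
  pose d' := d / (C + 2); have d'0 : 0 < d' by rewrite divr_gt0 // ltr_wpDl.
  have d'E : d' * (C + 2) = d by rewrite divfK // gt_eqF // ltr_wpDl.
  clearbody d'; have [n1 n1P] := mesh _ d'0.
  have [n nn H] := uP [:: x; y] d' n1 d'0.
  have := H x; rewrite inE eqxx => /(_ isT) Hx.
  have := H y; rewrite !inE eqxx orbT => /(_ isT) Hy.
  have := ler_wpM2l C0 (n1P _ nn).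
  have := Ulip n _ _ xT yT.
  rewrite (_ : u y - u x = (U n y - U n x) - (U n y - u y) + (U n x - u x));
    last by ring.
  move=> h1 h2.
  have h4 := ler_normD (U n y - U n x - (U n y - u y)) (U n x - u x).
  have h5 := ler_normB (U n y - U n x) (U n y - u y).
  by move: (T / _) h1 h2 => q h1 h2; clear -h1 h2 d'E h4 h5 Hx Hy; lra.
exists u => zeta n0 zeta0.
(* From the grid point to the left of [x]: [2 * C * d] for [U n], mesh included, [C * d] for [u],
   and [d] at the grid point itself. *)
pose d := zeta / (3 * C + 1);
  have d0 : 0 < d by rewrite divr_gt0 // ltr_wpDl // mulr_ge0.
have dE : d * (3 * C + 1) = zeta by rewrite divfK // gt_eqF // ltr_wpDl // mulr_ge0.
clearbody d; have [n1 n1P] := mesh _ d0.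
pose pts := - 1 :: [seq i%:R * (T / n1.+1%:R) | i <- iota 0 n1.+2].
have [n nn H] := uP pts d (maxn n0 n1) d0.
move: nn; rewrite geq_max => /andP[nn0 nn1]; exists n => //.
have dz : d <= zeta by rewrite -dE mulrDr mulr1 lerDr !mulr_ge0 // ltW.
split; first by apply: le_trans dz; apply/ltW/H; rewrite inE eqxx.
move=> x /andP[x0 xT].
have h0 : 0 < T / n1.+1%:R by rewrite divr_gt0.
pose i := Num.truncn (x / (T / n1.+1%:R)).
have ix : i%:R * (T / n1.+1%:R) <= x.
  by rewrite -ler_pdivlMr // truncn_le divr_ge0 // ltW.
have xi : x < i%:R * (T / n1.+1%:R) + T / n1.+1%:R.
  by rewrite -{2}[T / n1.+1%:R]mul1r -mulrDl natr1 -ltr_pdivrMr // truncnS_gt.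
have iN : (i < n1.+2)%N.
  rewrite ltnS -(ler_nat R) -(ler_pM2r h0) [leRHS]mulrC divfK //.
  exact: le_trans ix xT.
set s := i%:R * _ in ix xi.
have sT : 0 <= s <= T by rewrite mulr_ge0 ?(ltW h0) //= (le_trans ix).
have xT' : 0 <= x <= T by rewrite x0.
have Hs : `|U n s - u s| < d.
  apply: H; rewrite inE; apply/orP; right; apply/mapP; exists i => //.
  by rewrite mem_iota.
have h1 := Ulip n s x sT xT'; have h2 := ulip s x sT xT'.
have xs : `|x - s| <= d.
  rewrite ger0_norm ?subr_ge0 //; have := n1P n1 (leqnn _).
  by move: (T / _) xi => q xi; clear -xi; lra.
have h3 := ler_wpM2l C0 xs; have h4 := ler_wpM2l C0 (n1P _ nn1).
rewrite (_ : U n x - u x = (U n x - U n s) + (U n s - u s) - (u x - u s)); last by ring.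
have h5 := ler_normB ((U n x - U n s) + (U n s - u s)) (u x - u s).
have h6 := ler_normD (U n x - U n s) (U n s - u s).
by move: (T / n.+1%:R) h1 h4 => q' h1 h4; clear -h1 h2 h3 h4 h5 h6 Hs dE; lra.
Qed.
End compactness.

(** On [[0, T]] the cap [n.+1] acts at [x = T] only, where the truncation would point past the last
    cell. At an interior node the cell to its right is chosen. *)
Definition cell_index (R : realType) (T : R) (n : nat) (x : R) : nat :=
  minn (Num.truncn (x / (T / n.+1%:R))).+1 n.+1.

Section limit.
Variable R : realType.
Local Notation mu := (leb R).

Lemma aeT (P : R -> Prop) : (forall x, P x) -> {ae mu, forall x, P x}.
Proof.
have F : Filter (almost_everywhere mu) := ae_filter_ringOfSetsType mu.
by move=> PT; exact: (@filterE _ _ F).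
Qed.

Lemma cell_indexP (T : R) n x : 0 < T -> 0 <= x <= T ->
  let k := cell_index T n x in
  [/\ (0 < k <= n.+1)%N, k.-1%:R * (T / n.+1%:R) <= x
    & x <= k%:R * (T / n.+1%:R)].
Proof.
move=> T0 /andP[x0 xT] /=; rewrite /cell_index.
set h := T / _; have h0 : 0 < h by rewrite divr_gt0.
have xh0 : 0 <= x / h by rewrite divr_ge0 // ltW.
have t1 : (Num.truncn (x / h))%:R * h <= x by rewrite -ler_pdivlMr // truncn_le.
have t2 : x < (Num.truncn (x / h)).+1%:R * h by rewrite -ltr_pdivrMr // truncnS_gt.
have hT : n.+1%:R * h = T by rewrite mulrC divfK.
split; first by rewrite leq_min /= geq_minr.
- apply: le_trans t1; rewrite ler_pM2r // ler_nat.
  by rewrite -ltnS prednK ?leq_min // geq_minl.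
- by rewrite /minn; case: ifP => // _; rewrite ?hT // ltW.
Qed.

(* Piecewise constant interpolation of the discrete solutions; the value on the
   negative axis records the slope at 0, so that its limit is extracted together
   with the limit of the solutions. *)
Lemma limit_solution (b : boundary_type) (a g : R -> R) (T r r' : R) n0 :
  0 < T -> 0 < r' -> mu.-integrable setT (EFin \o a) ->
  {within `[0, +oo[, continuous g} -> (forall s, 0 <= s -> 0 <= g s) -> g 0 = 0 ->
  (forall n, (n0 <= n)%N -> exists e, [/\ discrete_bc b n.+1 e,
    forall k, 0 <= e k <= r',
    exists2 k, (0 < k <= n.+1)%N & r <= e k &
    forall k, (0 < k <= n.+1)%N ->
      d2 e k = T / n.+1%:R * (cell a (T / n.+1%:R) k * g (e k))]) ->
  exists u c, let A := itg (fun t => a t * ((g \o u) \_ `[0, T]) t) 0 in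
    [/\ forall x, 0 <= x <= T -> 0 <= u x <= r',
     exists2 x, 0 <= x <= T & r <= u x,
     mu.-integrable setT (EFin \o (fun t => a t * ((g \o u) \_ `[0, T]) t)),
     {in `[0, T], forall x, is_derive_on `[0, T] u x (c - A x)} &
     A T = 0 /\ if b is Periodic then u T = u 0 else c = 0].
Proof.
move=> T0 r'0 inta gc g0 g00 ex.
pose h n := T / n.+1%:R.
have /choice[e eP] : forall n, exists e, [/\ discrete_bc b n.+1 e,
    forall k, 0 <= e k <= r',
    (n0 <= n)%N -> exists2 k, (0 < k <= n.+1)%N & r <= e k &
    forall k, (0 < k <= n.+1)%N ->
      d2 e k = h n * (cell a (h n) k * g (e k))].
  move=> n; have [/ex[e [h1 h2 h3 h4]]|nn] := leqP n0 n.
    by exists e; split.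
  (* Below [n0] the zero sequence fills in; it solves the equation since [g 0 = 0]. *)
  exists (fun=> 0); split; [by case: (b)|by move=> _; rewrite lexx ltW| |].
  - by [].
  - by move=> k _; rewrite g00 /d2; ring.
have r'0' : 0 <= r' by exact: ltW.
have gcr : {within `[0, r'], continuous g}.
  by apply: continuous_subspaceW gc; apply: subset_itvl; rewrite bnd_simp.
have [G G0 gG] := segment_bounded r'0' gcr.
have h0 n : 0 < h n by rewrite divr_gt0.
have hT n : n.+1%:R * h n = T by rewrite mulrC divfK.
pose M := itg (fun t => `|a t|) 0 T.
have M0 : 0 <= M by apply: Rintegral_ge0.
pose C := 2 * (M * G); have C0 : 0 <= C by rewrite !mulr_ge0 // ltW.
have geB n k : `|g (e n k)| <= G by have [_ /(_ k)] := eP n; move=> ? _ _; exact: gG.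
have slope n k : (k <= n.+1)%N -> `|e n k.+1 - e n k| <= h n * C.
  move=> kn; have [bc _ _ eqn] := eP n; apply: le_trans (slope_le _ bc kn) _ => //.
  rewrite mulrCA ler_pM2l //.
  apply: (@le_trans _ _ (\sum_(1 <= k < n.+2) h n * (`|cell a (h n) k| * G))).
    rewrite big_nat [leRHS]big_nat; apply: ler_sum => i /eqn ->.
    by rewrite normrM (gtr0_norm (h0 n)) ler_pM2l // normrM ler_wpM2l.
  rewrite -mulr_sumr ler_pM2l // -mulr_suml ler_pM2r //.
  exact: sum_norm_cell (ltW (h0 n)) (hT n).
have lip n i j : (i <= j <= n.+2)%N -> `|e n j - e n i| <= h n * C * (j - i)%:R.
  exact: (lipschitz_nat (slope n)).
pose U n x := if x < 0 then (e n 1%N - e n 0%N) / h n else e n (cell_index T n x).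
have UN n : U n (- 1) = (e n 1%N - e n 0%N) / h n by rewrite /U ltrN10.
have UE n x : 0 <= x -> U n x = e n (cell_index T n x).
  by move=> x0; rewrite /U ltNge x0.
have slope0 n : `|(e n 1%N - e n 0%N) / h n| <= C.
  by rewrite normrM normfV (gtr0_norm (h0 n)) ler_pdivrMr // mulrC slope.
have Ub n x : `|U n x| <= r' + C.
  rewrite /U; case: ifP => _; first by apply: le_trans (slope0 n) _; rewrite lerDr.
  by have [_ /(_ (cell_index T n x))/andP[? ?] _ _] := eP n;
    rewrite ger0_norm // ler_wpDr.
have near_cells n (k l : nat) (d : R) : (0 < k <= n.+1)%N -> (0 < l <= n.+1)%N ->
    (l%:R - k%:R) * h n <= d -> (k%:R - l%:R) * h n <= d -> `|e n l - e n k| <= C * d.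
  move=> /andP[k0 kn] /andP[l0 ln] d1 d2.
  have [kl|/ltnW lk] := leqP k l.
    apply: (le_trans (lip n k l _)); first by rewrite kl leqW.
    rewrite natrB // (_ : _ * _ = C * ((l%:R - k%:R) * h n)); last by ring.
    exact: ler_wpM2l.
  rewrite distrC; apply: (le_trans (lip n l k _)); first by rewrite lk leqW.
  rewrite natrB // (_ : _ * _ = C * ((k%:R - l%:R) * h n)); last by ring.
  exact: ler_wpM2l.
have predE (k : nat) (H : R) : (0 < k)%N -> k%:R * H = k.-1%:R * H + H.
  by move=> k0; rewrite -[in LHS](prednK k0) -natr1 mulrDl mul1r.
have Ulip n x y : 0 <= x <= T -> 0 <= y <= T ->
    `|U n y - U n x| <= C * (`|y - x| + T / n.+1%:R).
  move=> xT yT; have /andP[x0 _] := xT; have /andP[y0 _] := yT.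
  have [k1 k2 k3] := cell_indexP n T0 xT; have [l1 l2 l3] := cell_indexP n T0 yT.
  rewrite !UE //; apply: near_cells => //.
    have /andP[lp _] := l1; have := predE _ (h n) lp; have := ler_norm (y - x).
    by rewrite -/(h n) in k3 l2 *; clear -k3 l2; lra.
  have /andP[kp _] := k1; have := predE _ (h n) kp; have := ler_norm (x - y).
  by rewrite distrC -/(h n) in k2 l3 *; clear -k2 l3; lra.
have [u uP] := cluster_uniform T0 C0 Ub Ulip.
pose c := u (- 1).
have mesh d : 0 < d -> exists n1, forall n, (n1 <= n)%N -> h n <= d.
  move=> d0; exists (Num.truncn (T / d)) => n dn.
  rewrite ler_pdivrMr ?ltr0n // mulrC -ler_pdivrMr //.
  by apply/ltW/(lt_le_trans (truncnS_gt _)); rewrite ler_nat.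
have UA zeta : 0 < zeta -> exists n, [/\ (n0 <= n)%N, h n <= zeta,
    `|(e n 1%N - e n 0%N) / h n - c| <= zeta &
    forall x, 0 <= x <= T -> `|U n x - u x| <= zeta].
  move=> z0; have [n1 n1P] := mesh _ z0.
  have [n] := uP zeta (maxn n0 n1) z0; rewrite geq_max => /andP[nn0 nn1] [hc hu].
  by exists n; split=> //; [exact: n1P|rewrite -UN].
have ulip x y : 0 <= x <= T -> 0 <= y <= T -> `|u y - u x| <= C * `|y - x|.
  move=> xT yT; apply/ler_addgt0Pr => d d0.
  pose z := d / (C + 2); have z0 : 0 < z by rewrite divr_gt0 // ltr_wpDl.
  have zE : z * (C + 2) = d by rewrite divfK // gt_eqF // ltr_wpDl.
  have [n [_ hz _ uz]] := UA _ z0.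
  have h1 := Ulip n x y xT yT; have h2 := uz _ xT; have h3 := uz _ yT.
  have h4 := ler_wpM2l C0 hz.
  rewrite (_ : u y - u x = (U n y - U n x) - (U n y - u y) + (U n x - u x));
    last by ring.
  have h5 := ler_normD (U n y - U n x - (U n y - u y)) (U n x - u x).
  have h6 := ler_normB (U n y - U n x) (U n y - u y).
  by rewrite -/(h n) in h1; clear -h1 h2 h3 h4 h5 h6 zE; lra.
have uB x : 0 <= x <= T -> 0 <= u x <= r'.
  move=> xT; suff H zeta : 0 < zeta -> - zeta <= u x <= r' + zeta.
    apply/andP; split; apply/ler_addgt0Pr => z /H; first by clear; lra.
    by case/andP.
  move=> /UA[n [_ _ _ /(_ _ xT)]]; rewrite UE; last by case/andP: xT.
  have [_ /(_ (cell_index T n x))/andP[h1 h2] _ _] := eP n.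
  by rewrite ler_norml => /andP[h3 h4]; clear -h1 h2 h3 h4; apply/andP; split; lra.
have T0' : 0 <= T by exact: ltW.
have uc : {within `[0, T], continuous u}.
  apply/within_continuousP => x; rewrite /= in_itv /= => xT eps eps0.
  have C1 : 0 < C + 1 by rewrite ltr_wpDl.
  exists (eps / (C + 1)); first by rewrite divr_gt0.
  move=> y; rewrite in_itv /= => yT yx; apply: le_lt_trans (ulip _ _ xT yT) _.
  apply: (@le_lt_trans _ _ ((C + 1) * `|y - x|)); first by rewrite ler_wpM2r // lerDl.
  by rewrite mulrC -ltr_pdivlMr.
have guc : {within `[0, T], continuous (g \o u)}.
  apply/within_continuousP => x; rewrite /= in_itv /= => xT eps eps0.
  have [|d d0 Hd] := (within_continuousP _ _).1 gcr (u x) _ _ eps0.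
    by rewrite /= in_itv /= uB.
  have [|d' d'0 Hd'] := (within_continuousP _ _).1 uc x _ _ d0.
    by rewrite /= in_itv.
  exists d' => // y yT yx; apply: Hd; last exact: Hd'.
  by move: yT; rewrite /= !in_itv /= => /uB.
have intf := integrable_mul_continuous T0' inta guc.
set f := (fun t => a t * _) in intf.
pose A := itg f 0.
(* At the right end of the cell [cell_index T n t] may differ from [j], by at most one; hence the
   term [C * h n]. *)
have cellC n (j : nat) (zeta t : R) : (0 < j <= n.+1)%N ->
    (forall x, 0 <= x <= T -> `|U n x - u x| <= zeta) ->
    j.-1%:R * h n < t <= j%:R * h n -> `|e n j - u t| <= C * h n + zeta.
  move=> jn Uz /andP[t1 t2]; have /andP[j0 jn'] := jn.
  have tT : 0 <= t <= T.
    rewrite (le_trans _ (ltW t1)) ?mulr_ge0 ?(ltW (h0 n)) //= (le_trans t2) //.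
    by rewrite -(hT n) ler_pM2r // ler_nat.
  have [k1 k2 k3] := cell_indexP n T0 tT; rewrite -/(h n) in k2 k3.
  have := Uz _ tT; rewrite UE; last by case/andP: tT.
  set k := cell_index T n t in k1 k2 k3 *.
  have /andP[kp kn] := k1; have pk := predE k (h n) kp; have pj := predE j (h n) j0.
  have kj : `|e n j - e n k| <= C * h n.
    apply: near_cells => //; first by clear -t1 k3 pj; lra.
    rewrite (_ : _ * _ = (k%:R * h n - j%:R * h n)); last by ring.
    by clear -k2 t2 pk; lra.
  move=> h1; rewrite (_ : _ - _ = (e n j - e n k) + (e n k - u t)); last by ring.
  exact: le_trans (ler_normD _ _) (lerD kj h1).
have [x0 x0T x0r] : exists2 x, 0 <= x <= T & r <= u x.
  (* The maximum point of [u] spares following the nodes where the discrete solutions reach [r]. *)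
  have [x xT xmax] := EVT_max T0' uc.
  rewrite in_itv /= in xT; exists x => //; apply/ler_addgt0Pr => d d0.
  pose z := d / (C + 1); have z0 : 0 < z by rewrite divr_gt0 // ltr_wpDl.
  have zE : z * (C + 1) = d by rewrite divfK // gt_eqF // ltr_wpDl.
  have [n [nn0 hz _ uz]] := UA _ z0.
  have [_ _ /(_ nn0)[k kn rk] _] := eP n.
  have [k0 kn'] : (0 < k)%N /\ (k <= n.+1)%N by apply/andP.
  have kT : k%:R * h n \in `[0, T].
    rewrite in_itv /= mulr_ge0 ?(ltW (h0 n)) //= -(hT n) ler_pM2r // ler_nat //.
  have := cellC n k z (k%:R * h n) kn uz; rewrite lexx (predE _ _ k0) ltrDl h0.
  rewrite -(predE _ _ k0) => /(_ isT); rewrite ler_norml => /andP[_ h1].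
  have h2 := xmax _ kT; have h3 := ler_wpM2l C0 hz.
  by clear -rk h1 h2 h3 zE; lra.
(* On each cell [g (e n j)] is within [eta / (M + 1)] of [g (u t)], and these errors are weighted by
   the absolute value of [a], of integral [M]. *)
have sums eta : 0 < eta -> exists2 zeta : R, 0 < zeta & forall n, h n <= zeta ->
    (forall x, 0 <= x <= T -> `|U n x - u x| <= zeta) ->
    forall k, (k <= n.+1)%N ->
    `|\sum_(1 <= j < k.+1) cell a (h n) j * g (e n j) - A (k%:R * h n)| <= eta.
  move=> eta0; have M1 : 0 < M + 1 by rewrite ltr_wpDl.
  have eta'0 : 0 < eta / (M + 1) by rewrite divr_gt0.
  have [d d0 Hd] := segment_unif_continuous r'0' gcr eta'0.
  have C2 : 0 < 2 * (C + 1) by rewrite mulr_gt0 // ltr_wpDl.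
  exists (d / (2 * (C + 1))); first by rewrite divr_gt0.
  set zeta := d / _; have zetaE : zeta * (2 * (C + 1)) = d by rewrite divfK // gt_eqF.
  move=> n hz Uz k kn.
  have intna : mu.-integrable setT (EFin \o (fun t => eta / (M + 1) * `|a t|)).
    exact: (integrableZl measurableT (eta / (M + 1)) (integrable_norm inta)).
  have one j : (0 < j <= n.+1)%N ->
    `|cell a (h n) j * g (e n j) - itg f (j.-1%:R * h n) (j%:R * h n)|
      <= eta / (M + 1) * cell (fun t => `|a t|) (h n) j.
    move=> jn.
    have intga : mu.-integrable setT (EFin \o (fun t => g (e n j) * a t)).
      exact: (integrableZl measurableT (g (e n j)) inta).
    rewrite /cell mulrC -itgZ // -itgB // -itgZ; last exact: integrable_norm.
    apply: le_trans (itg_norm _ _ (integrableB measurableT intga intf)) _.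
    apply: le_itg => //; first exact: integrable_norm
      (integrableB measurableT intga intf).
    apply: aeT => t; rewrite in_itv /= => tj.
    have /andP[j0 jn'] := jn.
    have tT : 0 <= t <= T.
      case/andP: tj => t1 t2.
      rewrite (le_trans _ (ltW t1)) ?mulr_ge0 ?(ltW (h0 n)) //= (le_trans t2) //.
      by rewrite -(hT n) ler_pM2r // ler_nat.
    rewrite /f patchE mem_set /= ?in_itv //= mulrC -mulrBr normrM mulrC ler_wpM2r //.
    apply/ltW/Hd; [exact: uB| |]; first by have [_ /(_ j)] := eP n.
    have h1 := cellC n j _ _ jn Uz tj; have h2 := ler_wpM2l C0 hz.
    apply: le_lt_trans h1 _.
    by have := h0 n; clear -h2 zetaE d0 hz; lra.
  rewrite /A -[X in itg f X](mul0r (h n)) -(itg_sum intf (ltW (h0 n)) (leq0n k)) -sumrB.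
  apply: le_trans (ler_norm_sum _ _ _) _.
  apply: (@le_trans _ _ (\sum_(1 <= j < k.+1) eta / (M + 1) * cell
    (fun t => `|a t|) (h n) j)).
    rewrite big_nat [leRHS]big_nat; apply: ler_sum => j /andP[j0 jk]; apply: one.
    by rewrite j0 (leq_trans _ kn).
  have E : eta / (M + 1) * (M + 1) = eta by rewrite divfK // gt_eqF.
  rewrite -mulr_sumr -[leRHS]E.
  rewrite ler_pM2l //.
  apply: (@le_trans _ _ (\sum_(1 <= j < n.+2) cell (fun t => `|a t|) (h n) j)).
    rewrite [leRHS](@big_cat_nat _ _ _ k.+1) //= lerDl.
    by apply: sumr_ge0 => j _; apply: Rintegral_ge0.
  rewrite (sum_cell (integrable_norm inta) (ltW (h0 n)) (hT n)) -/M.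
  by rewrite lerDl.
(* The limit of [sum_d2]; it gives [u'] the same value [c] at both ends. *)
have AT : A T = 0.
  apply/eqP; rewrite -normr_le0; apply/ler_addgt0Pr => d d0; rewrite add0r.
  have [zeta z0 Hz] := sums _ d0; have [n [_ hz _ uz]] := UA _ z0.
  have := Hz n hz uz n.+1 (leqnn _); rewrite hT.
  have [bc _ _ eqn] := eP n.
  suff -> : \sum_(1 <= j < n.+2) cell a (h n) j * g (e n j) = 0.
    by rewrite sub0r normrN.
  have E : \sum_(1 <= j < n.+2) d2 (e n) j =
      \sum_(1 <= j < n.+2) h n * (cell a (h n) j * g (e n j)).
    by apply: eq_big_nat => j; exact: eqn.
  have := sum_d2 bc; rewrite E -mulr_sumr => /eqP.
  by rewrite mulf_eq0 gt_eqF ?h0 //= => /eqP.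
(* Each increment of [e n] is the first one minus [h n] times a partial sum, thus close to
   [h n * (c - A z)] up to the variation [w] of [A]; the increments between [x] and [y] add up to
   that of [u] in the limit. *)
have key x y z w : 0 <= x -> x < y -> y <= T -> 0 <= z <= T -> 0 <= w ->
    (forall s, x <= s <= y -> `|A s - A z| <= w) ->
    `|u y - u x - (c - A z) * (y - x)| <= w * (y - x).
  move=> x0' xy yT zT w0 Aw; apply/ler_addgt0Pr => d d0.
  have xT : 0 <= x <= T by rewrite x0' (le_trans (ltW xy)).
  have yT' : 0 <= y <= T by rewrite yT (le_trans x0') // ltW.
  (* [W] collects the coefficients of the error [q], the quadratic term being bounded with
     [q <= 1]. *)
  set B := c - A z; pose W := 4 + 2 * (y - x) + w + `|B|.
  have W0 : 0 < W by have := normr_ge0 B; rewrite /W; clear -xy w0; lra.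
  pose q := Num.min 1 (d / W).
  have q0 : 0 < q by rewrite lt_min ltr01 divr_gt0.
  have q1 : q <= 1 by rewrite ge_min lexx.
  have qW : q * W <= d by rewrite -ler_pdivlMr // ge_min lexx orbT.
  clearbody q; have [zs zs0 Hs] := sums _ q0.
  have mq : 0 < Num.min q zs by rewrite lt_min q0.
  have [n [_ hz cz uz]] := UA _ mq.
  have hq : h n <= q by apply: le_trans hz _; rewrite ge_min lexx.
  have hzs : h n <= zs by apply: le_trans hz _; rewrite ge_min lexx orbT.
  have cq : `|(e n 1%N - e n 0%N) / h n - c| <= q.
    by apply: le_trans cz _; rewrite ge_min lexx.
  have uq t : 0 <= t <= T -> `|U n t - u t| <= q.
    by move=> /uz/le_trans; apply; rewrite ge_min lexx.
  have uzs t : 0 <= t <= T -> `|U n t - u t| <= zs.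
    by move=> /uz/le_trans; apply; rewrite ge_min lexx orbT.
  have {}Hs := Hs n hzs uzs.
  have [k1 k2 k3] := cell_indexP n T0 xT; have [l1 l2 l3] := cell_indexP n T0 yT'.
  have hux := uq _ xT; have huy := uq _ yT'.
  rewrite UE // in hux; rewrite UE ?(le_trans x0' (ltW xy)) // in huy.
  rewrite -/(h n) in k2 k3 l2 l3.
  set k := cell_index T n x in k1 k2 k3 hux.
  set l := cell_index T n y in l1 l2 l3 huy.
  have /andP[kp kn] := k1; have /andP[lp ln] := l1; have hn := h0 n.
  have pk := predE k (h n) kp; have pl := predE l (h n) lp.
  have kl : (k <= l)%N.
    rewrite leqNgt; apply/negP => lk.
    have : l%:R * h n <= k.-1%:R * h n.
      by rewrite ler_pM2r // ler_nat -ltnS prednK.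
    by clear -k2 l3 xy; lra.
  have inc i : (k <= i < l)%N ->
      `|e n i.+1 - e n i - h n * B| <= h n * (2 * q + w).
    move=> /andP[ki il]; have [_ _ _ eqn] := eP n.
    have iN : (i <= n.+1)%N by rewrite (leq_trans (ltnW il)).
    have xi : x <= i%:R * h n by rewrite (le_trans k3) // ler_pM2r // ler_nat.
    have iy : i%:R * h n <= y.
      by apply: le_trans l2; rewrite ler_pM2r // ler_nat -ltnS prednK.
    have HA : `|A (i%:R * h n) - A z| <= w by apply: Aw; rewrite xi.
    have HS := Hs i iN.
    set S := \sum_(1 <= j < i.+1) _ in HS.
    have -> : e n i.+1 - e n i = (e n 1%N - e n 0%N) - h n * S.
      rewrite slopeE /S mulr_sumr; congr (_ - _).
      rewrite big_nat [RHS]big_nat; apply: eq_bigr => j /andP[j1 ji].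
      by apply: eqn; rewrite j1 (leq_trans _ iN).
    have -> : e n 1%N - e n 0%N = h n * ((e n 1%N - e n 0%N) / h n).
      by rewrite mulrC divfK // gt_eqF.
    rewrite -!mulrBr normrM (gtr0_norm hn) ler_pM2l // /B.
    move: ((e n 1%N - e n 0%N) / h n) cq => cn cq.
    rewrite (_ : _ - _ = (cn - c) - (S - A (i%:R * h n)) - (A (i%:R * h n) - A z)).
      have n1 := ler_normB (cn - c - (S - A (i%:R * h n))) (A (i%:R * h n) - A z).
      have n2 := ler_normB (cn - c) (S - A (i%:R * h n)).
      by clear -n1 n2 cq HS HA; lra.
    by clear; ring.
  have tot : `|e n l - e n k - (l%:R - k%:R) * (h n * B)| <=
      (l%:R - k%:R) * (h n * (2 * q + w)).
    move: (h n * (2 * q + w)) (h n * B) inc => X Y inc.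
    rewrite -(telescope_sumr (e n) kl) -natrB // !mulr_natl -!sumr_const_nat -sumrB.
    apply: le_trans (ler_norm_sum _ _ _) _.
    by rewrite big_nat [leRHS]big_nat; apply: ler_sum => i; exact: inc.
  set D := (l%:R - k%:R) * h n.
  have DE : D = l%:R * h n - k%:R * h n by rewrite /D mulrBl.
  have D1 : D <= y - x + h n by rewrite DE; clear -k3 l2 pl; lra.
  have D2 : y - x - h n <= D by rewrite DE; clear -k2 l3 pk; lra.
  have {}tot : `|e n l - e n k - D * B| <= D * (2 * q + w).
    by rewrite /D -[_ * B]mulrA -[_ * (2 * q + w)]mulrA.
  clearbody D.
  rewrite (_ : u y - u x - B * (y - x) = (e n l - e n k - D * B) -
    (e n l - u y) + (e n k - u x) + (D - (y - x)) * B); last by clear; ring.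
  have n1 := ler_normD (e n l - e n k - D * B - (e n l - u y) + (e n k - u x))
    ((D - (y - x)) * B).
  have n2 := ler_normD (e n l - e n k - D * B - (e n l - u y)) (e n k - u x).
  have n3 := ler_normB (e n l - e n k - D * B) (e n l - u y).
  have n4 : `|(D - (y - x)) * B| <= q * `|B|.
    rewrite normrM ler_wpM2r // ler_norml.
    by clear -D1 D2 hq; apply/andP; split; lra.
  have n5 : D * (2 * q + w) <= (y - x + q) * (2 * q + w).
    by rewrite ler_wpM2r //; clear -D1 hq q0 w0; lra.
  have n6 : q * q <= q * 1 by rewrite ler_pM2l.
  rewrite /W in qW.
  by clear -n1 n2 n3 n4 n5 n6 qW hux huy tot; lra.
have Ac (eps : R) : 0 < eps -> exists2 d : R, 0 < d & forall s t, 0 <= s <= T ->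
    0 <= t <= T -> `|t - s| < d -> `|A t - A s| <= eps.
  move=> eps0; have [d d0 Hd] := itg_small intf eps0; exists d => // s t.
  wlog st : s t / s <= t.
    move=> W sT tT; have [st|/ltW ts] := leP s t; first exact: W.
    by rewrite distrC => ?; rewrite distrC; exact: W.
  move=> /andP[s0 _] _; rewrite ger0_norm ?subr_ge0 // => /(Hd _ _ st) lt.
  rewrite /A -(itg_add intf (x := 0) (y := s) (z := t)) ?s0 // addrC addKr.
  exact: le_trans (itg_norm _ _ intf) (ltW lt).
exists u, c; split=> //; first by exists x0.
- move=> x; rewrite in_itv /= => xT; apply/is_derive_onP => eps eps0.
  have [d d0 Hd] := Ac _ eps0; exists d => // y; rewrite /= in_itv /= => yT yx.
  have /andP[x0' xT'] := xT; have /andP[y0' yT'] := yT.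
  have [xy|yx'|<-] := ltgtP x y.
  + rewrite [`|y - x|]gtr0_norm ?subr_gt0 //; apply: key => //; first exact: ltW.
    move=> s /andP[xs sy]; apply: Hd => //; first by rewrite (le_trans x0') //
      (le_trans sy).
    rewrite ger0_norm ?subr_ge0 //; apply: le_lt_trans yx.
    by rewrite ger0_norm ?subr_ge0 ?(ltW xy) // lerB.
  + rewrite [`|y - x|]ltr0_norm ?subr_lt0 // opprB.
    have -> : u y - u x - (c - A x) * (y - x) =
        - (u x - u y - (c - A x) * (x - y)) by ring.
    rewrite normrN.
    apply: key => //; first exact: ltW.
    move=> s /andP[ys sx]; apply: Hd => //; first by rewrite (le_trans y0') //
      (le_trans sx).
    rewrite ler0_norm ?subr_le0 // opprB; apply: le_lt_trans yx.
    by rewrite ler0_norm ?subr_le0 ?(ltW yx') // opprB lerB.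
  + by rewrite !subrr mulr0 subr0 normr0 mulr0.
- split; first exact: AT.
  have small v : (forall z, 0 < z -> `|v| <= z) -> v = 0 :> R.
    move=> H; apply/eqP; rewrite -normr_le0; apply/ler_addgt0Pr => z z0.
    by rewrite add0r H.
  case: b eP {ex} => eP; apply: small || (apply/eqP; rewrite -subr_eq0;
    apply/eqP/small) => z z0.
  + have [n [_ _ + _]] := UA _ z0; have [[-> _] _ _ _] := eP n.
    by rewrite subrr mul0r sub0r normrN.
  + have C2 : 0 < C + 2 by rewrite ltr_wpDl.
    have z'0 : 0 < z / (C + 2) by rewrite divr_gt0.
    have [n [_ hz _ uz]] := UA _ z'0; have [[E0 _] _ _ _] := eP n.
    have zE : z / (C + 2) * (C + 2) = z by rewrite divfK // gt_eqF.
    move: (z / (C + 2)) zE hz uz {z'0} => z' zE hz uz.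
    have T00 : 0 <= (0 : R) <= T by rewrite lexx.
    have TT0 : 0 <= T <= T by rewrite lexx T0'.
    have := uz _ T00; have := uz _ TT0; rewrite !UE //.
    have [/andP[k1 _] k2 _] := cell_indexP n T0 T00.
    have [/andP[_ l1] _ l2] := cell_indexP n T0 TT0.
    have -> : cell_index T n 0 = 1%N.
      rewrite -(prednK k1); congr _.+1; apply/eqP.
      by move: k2; rewrite pmulr_lle0 ?(h0 n) // lern0.
    have -> : cell_index T n T = n.+1.
      apply/eqP; rewrite eqn_leq l1 /= -(ler_nat R) -(ler_pM2r (h0 n)) hT.
      exact: l2.
    have := slope n 0%N isT; rewrite E0.
    have hC := ler_wpM2r C0 hz.
    rewrite (_ : u T - u 0 = - (e n n.+1 - u T) + (e n 1%N - u 0) -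
      (e n 1%N - e n n.+1)); last by ring.
    move=> s1 s2 s3.
    have n1 := ler_normB (- (e n n.+1 - u T) + (e n 1%N - u 0)) (e n 1%N - e n n.+1).
    have n2 := ler_normD (- (e n n.+1 - u T)) (e n 1%N - u 0).
    rewrite normrN in n2.
    by clear -s1 s2 s3 n1 n2 hC zE; lra.
Qed.
End limit.

(** * Positivity of the limit *)

Section positivity.
Variable R : realType.
Local Notation mu := (leb R).

Lemma sublinear_bound (g : R -> R) (S : R) :
  {within `[0, +oo[, continuous g} -> g 0 = 0 ->
  g s / s @[s --> 0^'+] --> 0 -> 0 <= S ->
  exists2 K : R, 0 <= K & forall s, 0 <= s <= S -> g s <= K * s.
Proof.
move=> gc g00 gsub S0; have [d d0 Hd] := sublinear_near0 gsub ltr01.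
have gcS : {within `[0, S], continuous g}.
  by apply: continuous_subspaceW gc; apply: subset_itvl; rewrite bnd_simp.
have [G G0 HG] := segment_bounded S0 gcS.
exists (1 + G / d); first by rewrite addr_ge0 // divr_ge0 // ltW.
move=> s /andP[]; rewrite le_eqVlt => /predU1P[<- _|s0 sS].
  by rewrite g00 mulr0.
have [sd|ds] := ltP s d.
  apply: le_trans (Hd s _) _; first by rewrite s0.
  by rewrite ler_pM2r // lerDl divr_ge0 // ltW.
apply: le_trans (ler_norm _) (le_trans (HG s _) _); first by rewrite (ltW s0).
apply: (@le_trans _ _ (G / d * s)); last by rewrite ler_pM2r // lerDr.
by rewrite mulrAC ler_pdivlMr // ler_pM2l.
Qed.

Lemma derive_at_zero (u : R -> R) (T z d : R) : 0 <= z <= T ->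
  (forall x, 0 <= x <= T -> 0 <= u x) -> u z = 0 -> is_derive_on `[0, T] u z d ->
  (z < T -> 0 <= d) /\ (0 < z -> d <= 0).
Proof.
move=> /andP[z0 zT] u0 uz /is_derive_onP H; split=> zlt.
- rewrite leNgt; apply/negP => d0.
  have [|eta eta0 He] := H (- d / 2); first by rewrite divr_gt0 // oppr_gt0.
  pose y := Num.min T (z + eta / 2).
  have zy : z < y by rewrite lt_min zlt ltrDl divr_gt0.
  have yT : y <= T by rewrite ge_min lexx.
  have ye : y <= z + eta / 2 by rewrite ge_min lexx orbT.
  clearbody y; have y0T : 0 <= y <= T by rewrite yT (le_trans z0) // ltW.
  have := He y; rewrite /= in_itv /= y0T uz subr0 gtr0_norm ?subr_gt0 //.
  have ye' : y - z < eta by clear -ye eta0; lra.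
  move=> /(_ isT ye') /(le_trans (ler_norm _)); have := u0 _ y0T.
  have : d * (y - z) < 0 by rewrite nmulr_rlt0 ?subr_gt0.
  by clear; move=> h1 h2 h3; lra.
- rewrite leNgt; apply/negP => d0.
  have [|eta eta0 He] := H (d / 2); first by rewrite divr_gt0.
  pose y := Num.max 0 (z - eta / 2).
  have zy : y < z by rewrite gt_max zlt gtrDl oppr_lt0 divr_gt0.
  have yT : 0 <= y by rewrite le_max lexx.
  have ye : z - eta / 2 <= y by rewrite le_max lexx orbT.
  clearbody y; have y0T : 0 <= y <= T by rewrite yT (le_trans _ zT) // ltW.
  have := He y; rewrite /= in_itv /= y0T uz subr0 ltr0_norm ?subr_lt0 // opprB.
  have ye' : z - y < eta by clear -ye eta0; lra.
  move=> /(_ isT ye') /(le_trans (ler_norm _)); have := u0 _ y0T.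
  have : 0 < d * (z - y) by rewrite mulr_gt0 // subr_gt0.
  by clear; move=> h1 h2 h3; lra.
Qed.

(* At a zero the derivative vanishes as well; since [g s <= K s], the solution
   then vanishes on a neighbourhood whose size does not depend on the zero. *)
Lemma solution_positive (b : boundary_type) (a g u : R -> R) (T K r c : R) :
  let f := fun t => a t * ((g \o u) \_ `[0, T]) t in let A := itg f 0 in
  0 < T -> mu.-integrable setT (EFin \o a) -> mu.-integrable setT (EFin \o f) ->
  0 <= K -> (forall x, 0 <= x <= T -> 0 <= g (u x) <= K * u x) ->
  (forall x, 0 <= x <= T -> 0 <= u x) -> 0 < r ->
  (exists2 x, 0 <= x <= T & r <= u x) ->
  {in `[0, T], forall x, is_derive_on `[0, T] u x (c - A x)} ->
  A T = 0 -> (if b is Periodic then u T = u 0 else c = 0) ->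
  forall x, 0 <= x <= T -> 0 < u x.
Proof.
move=> f A T0 inta intf K0 gK u0 r0 [x0 x0T rx0] du AT bc.
have A0 : A 0 = 0 by apply: itg_same.
have T0' := ltW T0.
have du' x : 0 <= x <= T -> is_derive_on `[0, T] u x (c - A x).
  by move=> xT; apply: du; rewrite in_itv.
(* An interior zero is a minimum. At an end the Neumann condition gives slope zero directly; in the
   periodic case both ends are zeros with the same slope [c], nonnegative seen from 0 and
   nonpositive seen from [T]. *)
have zero_deriv z : 0 <= z <= T -> u z = 0 -> c - A z = 0.
  move=> zT uz; have [h1 h2] := derive_at_zero zT u0 uz (du' z zT).
  have /andP[z0 zT'] := zT.
  move: z0; rewrite le_eqVlt => /predU1P[z0|z0].
  - case: b bc => bc; last first.
      have uT : u T = 0 by rewrite bc; move: uz; rewrite -z0.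
      have TT : 0 <= T <= T by rewrite T0' lexx.
      have [_ /(_ T0)] := derive_at_zero TT u0 uT (du' T TT).
      move: h1; rewrite -z0 => /(_ T0); rewrite AT A0 subr0 => h3 h4.
      by apply/eqP; rewrite eq_le h3 h4.
    by rewrite -z0 bc A0 subrr.
  - move: zT'; rewrite le_eqVlt => /predU1P[zT'|zT']; last first.
      by apply/eqP; rewrite eq_le h1 // h2.
    case: b bc => bc; first by rewrite zT' bc AT subrr.
    have u00 : u 0 = 0 by rewrite -bc -zT'.
    have T00 : 0 <= (0 : R) <= T by rewrite lexx.
    have [/(_ T0) h3 _] := derive_at_zero T00 u0 u00 (du' 0 T00).
    move: h2 h3; rewrite zT' AT A0 subr0 => /(_ T0) h2 h3.
    by apply/eqP; rewrite eq_le h3 h2.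
pose M := itg (fun t => `|a t|) 0 T.
have M0 : 0 <= M by apply: Rintegral_ge0.
have KM0 : 0 <= K * M by rewrite mulr_ge0.
pose delta := (2 * (K * M + 1))^-1.
have delta0 : 0 < delta by rewrite invr_gt0 mulr_gt0 // ltr_wpDl.
have deltaE : delta * (2 * (K * M + 1)) = 1.
  by rewrite mulVf // gt_eqF // mulr_gt0 // ltr_wpDl.
clearbody delta.
have uc : {within `[0, T], continuous u} by exact: is_derive_on_continuous du.
have intna : mu.-integrable setT (EFin \o (fun t => `|a t|)).
  exact: integrable_norm.
(* Let [m] be the maximum of [u] on the window around [z]. The slope vanishes at [z], so it is at
   most [K * m * M] in absolute value there, whence [m <= K * m * M * delta]; as
   [K * M * delta < 1/2], this forces [m = 0]. *)
have local z y : 0 <= z <= T -> u z = 0 -> 0 <= y <= T -> `|y - z| <= delta -> u y = 0.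
  move=> zT uz yT yz; have dz := zero_deriv _ zT uz.
  pose l := Num.max 0 (z - delta); pose rr := Num.min T (z + delta).
  have /andP[z0 zT'] := zT; have /andP[y0 yT'] := yT.
  have [yz1 yz2] : z - delta <= y /\ y <= z + delta.
    by move: yz; rewrite ler_norml => /andP[h1 h2]; clear -h1 h2; split; lra.
  have l0 : 0 <= l by rewrite le_max lexx.
  have rT : rr <= T by rewrite ge_min lexx.
  have lz : l <= z by rewrite ge_max z0 gerBl ltW.
  have zr : z <= rr by rewrite le_min zT' lerDl ltW.
  have ly : l <= y by rewrite ge_max y0.
  have yr : y <= rr by rewrite le_min yT'.
  have zl : z - delta <= l by rewrite le_max lexx orbT.
  have rz : rr <= z + delta by rewrite ge_min lexx orbT.
  clearbody l rr; have lr := le_trans lz zr.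
  have ucl : {within `[l, rr], continuous u}.
    by apply: continuous_subspaceW uc; apply: subset_itv; rewrite bnd_simp.
  have [x xI xmax] := EVT_max lr ucl.
  have inT v : l <= v <= rr -> 0 <= v <= T.
    by move=> /andP[lv vr]; rewrite (le_trans l0) // (le_trans vr).
  rewrite in_itv /= in xI; have /andP[lx xr] := xI; set m := u x in xmax.
  have m0 : 0 <= m by exact/u0/inT.
  have itg_le s t : l <= s <= t -> t <= rr -> `|itg f s t| <= K * m * M.
    move=> /andP[ls st] tr; apply: le_trans (itg_norm _ _ intf) _.
    apply: (@le_trans _ _ (itg (fun v => K * m * `|a v|) s t)).
      apply: le_itg => //; first exact: integrable_norm intf.
        exact: (integrableZl measurableT (K * m) intna).
      apply: aeT => v; rewrite in_itv /= => /andP[sv vt].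
      have vI : l <= v <= rr by rewrite (le_trans ls (ltW sv)) (le_trans vt).
      have vT := inT _ vI.
      rewrite /f patchE mem_set /= ?in_itv //= normrM mulrC ler_wpM2r //.
      have /andP[g0 gKu] := gK _ vT; rewrite ger0_norm //; apply: le_trans gKu _.
      by rewrite ler_wpM2l // xmax // in_itv.
    rewrite itgZ // ler_wpM2l ?mulr_ge0 // /M.
    have s0 : 0 <= s := le_trans l0 ls; have tT : t <= T := le_trans tr rT.
    rewrite -(itg_add intna (x := 0) (y := s) (z := T)) ?s0 ?(le_trans st) //.
    rewrite -(itg_add intna (x := s) (y := t) (z := T)) ?st //.
    by rewrite addrCA lerDl; apply: addr_ge0; apply: Rintegral_ge0.
  have A_close v : l <= v <= rr -> `|c - A v| <= K * m * M.
    move=> /andP[lv vr].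
    have -> : c - A v = A z - A v by rewrite -[in LHS](subr0 (c - A v)) -dz; ring.
    have [vz|/ltW zv] := leP v z.
      rewrite /A -(itg_add intf (x := 0) (y := v) (z := z)) ?(le_trans l0 lv) //.
      by rewrite addrC addKr itg_le // lv.
    rewrite distrC /A -(itg_add intf (x := 0) (y := z) (z := v)) ?z0 //.
    by rewrite addrC addKr itg_le // lz.
  have mle : m <= K * m * M * delta.
    have [xz|xz|xz] := ltgtP x z.
    - have [v /andP[xv vz] E] := is_derive_on_MVT du (le_trans l0 lx) xz zT'.
      have vI : l <= v <= rr by rewrite (le_trans lx (ltW xv)) (le_trans (ltW vz)).
      rewrite uz sub0r -/m in E.
      rewrite -[leLHS]opprK E; apply: le_trans (ler_norm _) _.
      rewrite normrN normrM ler_pM ?A_close //.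
      rewrite gtr0_norm ?subr_gt0 //; clear -lx zl; lra.
    - have [v /andP[zv vx] E] := is_derive_on_MVT du z0 xz (le_trans xr rT).
      have vI : l <= v <= rr by rewrite (le_trans lz (ltW zv)) (le_trans (ltW vx)).
      rewrite uz subr0 -/m in E.
      rewrite [leLHS]E; apply: le_trans (ler_norm _) _.
      rewrite normrM ler_pM ?A_close //.
      rewrite gtr0_norm ?subr_gt0 //; clear -xr rz; lra.
    - by rewrite /m xz uz mulr0 !mul0r.
  have m00 : m <= 0.
    have h1 : m * (delta * (2 * (K * M + 1))) = m by rewrite deltaE mulr1.
    have h2 : 0 <= m * delta by rewrite mulr_ge0 // ltW.
    by clear -h1 h2 mle; lra.
  apply/eqP; rewrite eq_le u0 // andbT; apply: le_trans m00.
  by apply: xmax; rewrite in_itv /= ly.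
move=> z zT; rewrite lt_neqAle u0 // andbT; apply/negP => /eqP /esym uz.
(* The zero travels from [z] to [y] in equal steps of length at most [delta]; [z'] is the last stop
   before [y]. *)
have spread n : forall y, 0 <= y <= T -> `|y - z| <= n%:R * delta -> u y = 0.
  elim: n => [|n IH] y yT.
    by rewrite mul0r normr_le0 subr_eq0 => /eqP ->.
  move=> yz; pose z' := z + (y - z) * (n%:R / n.+1%:R).
  have n0 : 0 < n.+1%:R :> R by rewrite ltr0n.
  have q1 : n%:R / n.+1%:R <= 1 :> R by rewrite ler_pdivrMr // mul1r ler_nat.
  have q0 : 0 <= n%:R / n.+1%:R :> R by rewrite divr_ge0.
  have qE : 1 - n%:R / n.+1%:R = n.+1%:R^-1 :> R.
    rewrite -{1}(@divff _ n.+1%:R) ?gt_eqF // -mulrBl -[X in X - _]natr1.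
    by rewrite addrAC subrr add0r mul1r.
  have z'T : 0 <= z' <= T.
    have /andP[z1 z2] := zT; have /andP[y1 y2] := yT.
    rewrite (_ : z' = (1 - n%:R / n.+1%:R) * z + n%:R / n.+1%:R * y); last first.
      by rewrite /z'; ring.
    move: (n%:R / n.+1%:R) q0 q1 => q q0 q1.
    have h1 : 0 <= 1 - q by rewrite subr_ge0.
    rewrite addr_ge0 ?mulr_ge0 //=.
    have h2 := ler_wpM2l h1 z2; have h3 := ler_wpM2l q0 y2.
    by clear -h2 h3; lra.
  have uz' : u z' = 0.
    apply: IH => //; rewrite /z' addrC addKr normrM (ger0_norm q0).
    apply: le_trans (ler_wpM2r q0 yz) _.
    by rewrite mulrAC [n.+1%:R * _]mulrC divfK // gt_eqF.
  apply: (local z') => //.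
  rewrite (_ : y - z' = (y - z) * n.+1%:R^-1); last by rewrite -qE /z'; ring.
  rewrite normrM normfV [X in _ / X]ger0_norm // ler_pdivrMr // mulrC //.
have := spread (Num.truncn (T / delta)).+1 x0 x0T.
have : `|x0 - z| <= (Num.truncn (T / delta)).+1%:R * delta.
  rewrite -ler_pdivrMr //; apply/ltW/le_lt_trans/truncnS_gt.
  rewrite ler_pM2r ?invr_gt0 // ler_norml.
  have /andP[z1 z2] := zT; have /andP[x1 x2] := x0T.
  by clear -z1 z2 x1 x2; apply/andP; split; lra.
move=> h1 /(_ h1) ux0; by move: rx0; rewrite ux0 leNgt r0.
Qed.

(** The infimum of [g s / s] over one neighbourhood of infinity already exceeds the maximum and
    serves as [L], also when the liminf is infinite. An infimum equal to [+oo] is contradictory, the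
    quotients being real. *)
Lemma exists_slope (m : nat) (lam : 'I_m -> R) (g : R -> R) :
  (\big[maxe/-oo%E]_(i < m) (lam i)%:E
     < limf_einf (fun s : R => (g s / s)%R%:E) (pinfty_nbhs R))%E ->
  exists L s0 : R, [/\ forall i, lam i < L, 0 < s0 &
    forall s, s0 <= s -> L * s <= g s].
Proof.
rewrite limf_einfE => /ereal_sup_gt[_ [V [M [_ MV]] <-]] lt.
have [L [maxL LV]] : exists L : R,
    (\big[maxe/-oo%E]_(i < m) (lam i)%:E < L%:E)%E /\
    forall s, V s -> L <= g s / s.
  move: lt; case E : (ereal_inf _) => [l| |] lt; last by rewrite ltNge leNye in lt.
    exists l; split=> // s Vs; rewrite -lee_fin -E; apply: ereal_inf_lbound.
    by exists s.
  exists (\sum_i `|lam i| + 1); split.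
    apply: bigmax_lt => [|i _]; first exact: ltNyr.
    rewrite lte_fin (bigD1 i) //= -addrA; apply: le_lt_trans (ler_norm _) _.
    by rewrite ltrDl ltr_wpDl // sumr_ge0.
  move=> s Vs; have : (ereal_inf [set (g s / s)%:E | s in V] <= (g s / s)%:E)%E.
    by apply: ereal_inf_lbound; exists s.
  by rewrite E leye_eq.
exists L, (Num.max 0 M + 1); split.
- move=> i; rewrite -lte_fin; apply: le_lt_trans maxL.
  exact: (le_bigmax _ (fun i => (lam i)%:E)).
- by rewrite ltr_wpDl // le_max lexx.
- move=> s Ms; have m0 : 0 <= Num.max 0 M by rewrite le_max lexx.
  have mM : M <= Num.max 0 M by rewrite le_max lexx orbT.
  have s0 : 0 < s by apply: lt_le_trans Ms; rewrite ltr_wpDl.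
  rewrite -ler_pdivlMr //; apply/LV/MV; apply: lt_le_trans Ms.
  by rewrite ltr_pwDr.
Qed.

End positivity.

(** * Assembly of the estimates *)

Lemma abs_continuous_continuous (R : realType) (l r : R) (f : R -> R) :
  abs_continuous_on l r f -> {within `[l, r], continuous f}.
Proof.
move=> acf; apply/within_continuousP => x; rewrite /= in_itv /= => xlr eps eps0.
have [d d0 H] := acf _ eps0; exists d => // y; rewrite in_itv /= => ylr yx.
wlog xy : x y xlr ylr yx / x <= y.
  move=> W; have [xy|/ltW yx'] := leP x y; first exact: W.
  by rewrite distrC; apply: W => //; rewrite distrC.
have := H 1%N (fun=> x) (fun=> y); rewrite !big_ord1; apply.
- by move=> _; case/andP: xlr => lx _; case/andP: ylr => _ yr; rewrite lx xy.
- by apply/trivIsetP => i j _ _; rewrite !ord1 eqxx.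
- exact: le_lt_trans (ler_norm _) yx.
Qed.

Theorem theorem3p1 (R : realType) (T : R) (g a : R -> R)
    (m : nat) (al be lam : 'I_m -> R) (b : boundary_type) :
  0 < T ->
  {within `[0, +oo[, continuous g} ->
  g 0 = 0 ->
  (forall s, 0 < s -> 0 < g s) ->
  (@lebesgue_measure R).-integrable `[0, T] (EFin \o a) ->
  (0 < m)%N ->
  (forall i, `[al i, be i] `<=` `[0, T]) ->
  trivIset [set: 'I_m] (fun i => [set` `[al i, be i]]) ->
  (forall i, {ae @lebesgue_measure R, forall x,
     x \in `[al i, be i] -> 0 <= a x}) ->
  (forall i, ~ {ae @lebesgue_measure R, forall x,
     x \in `[al i, be i] -> a x = 0}) ->
  {ae @lebesgue_measure R, forall x,
     x \in `[0, T] -> (forall i, x \notin `[al i, be i]) -> a x <= 0} ->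
  (\int[@lebesgue_measure R]_(x in `[0%R, T]) (a x)%:E < 0)%E ->
  (forall i, is_first_eigenvalue a (al i) (be i) (lam i)) ->
  regularly_oscillating_at0 g ->
  g s / s @[s --> 0^'+] --> 0 ->
  (\big[maxe/-oo%E]_(i < m) (lam i)%:E
     < limf_einf (fun s : R => (g s / s)%R%:E) (pinfty_nbhs R))%E ->
  exists u : R -> R, positive_solution T b a g u.
Proof.
move=> T0 gc g00 gpos inta m0 sub _ a0 _ aneg aint eig gosc gsub glim.
have T0' := ltW T0.
have [L [s0 [lamL s00 gL]]] := exists_slope glim.
(* [a] is arbitrary outside [[0, T]]; its extension by zero is integrable on the line, and neither
   the equations nor the sign conditions see the change. *)
pose A := a \_ `[0, T].
have AE x : x \in `[0, T] -> A x = a x by move=> xT; rewrite /A patchE mem_set.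
have intA : (leb R).-integrable setT (EFin \o A).
  move: (inta); rewrite integrable_mkcond; last exact: measurable_itv.
  by rewrite restrict_EFin.
have al_be i : al i <= be i.
  have [[phi [phi' [_ _ _ [x xi _]]]] _] := eig i.
  by move: xi; rewrite in_itv /= => /andP[] /le_trans h /h.
have albe i : 0 <= al i /\ be i <= T.
  have := sub i (al i); have := sub i (be i).
  rewrite /= !in_itv /= !lexx !al_be => /(_ isT)/andP[_ h1] /(_ isT)/andP[h2 _].
  by [].
have subi i x : x \in `[al i, be i] -> x \in `[0, T] by exact: sub.
have eigA i : is_eigenvalue A (al i) (be i) (lam i).
  have [[phi [phi' [[h1 h2 h3 h4] p1 p2 p3]]] _] := eig i.
  exists phi, phi'; split=> //; split=> //; apply: aeS h4 => x Hx xi.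
  have [w dw wE] := Hx xi; exists w => //.
  by rewrite AE //; exact: subi xi.
have a0A i : {ae leb R, forall x, x \in `[al i, be i] -> 0 <= A x}.
  by apply: aeS (a0 i) => x Hx xi; rewrite AE ?Hx //; exact: subi xi.
have anegA : {ae leb R, forall x, x \in `[0, T] ->
    (forall i, x \notin `[al i, be i]) -> A x <= 0}.
  by apply: aeS aneg => x Hx xT; rewrite AE //; exact: Hx.
have AT0 : itg A 0 T < 0.
  have -> : itg A 0 T = \int[leb R]_(x in `[0, T]) a x.
    rewrite /itg Rintegral_itv_obnd_cbnd; last exact: integrableS intA.
    by apply: eq_Rintegral => x; rewrite inE; exact: AE.
  by rewrite /Rintegral -lte_fin fineK //; exact: integrable_fin_num.
have M0 : 0 <= itg (fun t => `|A t|) 0 T by apply: Rintegral_ge0.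
have g0 s : 0 <= s -> 0 <= g s.
  by rewrite le_eqVlt => /predU1P[<-|/gpos/ltW]; rewrite ?g00.
have [r r0 small] := no_small_solution gosc gsub g00 gpos T0 M0 AT0.
have [r' [N0 [r'0 N00 large poscell]]] := no_large_solution m0 T0 intA a0A albe
  anegA AT0 eigA lamL gL s00 gpos g00.
(* The small radius may be lowered freely, and the expansion of the cone needs it below the large
   one. *)
pose r1 := Num.min r (r' / 2).
have r10 : 0 < r1 by rewrite lt_min r0 divr_gt0.
have r1r : r1 <= r by rewrite ge_min lexx.
have r1r' : r1 < r'.
  have : r1 <= r' / 2 by rewrite ge_min lexx orbT.
  by clear -r'0; lra.
clearbody r1.
have r'1 : 0 <= r' + 1 by rewrite addr_ge0 // ltW.
have [K K0 gK] := sublinear_bound gc g00 gsub r'1.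
have [n nN|u [c [uB ur intf du [AT bcu]]]] :=
  @limit_solution R b A g T r1 r' N0 T0 r'0 intA gc g0 g00.
  have h0 : 0 < T / n.+1%:R by rewrite divr_gt0.
  have hT : n.+1%:R * (T / n.+1%:R) = T by rewrite mulrC divfK.
  have NN := leqW nN.
  apply: (@discrete_solution R b n g (cell A (T / n.+1%:R)) _ r1 r' K) => //.
  - exact: poscell NN hT.
  - move=> kappa e bc eB er kap0; apply: (small b n.+1 _ kappa r1) => //.
    + by rewrite r10.
    + exact: sum_norm_cell (ltW h0) hT.
    + exact: sum_cell (ltW h0) hT.
  - by move=> t e bc e0 t0 eqn; exact: (large b n.+1 _ t e NN hT bc e0 t0 eqn).
have upos : forall x, 0 <= x <= T -> 0 < u x.
  apply: (solution_positive (b := b) (K := K) (r := r1) T0 intA intf K0) => //.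
  - move=> x xT; have /andP[u0 u1] := uB _ xT.
    by rewrite g0 // gK // u0 (le_trans u1) // lerDl.
  - by move=> x /uB/andP[].
  - exact: du.
  - by case: (b) bcu.
exists u; split; last by move=> x; rewrite in_itv /=; exact: upos.
set f := fun t => A t * _ in intf du AT.
have acu : abs_continuous_on 0 T (fun x => c - itg f 0 x).
  by apply: abs_continuousB; [exact: abs_continuous_cst|exact: itg_abs_continuous].
(* With this formula for [u'], its absolute continuity and its derivative almost everywhere are
   those of an integral. *)
exists (fun x => c - itg f 0 x).
  split=> //; first exact: abs_continuous_continuous.
  apply: aeS (aeI (itg_derivable 0 intf) (ae_neq 0)) => x [dx x0] xT.
  exists (0 - f x); last first.
    by rewrite /f AE // patchE mem_set //= sub0r addNr.
  apply: is_derive_onB; first exact: is_derive_is_derive_on.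
  apply/is_derive_is_derive_on/dx; move: xT; rewrite in_itv /= => /andP[h _].
  by rewrite lt_neqAle eq_sym x0.
have A0 : itg f 0 0 = 0 by exact: itg_same.
by case: b bcu {small large} => bcu /=; rewrite A0 AT bcu !subrr.
Qed.
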